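(* Let $p=(p_k)_{k\ge 0}$ be a probability distribution on $\mathbb{N}_0$ with $p_0=0$, $p_1<1$ and $m_{\mathtt{BGW}}:=\sum_{k\ge1}kp_k<\infty$, and let $\omega$ be a Bienaymé–Galton–Watson tree with offspring law $p$ (law $\mathtt{BGW}$). Let $\lambda>0$ and let $\mu=(\mu_k)_{k\ge0}$ be a probability distribution on $\mathbb{N}_0$ with $\mu_0=0$, $\mu_1<1$ and $m:=\sum_{k\ge1}k\mu_k\in(1,\infty)$. Let $(X(u),u\in\mathbb{T})$ be the $\lambda$-biased branching random walk on $\omega$ with reproduction law $\mu$, started from one particle at the root. Then for $\mathtt{BGW}$-a.e. $\omega$, $$\lim_{n\to\infty}\frac1n\max_{|u|=n}|X(u)|=v_{\lambda,m}\qquad \mathbf{P}_\omega\text{-a.s.},$$ where $v_{\lambda,m}:=\sup\{a\in[v_\lambda,1]: I_\lambda(a)\le\log m\}$ is a constant depending only on $\lambda$, $m$ and $p$.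
   Context: Notation: $\varrho$ is the root of $\omega$; for a vertex $x$, $|x|$ is its graph distance to $\varrho$, $x_-$ its parent, $\kappa_x$ its number of children. The $\lambda$-biased random walk $(S_n)_{n\ge0}$ on $\omega$ is the Markov chain started at $S_0=\varrho$ which from $\varrho$ jumps to each child of $\varrho$ with probability $1/\kappa_\varrho$, and from $x\ne\varrho$ jumps to $x_-$ with probability $\lambda/(\lambda+\kappa_x)$ and to each child of $x$ with probability $1/(\lambda+\kappa_x)$; its quenched law is $\mathrm{P}_\omega$ and its annealed law $\mathbb{P}=\int \mathrm{P}_\omega\,\mathtt{BGW}(d\omega)$. The $\lambda$-biased branching random walk: the genealogy $\mathbb{T}$ is a Bienaymé–Galton–Watson tree with offspring law $\mu$ (root $\varnothing$, $|u|$ the generation of $u$), independent of $\omega$; $X(\varnothing)=\varrho$, and given $\omega$, each child of a particle located at $x$ is placed, independently of everything else, at a position chosen according to one step of the $\lambda$-biased random walk from $x$. Its quenched law (given $\omega$) is $\mathbf{P}_\omega$. $v_\lambda\in[0,1]$ denotes the deterministic speed of the $\lambda$-biased walk, i.e. $|S_n|/n\to v_\lambda$ $\mathrm{P}_\omega$-a.s. for $\mathtt{BGW}$-a.e. $\omega$. $I_\lambda:[v_\lambda,1]\to[0,\infty)$ denotes the (continuous, convex, strictly increasing, $I_\lambda(v_\lambda)=0$) large deviation rate function of the walk: for $a\in(v_\lambda,1]$ and $b>a$, $\lim_n\frac1n\log\mathrm{P}_\omega(|S_n|/n\in[a,b))=\lim_n\frac1n\log\mathbb{P}(|S_n|/n\in[a,b))=-I_\lambda(a)$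 for $\mathtt{BGW}$-a.e. $\omega$ (this is known to exist when $\lambda<m_{\mathtt{BGW}}$). *)

(* Defs.v *)
From HB Require Import structures.
From mathcomp Require Import all_boot all_order all_algebra.
From mathcomp Require Import all_classical all_reals all_analysis.
Set Implicit Arguments. Unset Strict Implicit. Unset Printing Implicit Defensive.
Import Order.TTheory GRing.Theory Num.Theory.
Import numFieldNormedType.Exports.
Local Open Scope classical_set_scope.
Local Open Scope ring_scope.

(* ---------- Trees (Ulam--Harris words, child i of x is i :: x) ----------
   A rooted tree is given by its child-count function kappa : seq nat -> nat;
   its vertices are the words reachable from the root [::] by i :: x with
   i < kappa x.  The parent of x <> [::] is behead x, and |x| = size x. *)
Definition tree := seq nat -> nat.

(* One step of the lambda-biased random walk on kappa from x, driven by a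
   uniform [0,1] number u (inverse-transform sampling):
   - at the root: go to child i w.p. 1/kappa(root);
   - elsewhere:   go to the parent w.p. lam/(lam+kappa x), to child i w.p.
                  1/(lam+kappa x). *)
Definition bstep {R : realType} (lam : R) (kappa : tree) (x : seq nat) (u : R)
  : seq nat :=
  let k := kappa x in
  match x with
  | [::] => minn (Num.truncn (u * k%:R)) k.-1 :: x
  | _ :: x' =>
      if u * (lam + k%:R) < lam then x'
      else minn (Num.truncn (u * (lam + k%:R) - lam)) k.-1 :: x
  end.

Fixpoint bwalk {R : realType} {T : Type} (lam : R) (kappa : tree)
  (V : nat -> T -> R) (n : nat) (w : T) : seq nat :=
  match n with
  | 0 => [::]
  | n'.+1 => bstep lam kappa (bwalk lam kappa V n' w) (V n' w)
  end.

(* ---------- Branching random walk ----------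
   Genealogy: particle words, child i of particle u is i :: u; the particle
   u has N u w children.  Position of particle i :: u is one walk step from the
   position of u driven by its own uniform U (i :: u). *)
Fixpoint gen {T : Type} (N : seq nat -> T -> nat) (n : nat) (w : T)
  : seq (seq nat) :=
  match n with
  | 0 => [:: [::]]
  | n'.+1 => flatten [seq [seq i :: u | i <- iota 0 (N u w)] | u <- gen N n' w]
  end.

Fixpoint brw_pos {R : realType} {T : Type} (lam : R) (kappa : tree)
  (U : seq nat -> T -> R) (u : seq nat) (w : T) : seq nat :=
  match u with
  | [::] => [::]
  | i :: u' => bstep lam kappa (brw_pos lam kappa U u' w) (U u w)
  end.

Definition brw_max {R : realType} {T : Type} (lam : R) (kappa : tree)
  (N : seq nat -> T -> nat) (U : seq nat -> T -> R) (n : nat) (w : T) : nat :=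
  \max_(u <- gen N n w) size (brw_pos lam kappa U u w).

Section Indep.
Context {d : measure_display} {T : measurableType d} {R : realType}.
Variable P : probability T R.

Definition nat_rv_law {I : Type} (X : I -> T -> nat) (q : nat -> R) :=
  (forall i k, measurable (X i @^-1` [set k])) /\
  (forall i k, P (X i @^-1` [set k]) = (q k)%:E).

Definition unif_rv {I : Type} (X : I -> T -> R) :=
  (forall i, measurable_fun setT (X i)) /\
  (forall i (B : set R), measurable B ->
     P (X i @^-1` B) = (@lebesgue_measure R) (B `&` `[0%R, 1%R])).

Definition indep2 {I J : eqType} {A B : Type}
  (X : I -> T -> A) (measA : set A -> Prop)
  (Y : J -> T -> B) (measB : set B -> Prop) :=
  forall (F : seq I) (G : seq J) (SA : I -> set A) (SB : J -> set B),
    uniq F -> uniq G -> (forall i, measA (SA i)) -> (forall j, measB (SB j)) ->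
    P (\bigcap_(i in [set x | x \in F]) (X i @^-1` SA i)
        `&` \bigcap_(j in [set x | x \in G]) (Y j @^-1` SB j))
    = ((\prod_(i <- F) P (X i @^-1` SA i)) * \prod_(j <- G) P (Y j @^-1` SB j))%E.

Definition indep1 {I : eqType} {A : Type} (X : I -> T -> A) (measA : set A -> Prop) :=
  forall (F : seq I) (SA : I -> set A),
    uniq F -> (forall i, measA (SA i)) ->
    P (\bigcap_(i in [set x | x \in F]) (X i @^-1` SA i))
    = (\prod_(i <- F) P (X i @^-1` SA i))%E.

End Indep.

Definition prob_nat {R : realType} (q : nat -> R) :=
  (forall k, 0 <= q k) /\ (fun n => \sum_(k < n) q k) @ \oo --> (1 : R).

(* Main.v *)
(* Idea of the proof. Fix the tree [kap]. The probability [fail] that no line of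
   descent of length [n] satisfies a constraint obeys the recursion
   [fail (n + 1) = pgf mu (walk (fail n))], so everything reduces to the walk
   operator. The upper bound is the first moment bound
   [1 - fail <= m ^+ n * P(|S_n| >= a n)] and Borel-Cantelli.

   Lower bound, for [v < a] and [I a < ln m]. For [m' < m] close to [m], the
   map [t |-> 1 - pgf mu (1 - t)] dominates [m' * t] near 0. By the large
   deviation principle the mass [block_mass] of the walks which climb [a * k]
   levels within [k] steps without going below their starting point, weighted
   by [m'] per step, is at least [expR (gam * k)]. The subtrees at the level
   reached are independent of the levels below it, hence by Jensen the negative
   moments of order [1 / k] of the cascade of such blocks contract, and lineages
   staying above a line of slope [a] survive with positive probability. Along
   the walk many such subtrees are met, which turns positive probability into
   probability one up to an additive constant.

   The large deviation estimate is spoiled if the walk climbs [a * k] levels much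
   before time [k]. This is harmless if [v > 0], or if [v = 0] and the walk can
   wait at the root at subexponential cost. Otherwise, by a zero-one law, the
   loops at the root decay exponentially, and by reversibility so do the tails
   of the return times. One then replaces [m'] by a larger [mt] in the blocks,
   at the cost [(m' / mt) ^+ N], and regains this factor beforehand by the
   exponential growth of the number of particles at the root. *)

Require Import Defs.
From HB Require Import structures.
From mathcomp Require Import all_boot all_order all_algebra.
From mathcomp Require Import all_classical all_reals all_analysis.
From mathcomp Require Import measurable_realfun.
From mathcomp Require Import ring lra.
Import Order.TTheory GRing.Theory Num.Theory.
Import numFieldNormedType.Exports.
Local Open Scope classical_set_scope.
Local Open Scope ring_scope.

Set Implicit Arguments. Unset Strict Implicit. Unset Printing Implicit Defensive.

(** Blocks are weighted by steps: a path that enters the target level at time [t] carries [mt ^+ t],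
    so early arrivals waste weight. If [I] is affine with slope [be] between [v] and [a], height
    [a * k] at time [t] costs about [be * (a * k - v * t)]. For [v > 0] earlier arrival is strictly
    dearer; for [v = 0] it is not, and this is what singles out zero speed.

    The order [1 / k] of the negative moment fits two facts: a block of mass [expR (gam * k)]
    contributes [expR (- gam)], and the deterministic bound [(1 + lam) ^- h] with [h <= k] keeps
    every block below [1 + lam]. Hence almost sure growth of the mass, without any rate for the
    exceptional probability, makes some moment smaller than 1.

    The environment along the walk is never treated as a process. All quantities are operators that
    read the tree only below the level where they stop, so independence at one fixed vertex
    suffices. Products over several levels are first decoupled by the inequality of arithmetic and
    geometric means. *)

(** * Independence *)

Section independence.
Context {d : measure_display} {Om : measurableType d} {R : realType}.
Variable P : probability Om R.
Local Open Scope ereal_scope.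

(** Dynkin's argument: the events independent of the fixed [C] form a lambda-system containing [G].
    Only one side is extended, which suits the zero-one law, where [C] turns out to lie in the
    generated sigma-algebra itself. *)
Lemma indep_sigma_half (G : set (set Om)) (C : set Om) :
  setI_closed G -> G `<=` measurable -> measurable C ->
  (forall E, G E -> P (E `&` C) = P E * P C) ->
  forall E, <<s G >> E -> measurable E /\ P (E `&` C) = P E * P C.
Proof.
move=> GI Gm mC GC E sE.
suff: <<s G >> `<=` [set E | measurable E /\ P (E `&` C) = P E * P C] by apply.
apply: lambda_system_subset => //; last first.
  by move=> F GF; split; [exact: Gm|exact: GC].
apply/dynkin_lambda_system; split.
- by split => //; rewrite setTI probability_setT mul1e.
- move=> F [mF FC]; split; first exact: measurableC.
  have -> : ~` F `&` C = C `\` F by rewrite setIC.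
  rewrite measureD //; last by rewrite (le_lt_trans (probability_le1 P mC)) // ltry.
  rewrite [X in _ - X](_ : _ = P F * P C); last by rewrite setIC.
  by rewrite probability_setC // muleBl ?mul1e // fin_num_measure.
- move=> F tF FG; have mF n := (FG n).1.
  split; first exact: bigcupT_measurable.
  rewrite setI_bigcupl measure_semi_bigcup //; last 3 first.
  - by move=> n; exact: measurableI.
  - by apply: trivIset_setIr.
  - by apply: bigcupT_measurable => n; exact: measurableI.
  rewrite measure_semi_bigcup //; last exact: bigcupT_measurable.
  rewrite muleC -[X in X * _](@fineK _ (P C)) ?fin_num_measure // -nneseriesZl //.
  apply: eq_eseriesr => n _.
  by rewrite fineK ?fin_num_measure // [RHS]muleC; exact: (FG n).2.
Qed.

Lemma indep_sigma (G1 G2 : set (set Om)) :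
  setI_closed G1 -> setI_closed G2 ->
  G1 `<=` measurable -> G2 `<=` measurable ->
  (forall E1 E2, G1 E1 -> G2 E2 -> P (E1 `&` E2) = P E1 * P E2) ->
  forall E1 E2, <<s G1 >> E1 -> <<s G2 >> E2 ->
    P (E1 `&` E2) = P E1 * P E2.
Proof.
move=> I1 I2 m1 m2 G12 E1 E2 sE1 sE2.
have mE2 : measurable E2.
  by have /(_ E2 sE2) := smallest_sub (@sigma_algebra_measurable _ Om) m2.
apply: (indep_sigma_half I1 m1 mE2 _ sE1).2 => F1 GF1.
rewrite setIC muleC.
apply: (indep_sigma_half I2 m2 (m1 _ GF1) _ sE2).2 => F2 GF2.
by rewrite setIC muleC G12.
Qed.

Section family.
Variables (I : eqType) (A : I -> set (set Om)).

(** The [A i] are families of events rather than random variables, so that integer offspring numbers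
    and real uniforms can share one index type. *)
Definition cylinder (D : set I) : set (set Om) :=
  [set C | exists (s : seq I) (E : I -> set Om),
    [/\ uniq s, forall i, i \in s -> D i, forall i, A i (E i) &
        C = \bigcap_(i in [set x | x \in s]) E i]].

Hypothesis Am : forall i, A i `<=` measurable.
Hypothesis AI : forall i, setI_closed (A i).
Hypothesis AT : forall i, A i setT.
Hypothesis Aind : forall (s : seq I) (E : I -> set Om), uniq s ->
  (forall i, A i (E i)) ->
  P (\bigcap_(i in [set x | x \in s]) E i) = \prod_(i <- s) P (E i).

Lemma cylinder_setI D : setI_closed (cylinder D).
Proof.
move=> C1 C2 [s1 [E1 [u1 D1 A1 ->]]] [s2 [E2 [u2 D2 A2 ->]]].
exists (undup (s1 ++ s2)), (fun i => (if i \in s1 then E1 i else setT) `&`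
  (if i \in s2 then E2 i else setT)); split.
- exact: undup_uniq.
- by move=> i; rewrite mem_undup mem_cat => /orP[/D1|/D2].
- by move=> i; apply: AI; case: ifP => _ //.
- apply/seteqP; split => w /=.
    move=> [h1 h2] i /=; rewrite mem_undup mem_cat => _; split.
      by case: ifPn => // i1; exact: h1.
    by case: ifPn => // i2; exact: h2.
  move=> h; split => i /= im.
    have /h[/= + _] : i \in undup (s1 ++ s2) by rewrite mem_undup mem_cat im.
    by rewrite im.
  have /h[/= _] : i \in undup (s1 ++ s2) by rewrite mem_undup mem_cat im orbT.
  by rewrite im.
Qed.

Lemma cylinder_measurable D : cylinder D `<=` measurable.
Proof.
move=> C [s [E [us Ds AE ->]]]; apply: fin_bigcap_measurable => //.
by move=> i _; exact: Am (AE i).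
Qed.

Lemma cylinder_indep D1 D2 : D1 `&` D2 = set0 -> forall E1 E2,
  <<s cylinder D1 >> E1 -> <<s cylinder D2 >> E2 ->
  P (E1 `&` E2) = P E1 * P E2.
Proof.
move=> D12; apply: indep_sigma; do ?exact: cylinder_setI;
  do ?exact: cylinder_measurable.
move=> C1 C2 [s1 [E1 [u1 D1s A1 ->]]] [s2 [E2 [u2 D2s A2 ->]]].
have dis i : i \in s1 -> i \in s2 -> False.
  by move=> /D1s h1 /D2s h2; have : (D1 `&` D2) i by []; rewrite D12.
pose E i := if i \in s1 then E1 i else E2 i.
have AE i : A i (E i) by rewrite /E; case: ifP.
have us : uniq (s1 ++ s2).
  rewrite cat_uniq u1 u2 andbT /=; apply/hasPn => i i2; apply/negP => i1.
  exact: dis i1 i2.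
have -> : \bigcap_(i in [set x | x \in s1]) E1 i `&`
    \bigcap_(i in [set x | x \in s2]) E2 i =
    \bigcap_(i in [set x | x \in s1 ++ s2]) E i.
  apply/seteqP; split => w /=.
    move=> [h1 h2] i /=; rewrite mem_cat /E; case: ifPn => [i1 _|i1 /= i2].
      exact: h1.
    exact: h2.
  move=> h; split => i /= im.
    by have := h i; rewrite /= mem_cat im /E im => /(_ isT).
  have := h i; rewrite /= mem_cat im orbT /E => /(_ isT).
  by case: ifPn => // i1; case: (dis i i1 im).
rewrite !Aind // big_cat /=; congr (_ * _); apply: eq_big_seq => i im.
  by rewrite /E im.
by rewrite /E; case: ifPn => // i1; case: (dis i i1 im).
Qed.

Lemma cylinder1 (D : set I) i E : D i -> A i E -> <<s cylinder D >> E.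
Proof.
move=> Di AE; apply: sub_sigma_algebra.
exists [:: i], (fun j => if j == i then E else setT); split => //.
- by move=> j; rewrite inE => /eqP ->.
- by move=> j; case: eqP => [->|].
- apply/seteqP; split => w /=; first by move=> Ew j /=; rewrite inE => ->.
  by move=> /(_ i); rewrite /= inE eqxx => /(_ isT).
Qed.

Lemma sigma_cylinderS D1 D2 : D1 `<=` D2 ->
  <<s cylinder D1 >> `<=` <<s cylinder D2 >>.
Proof.
move=> D12; apply: smallest_sub; first exact: smallest_sigma_algebra.
move=> C [s [E [us Ds AE ->]]]; apply: sub_sigma_algebra.
by exists s, E; split => // i /Ds /D12.
Qed.

Lemma sigma_cylinder_measurable D : <<s cylinder D >> `<=` measurable.
Proof.
by apply: smallest_sub; [exact: sigma_algebra_measurable|exact: cylinder_measurable].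
Qed.

End family.
End independence.

(** * Random trees *)

Section independent_product.
Local Open Scope ereal_scope.
Context {d d1 d2 : measure_display} {T : measurableType d}
  {T1 : measurableType d1} {T2 : measurableType d2} {R : realType}.
Variable P : probability T R.

(** Independence makes the joint law of [(Y1, Y2)] the product of the two laws; the rest is
    Tonelli. *)
Lemma indep_integralM (Y1 : T -> T1) (Y2 : T -> T2)
    (F : T1 -> \bar R) (G : T2 -> \bar R) :
  measurable_fun setT Y1 -> measurable_fun setT Y2 ->
  (forall A B, measurable A -> measurable B ->
    P (Y1 @^-1` A `&` Y2 @^-1` B) = P (Y1 @^-1` A) * P (Y2 @^-1` B)) ->
  measurable_fun setT F -> measurable_fun setT G ->
  (forall x, 0 <= F x) -> (forall x, 0 <= G x) ->
  \int[P]_w (F (Y1 w) * G (Y2 w)) =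
  (\int[P]_w F (Y1 w)) * (\int[P]_w G (Y2 w)).
Proof.
move=> mY1 mY2 ind mF mG F0 G0.
pose X1 : {mfun T >-> T1} := HB.pack Y1 (isMeasurableFun.Build _ _ _ _ _ mY1).
pose X2 : {mfun T >-> T2} := HB.pack Y2 (isMeasurableFun.Build _ _ _ _ _ mY2).
have mY12 : measurable_fun setT (fun w => (Y1 w, Y2 w)).
  exact: measurable_fun_pair.
pose X12 : {mfun T >-> (T1 * T2)%type} :=
  HB.pack (fun w => (Y1 w, Y2 w)) (isMeasurableFun.Build _ _ _ _ _ mY12).
have m12 (X : set (T1 * T2)) : measurable X ->
    (distribution P X1 \x distribution P X2) X = distribution P X12 X.
  apply: product_measure_unique => A B mA mB.
  by rewrite /distribution /pushforward /= -ind.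
have mFG : measurable_fun setT (fun z : T1 * T2 => F z.1 * G z.2).
  by apply: emeasurable_funM; apply: measurableT_comp.
have FG0 (z : T1 * T2) : 0 <= F z.1 * G z.2 by exact: mule_ge0.
have e1 : \int[distribution P X1]_y F y = \int[P]_w F (Y1 w).
  by rewrite ge0_integral_distribution.
have e2 : \int[distribution P X2]_y G y = \int[P]_w G (Y2 w).
  by rewrite ge0_integral_distribution.
rewrite -e1 -e2.
transitivity (\int[distribution P X12]_z (F z.1 * G z.2)).
  by rewrite (@ge0_integral_distribution _ _ _ _ _ P X12 _ mFG).
transitivity (\int[distribution P X1 \x distribution P X2]_z (F z.1 * G z.2)).
  by apply: eq_measure_integral => A mA _; first [exact: m12|exact/esym/m12].
rewrite fubini_tonelli1 //= /fubini_F /=.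
transitivity (\int[distribution P X1]_x (F x * \int[distribution P X2]_y G y)).
  by apply: eq_integral => x _; rewrite ge0_integralZl.
by rewrite ge0_integralZr // integral_ge0.
Qed.

End independent_product.

Definition tree_cyl : set (set tree) :=
  [set C | exists u k, C = [set kap : tree | kap u = k]].

Notation Tree := (g_sigma_algebraType tree_cyl).

Definition subtree (kap : tree) (z : seq nat) : tree := fun u => kap (u ++ z).

Lemma subtree_cat kap y z : subtree (subtree kap z) y = subtree kap (y ++ z).
Proof. by apply/funext => u; rewrite /subtree catA. Qed.

Lemma subtree_nil kap : subtree kap [::] = kap.
Proof. by apply/funext => u; rewrite /subtree cats0. Qed.

Lemma measurable_cst_prop d (T : measurableType d) (Q : Prop) :
  measurable [set _ : T | Q].
Proof.
have [q|q] := pselect Q.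
  by rewrite (_ : [set _ | _] = setT) //; apply/seteqP; split.
by rewrite (_ : [set _ | _] = set0) //; apply/seteqP; split.
Qed.

Section tree_measurable.
Context {d : measure_display} {T : measurableType d}.

Lemma measurable_coord u : measurable_fun setT (fun kap : Tree => kap u).
Proof.
move=> _ Y _; rewrite setTI.
rewrite (_ : _ @^-1` Y = \bigcup_(k in Y) [set kap : tree | kap u = k]); last first.
  by apply/seteqP; split => kap /=; [move=> h; exists (kap u)|case=> k Yk ->].
apply: bigcup_measurable => k _.
by apply: sub_sigma_algebra; exists u, k.
Qed.

Lemma measurable_to_tree (X : T -> Tree) :
  (forall u k, measurable [set w | X w u = k]) -> measurable_fun setT X.
Proof.
move=> mX; apply: (@measurability _ _ T Tree setT X tree_cyl erefl).
by move=> _ [_ [u [k ->]] <-]; rewrite setTI; exact: mX.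
Qed.

End tree_measurable.

Lemma measurable_coord_fun d (T : measurableType d) (h : nat -> T) u :
  measurable_fun setT (fun kap : Tree => h (kap u)).
Proof.
apply: (@measurableT_comp _ _ _ _ nat T h) => //.
exact: measurable_coord.
Qed.

Lemma measurable_subtree z : measurable_fun setT (fun kap : Tree => subtree kap z : Tree).
Proof.
apply: measurable_to_tree => u k.
by apply: sub_sigma_algebra; exists (u ++ z), k.
Qed.

Section tree_functionals.
Context {R : realType}.

Lemma measurable_childsum (F : nat -> Tree -> R) z :
  (forall i, measurable_fun setT (F i)) ->
  measurable_fun setT (fun kap : Tree => \sum_(i < kap z) F i kap).
Proof.
move=> mF _ Y mY; rewrite setTI.
rewrite (_ : _ @^-1` Y = \bigcup_k ([set kap : Tree | kap z = k] `&`
    (fun kap => \sum_(i < k) F i kap) @^-1` Y)); last first.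
  apply/seteqP; split => kap /=; first by move=> h; exists (kap z).
  by case=> k _ [/= ->].
apply: bigcupT_measurable => k; apply: measurableI.
  by apply: sub_sigma_algebra; exists z, k.
rewrite -[X in measurable X]setTI.
by apply: measurable_sum => //.
Qed.

End tree_functionals.

Section random_tree.
Local Open Scope ereal_scope.
Context {d : measure_display} {Om : measurableType d} {R : realType}.
Variables (P : probability Om R) (p : nat -> R) (K : seq nat -> Om -> nat).
Hypothesis Klaw : nat_rv_law P K p.
Hypothesis Kind : indep1 P K (fun _ => True).

Let A (u : seq nat) : set (set Om) := [set E | exists S, E = K u @^-1` S].

Let Am u : A u `<=` measurable.
Proof.
move=> _ [S ->].
rewrite (_ : _ @^-1` S = \bigcup_(k in S) (K u @^-1` [set k])); last first.
  by apply/seteqP; split => w /=; [move=> h; exists (K u w)|case=> k Sk ->].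
by apply: bigcup_measurable => k _; exact: Klaw.1.
Qed.

Let AI u : setI_closed (A u).
Proof. by move=> _ _ [S1 ->] [S2 ->]; exists (S1 `&` S2). Qed.

Let AT u : A u setT. Proof. by exists setT. Qed.

Let Aind (s : seq (seq nat)) (E : seq nat -> set Om) : uniq s ->
  (forall i, A i (E i)) ->
  P (\bigcap_(i in [set x | x \in s]) E i) = \prod_(i <- s) P (E i).
Proof.
move=> us AE.
have [S ES] : {S : seq nat -> set nat & forall u, E u = K u @^-1` S u}.
  by exists (fun u => projT1 (cid (AE u))) => u; case: cid.
rewrite (_ : \bigcap_(i in _) _ = \bigcap_(i in [set x | x \in s]) (K i @^-1` S i)).
  by rewrite Kind //; apply: eq_bigr => i _; rewrite ES.
by apply: eq_bigcapr => i _; rewrite ES.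
Qed.

Let X (w : Om) : Tree := K^~ w.

Lemma measurable_random_tree : measurable_fun setT X.
Proof. by apply: measurable_to_tree => u k; exact: Klaw.1. Qed.

Let offspring_law u v (S : set nat) : P (K u @^-1` S) = P (K v @^-1` S).
Proof.
have e x : P (K x @^-1` S) = \sum_(k <oo | k \in S) (p k)%:E.
  rewrite (_ : _ @^-1` S = \bigcup_(k in S) (K x @^-1` [set k])); last first.
    by apply/seteqP; split => w /=; [move=> h; exists (K x w)|case=> k Sk ->].
  rewrite measure_bigcup //; last 2 first.
    by move=> k _; exact: Klaw.1.
    by move=> i j _ _ [w [/= <- <-]].
  by apply: eq_eseriesr => k _; exact: Klaw.2.
by rewrite !e.
Qed.

Let Tc (u : seq nat) : set (set Tree) :=
  [set E | exists S : set nat, E = (fun kap : Tree => kap u) @^-1` S].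

Let Tcm u : Tc u `<=` measurable.
Proof. by move=> _ [S ->]; rewrite -[X in measurable X]setTI; exact: measurable_coord. Qed.

Let TcI u : setI_closed (Tc u).
Proof. by move=> _ _ [S1 ->] [S2 ->]; exists (S1 `&` S2). Qed.

Let TcT u : Tc u setT. Proof. by exists setT. Qed.

(** [tree_cyl] is not closed under intersection; the finite-dimensional cylinders are, as uniqueness
    of measures requires of a generator. *)
Lemma measurable_tree_cylinder : @measurable _ Tree = <<s cylinder Tc setT >>.
Proof.
apply/seteqP; split; last first.
  exact: (@sigma_cylinder_measurable _ Tree _ Tc Tcm setT).
apply: smallest_sub; first exact: smallest_sigma_algebra.
move=> _ [u [k ->]]; apply: (@cylinder1 _ Tree _ Tc TcT setT u) => //.
by exists [set k].
Qed.

(** Both laws agree on cylinders: [u |-> u ++ z] is injective, so the shifted coordinates are again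
    distinct and i.i.d. *)
Lemma subtree_law z (B : set Tree) : measurable B ->
  P ((fun w => subtree (X w) z) @^-1` B) = P (X @^-1` B).
Proof.
move=> mB.
have mX := measurable_random_tree.
have mY : measurable_fun setT (fun w => subtree (X w) z : Tree).
  exact: (measurableT_comp (measurable_subtree z) mX).
pose X1 : {mfun Om >-> Tree} := HB.pack X (isMeasurableFun.Build _ _ _ _ _ mX).
pose X2 : {mfun Om >-> Tree} :=
  HB.pack (fun w => subtree (X w) z : Tree) (isMeasurableFun.Build _ _ _ _ _ mY).
apply: (measure_unique (cylinder Tc setT) (fun=> setT)
  measurable_tree_cylinder _ _ _ (distribution P X2) (distribution P X1)) => //.
- exact: (@cylinder_setI _ Tree _ Tc TcI TcT setT).
- move=> _; exists [::], (fun=> setT); split => //.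
  by apply/seteqP; split => // kap _ i /=.
- by rewrite bigcup_const //; exists 0%N.
- move=> _ [s [E [us _ TE ->]]].
  have [S ES] : {S : seq nat -> set nat & forall u, E u = (fun kap : Tree => kap u) @^-1` S u}.
    by exists (fun u => projT1 (cid (TE u))) => u; case: cid.
  have e2 : P ((fun w => subtree (X w) z) @^-1` \bigcap_(i in [set x | x \in s]) E i) =
      \prod_(i <- s) P (K i @^-1` S i).
    (* [take (size i - size z) i] recovers [u] from [i = u ++ z] and so carries the constraint on
       [u] to the shifted index. *)
    rewrite [X in P X](_ : _ = \bigcap_(i in [set x | x \in map (cat^~ z) s])
      (K i @^-1` S (take (size i - size z) i))); last first.
      apply/seteqP; split => w /=.
        move=> h i /= /mapP[u us' ->]; have := h u us'.
        by rewrite ES /= size_cat addnK take_size_cat.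
      move=> h u us'; rewrite ES /=.
      have /= := h (u ++ z); rewrite size_cat addnK take_size_cat //; apply.
      by apply/mapP; exists u.
    rewrite Kind //; last first.
      rewrite map_inj_uniq // => u v e.
      have se : size u = size v.
        by move/(congr1 size): e; rewrite !size_cat => /addIn.
      by move/eqP: e; rewrite eqseq_cat // => /andP[/eqP].
    rewrite big_map; apply: eq_bigr => u _.
    by rewrite size_cat addnK take_size_cat //; exact: offspring_law.
  have e1 : P (X @^-1` \bigcap_(i in [set x | x \in s]) E i) =
      \prod_(i <- s) P (K i @^-1` S i).
    rewrite -Kind //; congr (P _).
    by apply/seteqP; split => w h u us'; have := h u us'; rewrite ES.
  exact: etrans e2 (esym e1).
- by move=> _; apply: (le_lt_trans (probability_le1 (distribution P X2) measurableT)); rewrite ltry.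
Qed.

Lemma subtree_integral z (F : Tree -> \bar R) : measurable_fun setT F ->
  (forall x, 0 <= F x) ->
  \int[P]_w F (subtree (X w) z) = \int[P]_w F (X w).
Proof.
move=> mF F0.
have mX := measurable_random_tree.
have mY : measurable_fun setT (fun w => subtree (X w) z : Tree).
  exact: (measurableT_comp (measurable_subtree z) mX).
pose X1 : {mfun Om >-> Tree} := HB.pack X (isMeasurableFun.Build _ _ _ _ _ mX).
pose X2 : {mfun Om >-> Tree} :=
  HB.pack (fun w => subtree (X w) z : Tree) (isMeasurableFun.Build _ _ _ _ _ mY).
have e1 : \int[distribution P X1]_y F y = \int[P]_w F (X w).
  by rewrite ge0_integral_distribution.
have e2 : \int[distribution P X2]_y F y = \int[P]_w F (subtree (X w) z).
  by rewrite ge0_integral_distribution.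
rewrite -e1 -e2; apply: eq_measure_integral => B mB _.
exact: subtree_law.
Qed.

(** Erasing the levels from [h] on turns dependence on the lower levels only into factorization
    through a measurable map. *)
Definition mask (h : nat) (kap : tree) : tree :=
  fun u => if (size u < h)%N then kap u else 0%N.

(** Words shorter than [z] and words ending in [z] form disjoint sets of coordinates. *)
Lemma tree_indep z (A1 B1 : set Tree) : measurable A1 -> measurable B1 ->
  P ((fun w => mask (size z) (X w)) @^-1` A1 `&`
     (fun w => subtree (X w) z) @^-1` B1) =
  P ((fun w => mask (size z) (X w)) @^-1` A1) *
  P ((fun w => subtree (X w) z) @^-1` B1).
Proof.
move=> mA mB.
pose D1 := [set u : seq nat | (size u < size z)%N].
pose D2 := [set u : seq nat | exists v, u = v ++ z].
apply: (cylinder_indep Am AI AT Aind (D1 := D1) (D2 := D2)).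
- rewrite -subset0 => u; rewrite /D1 /D2 /= => -[h [v uv]].
  by move: h; rewrite uv size_cat ltnNge leq_addl.
- have : measurable_fun setT
    (fun w : g_sigma_algebraType (cylinder A D1) => mask (size z) (X w) : Tree).
    apply: measurable_to_tree => u k; rewrite /mask.
    have [uz|uz] := boolP (size u < size z)%N; last exact: measurable_cst_prop.
    by apply: (cylinder1 AT (i := u)) => //; exists [set k].
  by move=> /(_ measurableT _ mA); rewrite setTI.
- have : measurable_fun setT
    (fun w : g_sigma_algebraType (cylinder A D2) => subtree (X w) z : Tree).
    apply: measurable_to_tree => u k; rewrite /subtree.
    by apply: (cylinder1 AT (i := u ++ z)); [exists u|exists [set k]].
  by move=> /(_ measurableT _ mB); rewrite setTI.
Qed.

Lemma measurable_mask h : measurable_fun setT (fun kap : Tree => mask h kap : Tree).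
Proof.
apply: measurable_to_tree => u k; rewrite /mask.
have [uz|uz] := boolP (size u < h)%N.
  by apply: sub_sigma_algebra; exists u, k.
exact: measurable_cst_prop.
Qed.

Lemma tree_integralM z (G F : Tree -> \bar R) :
  measurable_fun setT G -> measurable_fun setT F ->
  (forall x, 0 <= G x) -> (forall x, 0 <= F x) ->
  (forall kap kap' : tree, (forall u, (size u < size z)%N -> kap u = kap' u) ->
    G kap = G kap') ->
  \int[P]_w (G (X w) * F (subtree (X w) z)) =
  (\int[P]_w G (X w)) * (\int[P]_w F (X w)).
Proof.
move=> mG mF G0 F0 Gloc; have mX := measurable_random_tree.
have GE w : G (X w) = G (mask (size z) (X w)).
  by apply: Gloc => u uz; rewrite /mask uz.
rewrite -(subtree_integral z mF F0).
under eq_integral do rewrite GE.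
under [in RHS]eq_integral do rewrite GE.
apply: (indep_integralM (Y1 := fun w => mask (size z) (X w) : Tree)
  (Y2 := fun w => subtree (X w) z : Tree)) => //.
- exact: (measurableT_comp (measurable_mask _) mX).
- exact: (measurableT_comp (measurable_subtree z) mX).
- exact: tree_indep.
Qed.

End random_tree.

(** * Stopped walk operators *)

Section operators.
Context {R : realType}.
Implicit Types (dn up : bool -> nat -> R) (kap : tree) (phi : seq nat -> R).

(** A one-step kernel with free weights, which may depend on whether the vertex is the root. The
    reflected walk, the killed walk and the count of generations are instances. As [behead [::] =
    [::]], a nonzero [dn true] would mean holding at the root. *)
Definition op dn up kap phi (z : seq nat) : R :=
  dn (nilp z) (kap z) * phi (behead z) +
  up (nilp z) (kap z) * \sum_(i < kap z) phi (nat_of_ord i :: z).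

(** Total weight, tested against [phi], of the paths from [z] that first enter level [h] within [t]
    steps; paths that do not make it in time count 0. *)
Fixpoint stop dn up kap (h t : nat) phi (z : seq nat) : R :=
  if size z == h then phi z else
  if t is t'.+1 then op dn up kap (stop dn up kap h t' phi) z else 0.

Section generic.
Variables (dn up : bool -> nat -> R) (kap : tree).
Hypotheses (dn0 : forall b k, 0 <= dn b k) (up0 : forall b k, 0 <= up b k).

Lemma op_ge0 phi z : (forall y, 0 <= phi y) -> 0 <= op dn up kap phi z.
Proof. by move=> h; rewrite addr_ge0 ?mulr_ge0 ?sumr_ge0. Qed.

Lemma op_le phi psi z : (forall y, phi y <= psi y) ->
  op dn up kap phi z <= op dn up kap psi z.
Proof. by move=> h; rewrite lerD ?ler_wpM2l ?ler_sum. Qed.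

Lemma op_le_in phi psi z : ((0 < size z)%N -> phi (behead z) <= psi (behead z)) ->
  (dn true =1 fun=> 0) ->
  (forall i, (i < kap z)%N -> phi (i :: z) <= psi (i :: z)) ->
  op dn up kap phi z <= op dn up kap psi z.
Proof.
move=> h1 d0 h2; rewrite /op lerD //.
  by case: z h1 {h2} => [|a z] h1; rewrite ?d0 ?mul0r // ler_wpM2l // h1.
rewrite ler_wpM2l //; apply: ler_sum => i _; exact: h2.
Qed.

Lemma op_ext phi psi z : phi =1 psi -> op dn up kap phi z = op dn up kap psi z.
Proof. by move=> h; rewrite /op h; under eq_bigr do rewrite h. Qed.

Lemma opZ c phi z : op dn up kap (fun y => c * phi y) z = c * op dn up kap phi z.
Proof. by rewrite /op -mulr_sumr; ring. Qed.

Lemma opD phi psi z : op dn up kap (fun y => phi y + psi y) z =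
  op dn up kap phi z + op dn up kap psi z.
Proof. by rewrite /op big_split /=; ring. Qed.

Lemma stop_ge0 h t phi z : (forall y, 0 <= phi y) -> 0 <= stop dn up kap h t phi z.
Proof.
move=> p0; elim: t z => [|t IH] z /=; case: ifP => // _.
exact: op_ge0.
Qed.

Lemma stop_le h t phi psi z : (forall y, size y = h -> phi y <= psi y) ->
  stop dn up kap h t phi z <= stop dn up kap h t psi z.
Proof.
move=> hp; elim: t z => [|t IH] z /=.
  by case: ifP => // /eqP; exact: hp.
by case: ifP => [/eqP|_]; [exact: hp|exact: op_le].
Qed.

Lemma stop_ext h t phi psi z : (forall y, size y = h -> phi y = psi y) ->
  stop dn up kap h t phi z = stop dn up kap h t psi z.
Proof. by move=> e; apply/eqP; rewrite eq_le !stop_le // => y /e ->. Qed.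

Lemma stopZ h t c phi z :
  stop dn up kap h t (fun y => c * phi y) z = c * stop dn up kap h t phi z.
Proof.
elim: t z => [|t IH] z /=; case: ifP => // _; rewrite ?mulr0 //.
by rewrite -opZ; apply: op_ext.
Qed.

Lemma stopD h t phi psi z : stop dn up kap h t (fun y => phi y + psi y) z =
  stop dn up kap h t phi z + stop dn up kap h t psi z.
Proof.
elim: t z => [|t IH] z /=; case: ifP => // _; rewrite ?addr0 //.
by rewrite -opD; apply: op_ext.
Qed.

Lemma stop_at h t phi z : size z = h -> stop dn up kap h t phi z = phi z.
Proof. by case: t => [|t] /= ->; rewrite eqxx. Qed.

Lemma stopS h t phi z : size z != h ->
  stop dn up kap h t.+1 phi z = op dn up kap (stop dn up kap h t phi) z.
Proof. by move=> /= /negbTE ->. Qed.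

Lemma stop_leS h t phi z : (forall y, 0 <= phi y) ->
  stop dn up kap h t phi z <= stop dn up kap h t.+1 phi z.
Proof.
move=> p0; elim: t z => [|t IH] z.
  by rewrite /=; case: ifP => // _; apply: op_ge0 => y; case: ifP.
have [zh|zh] := eqVneq (size z) h; first by rewrite !stop_at.
by rewrite stopS // [leRHS]stopS //; apply: op_le.
Qed.

Lemma stop_le_t h s t phi z : (forall y, 0 <= phi y) -> (s <= t)%N ->
  stop dn up kap h s phi z <= stop dn up kap h t phi z.
Proof.
move=> p0; elim: t => [|t IH]; first by rewrite leqn0 => /eqP ->.
rewrite leq_eqVlt => /orP[/eqP -> //|]; rewrite ltnS => /IH /le_trans; apply.
exact: stop_leS.
Qed.

End generic.

(** Paths stop on entering level [h], so no child count at that level or above is read. This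
    locality makes a block independent of the subtrees grafted on top of it. *)
Lemma stop_local dn up kap kap' h t phi phi' z : (size z <= h)%N ->
  (forall u, (size u < h)%N -> kap u = kap' u) ->
  (forall y, size y = h -> phi y = phi' y) ->
  stop dn up kap h t phi z = stop dn up kap' h t phi' z.
Proof.
move=> zh ek ep; elim: t z zh => [|t IH] z zh /=.
  by case: ifP => // /eqP; exact: ep.
case: ifP => [/eqP|zh']; first exact: ep.
have {}zh : (size z < h)%N by rewrite ltn_neqAle zh' zh.
rewrite /op ek // IH; last by rewrite size_behead (leq_trans (leq_pred _)) // ltnW.
by congr (_ + _ * _); apply: eq_bigr => i _; rewrite IH.
Qed.

Lemma measurable_op dn up (F : seq nat -> Tree -> R) z :
  (forall y, measurable_fun setT (F y)) ->
  measurable_fun setT (fun kap : Tree => op dn up kap (F^~ kap) z).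
Proof.
move=> mF; apply: measurable_funD; apply: measurable_funM => //.
- exact: (measurable_coord_fun (dn (nilp z))).
- exact: (measurable_coord_fun (up (nilp z))).
- exact: (measurable_childsum (F := fun i => F (i :: z))).
Qed.

Lemma measurable_stop dn up h t (F : seq nat -> Tree -> R) z :
  (forall y, measurable_fun setT (F y)) ->
  measurable_fun setT (fun kap : Tree => stop dn up kap h t (F^~ kap) z).
Proof.
move=> mF; elim: t z => [|t IH] z /=; have [e|_] := boolP (size z == h) => //.
exact: (measurable_op dn up (F := fun y kap => stop dn up kap h t (F^~ kap) y)).
Qed.

(** Turns a sum of random length into a series with indicators, with which integration can be
    exchanged. *)
Lemma ordsum_nneseries (a : nat -> R) n : (forall i, 0 <= a i) ->
  ((\sum_(i < n) a i)%:E = \sum_(i <oo) ((i < n)%N%:R * a i)%:E)%E.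
Proof.
move=> a0; rewrite (nneseries_split 0 n); last first.
  by move=> k _; rewrite lee_fin mulr_ge0.
rewrite add0n [X in (_ + X)%E]eseries0 ?adde0; last first.
  by move=> i ni _; rewrite ltnNge ni mul0r.
rewrite sumEFin big_mkord; congr (_%:E); apply: eq_bigr => i _.
by rewrite ltn_ord mul1r.
Qed.

End operators.

Section stop_expectation.
Local Open Scope ereal_scope.
Context {d : measure_display} {Om : measurableType d} {R : realType}.
Variables (P : probability Om R) (p : nat -> R) (K : seq nat -> Om -> nat).
Hypothesis Klaw : nat_rv_law P K p.
Hypothesis Kind : indep1 P K (fun _ => True).
Variables (dn up : bool -> nat -> R).
Hypotheses (dn0 : forall b k, (0 <= dn b k)%R) (up0 : forall b k, (0 <= up b k)%R).

Let X (w : Om) : Tree := K^~ w.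

(** The subtree at the entrance point of level [h] is independent of the levels below and
    distributed as the whole tree. Instead of conditioning on that point, the induction on [t]
    collects the weights of the path in the factor [G], which remains a function of the levels below
    [h]; independence is then used at a fixed vertex. *)
Lemma stop_integral (F : Tree -> R) (c : R) h t (G : Tree -> R) z :
  measurable_fun setT F -> (forall kap, 0 <= F kap)%R ->
  \int[P]_w (F (X w))%:E = c%:E ->
  measurable_fun setT G -> (forall kap, 0 <= G kap)%R ->
  (forall kap kap' : tree, (forall u, (size u < h)%N -> kap u = kap' u) ->
    G kap = G kap') ->
  (size z <= h)%N ->
  \int[P]_w (G (X w) * stop dn up (X w) h t (fun y => F (subtree (X w) y)) z)%:E =
  c%:E * \int[P]_w (G (X w) * stop dn up (X w) h t (fun=> 1%R) z)%:E.
Proof.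
move=> mF F0 Fc; have mX := measurable_random_tree Klaw.
have mXR (H : Tree -> R) : measurable_fun setT H ->
    measurable_fun setT (fun w => H (X w)).
  by move=> mH; exact: (measurableT_comp mH mX).
have mS1 h' t' z' : measurable_fun setT
    (fun kap : Tree => stop dn up kap h' t' (fun=> 1%R) z').
  exact: (measurable_stop dn up h' t' (F := fun _ _ => 1%R)).
have mSF h' t' z' : measurable_fun setT
    (fun kap : Tree => stop dn up kap h' t' (fun y => F (subtree kap y)) z').
  apply: (measurable_stop dn up h' t' (F := fun y kap => F (subtree kap y))).
  by move=> y; exact: (measurableT_comp mF (measurable_subtree y)).
have S10 kap h' t' z' : (0 <= stop dn up kap h' t' (fun=> 1%R) z')%R.
  exact: stop_ge0.
have SF0 kap h' t' z' :
    (0 <= stop dn up kap h' t' (fun y => F (subtree kap y)) z')%R.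
  exact: stop_ge0.
elim: t z G => [|t IH] z G mG G0 Gloc zh.
  have [e|ne] := eqVneq (size z) h; last first.
    under eq_integral do rewrite /= (negbTE ne) mulr0.
    under [in RHS]eq_integral do rewrite /= (negbTE ne) mulr0.
    by rewrite integral0 mule0.
  under eq_integral do rewrite stop_at // EFinM.
  under [in RHS]eq_integral do rewrite stop_at // mulr1.
  rewrite (tree_integralM Klaw Kind (z := z) (G := EFin \o G) (F := EFin \o F)) //=.
  - by rewrite Fc muleC.
  - exact/measurable_EFinP.
  - exact/measurable_EFinP.
  - by move=> kap kap' e'; rewrite (Gloc kap kap') // -e.
have [e|ne] := eqVneq (size z) h.
  have es kap phi : stop dn up kap h t.+1 phi z = stop dn up kap h t phi z.
    by rewrite !stop_at.
  under eq_integral do rewrite es; under [in RHS]eq_integral do rewrite es.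
  exact: IH.
have {}zh : (size z < h)%N by rewrite ltn_neqAle ne zh.
(* The weight of the next step is absorbed into [G]: [Gd] for the parent, [Gu i] for child [i],
   including the indicator that this child exists. *)
pose Gd kap := (G kap * dn (nilp z) (kap z))%R.
pose Gu i kap := (G kap * (up (nilp z) (kap z) * (i < kap z)%N%:R))%R.
have mGd : measurable_fun setT (Gd : Tree -> R).
  apply: measurable_funM => //; exact: (measurable_coord_fun (dn (nilp z))).
have mGu i : measurable_fun setT (Gu i : Tree -> R).
  apply: measurable_funM => //.
  exact: (measurable_coord_fun (fun k => up (nilp z) k * (i < k)%N%:R)%R).
have Gd0 kap : (0 <= Gd kap)%R by rewrite mulr_ge0.
have Gu0 i kap : (0 <= Gu i kap)%R by rewrite !mulr_ge0.
have Gdloc (kap kap' : tree) : (forall u, (size u < h)%N -> kap u = kap' u) ->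
    Gd kap = Gd kap' by move=> e; rewrite /Gd (Gloc _ _ e) e.
have Guloc i (kap kap' : tree) : (forall u, (size u < h)%N -> kap u = kap' u) ->
    Gu i kap = Gu i kap' by move=> e; rewrite /Gu (Gloc _ _ e) e.
have split (S : Tree -> seq nat -> R) :
    (forall y, measurable_fun setT (S^~ y)) -> (forall k y, 0 <= S k y)%R ->
    \int[P]_w (G (X w) * op dn up (X w) (S (X w)) z)%:E =
    \int[P]_w (Gd (X w) * S (X w) (behead z))%:E +
    \sum_(i <oo) \int[P]_w (Gu i (X w) * S (X w) (i :: z))%:E.
  move=> mS S0; rewrite -integral_nneseries //; last 2 first.
    move=> i; apply/measurable_EFinP/measurable_funM; first exact: mXR.
    exact: (mXR (S^~ (i :: z))).
    by move=> i w _; rewrite lee_fin mulr_ge0.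
  rewrite -ge0_integralD //; first last.
  - apply: ge0_emeasurable_sum => i; first by move=> w _ _; rewrite lee_fin mulr_ge0.
    move=> _; apply/measurable_EFinP/measurable_funM; first exact: mXR.
    exact: (mXR (S^~ (i :: z))).
  - by move=> w _; apply: nneseries_ge0 => i _ _; rewrite lee_fin mulr_ge0.
  - apply/measurable_EFinP/measurable_funM; first exact: mXR.
    exact: (mXR (S^~ (behead z))).
  - by move=> w _; rewrite lee_fin mulr_ge0.
  apply: eq_integral => w _.
  rewrite /op mulrDr mulrA EFinD; congr (_ + _).
  rewrite mulrA mulr_sumr (ordsum_nneseries (a := fun i =>
    G (X w) * up (nilp z) (X w z) * S (X w) (i :: z))%R); last first.
    by move=> i; rewrite !mulr_ge0.
  by apply: eq_eseriesr => i _; congr (_%:E); rewrite /Gu; ring.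
under eq_integral do rewrite stopS //.
under [in RHS]eq_integral do rewrite stopS //.
rewrite (split (fun kap => stop dn up kap h t (fun y => F (subtree kap y)))) //.
rewrite (split (fun kap => stop dn up kap h t (fun=> 1%R))) //.
rewrite IH //; last by rewrite size_behead (leq_trans (leq_pred _)) // ltnW.
have a0 : 0 <= \int[P]_w (Gd (X w) * stop dn up (X w) h t (fun=> 1%R) (behead z))%:E.
  by apply: integral_ge0 => w _; rewrite lee_fin mulr_ge0.
have b0 i : 0 <= \int[P]_w (Gu i (X w) * stop dn up (X w) h t (fun=> 1%R) (i :: z))%:E.
  by apply: integral_ge0 => w _; rewrite lee_fin mulr_ge0.
rewrite (ge0_muleDr _ a0 (nneseries_ge0 (fun i _ _ => b0 i))).
congr (_ + _); rewrite -nneseriesZl //.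
apply: eq_eseriesr => i _; apply: IH => //; exact: Guloc.
Qed.

End stop_expectation.

(** * Generating functions *)

Section generating_function.
Context {R : realType}.
Implicit Types (mu : nat -> R) (s t : R).

Definition pgf mu s : R := limn (fun n => \sum_(k < n) mu k * s ^+ k).

Variable mu : nat -> R.
Hypothesis hmu : prob_nat mu.

Let mu0 k : 0 <= mu k := hmu.1 k.

Let S1_le n : \sum_(k < n) mu k <= 1.
Proof.
have nd : nondecreasing_seq (fun n => \sum_(k < n) mu k).
  by apply/nondecreasing_seqP => i; rewrite big_ord_recr /= lerDl.
rewrite -(cvg_lim (@Rhausdorff R) hmu.2).
by apply: nondecreasing_cvgn_le => //; apply/cvg_ex; exists 1; exact: hmu.2.
Qed.

Lemma offspring_le1 k : mu k <= 1.
Proof.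
apply: le_trans (S1_le k.+1); rewrite big_ord_recr /= lerDr.
by apply: sumr_ge0.
Qed.

Let pow01 s k : 0 <= s <= 1 -> 0 <= s ^+ k <= 1.
Proof. by move=> /andP[s0 s1]; rewrite exprn_ge0 // exprn_ile1. Qed.

Lemma pgf_cvg s : 0 <= s <= 1 ->
  (fun n => \sum_(k < n) mu k * s ^+ k) @ \oo --> pgf mu s.
Proof.
move=> s01; apply: (@nondecreasing_is_cvgn _ (fun n => \sum_(k < n) mu k * s ^+ k)).
  apply/nondecreasing_seqP => i; rewrite big_ord_recr /= lerDl mulr_ge0 //.
  by case/andP: (pow01 i s01).
exists 1 => _ [n _ <-]; apply: le_trans (S1_le n).
by apply: ler_sum => k _; rewrite ler_piMr //; case/andP: (pow01 k s01).
Qed.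

Lemma pgf_ge0 s : 0 <= s <= 1 -> 0 <= pgf mu s.
Proof.
move=> s01; apply: (limr_ge (x := 0)); first by apply/cvg_ex; exists (pgf mu s); exact: pgf_cvg.
apply: nearW => n; apply: sumr_ge0 => k _; rewrite mulr_ge0 //.
by case/andP: (pow01 k s01).
Qed.

Lemma pgf_le s t : 0 <= s -> s <= t -> t <= 1 -> pgf mu s <= pgf mu t.
Proof.
move=> s0 st t1; apply: ler_lim.
- by apply/cvg_ex; exists (pgf mu s); apply: pgf_cvg; rewrite s0 (le_trans st).
- by apply/cvg_ex; exists (pgf mu t); apply: pgf_cvg; rewrite t1 (le_trans s0).
- apply: nearW => n; apply: ler_sum => k _.
  by rewrite ler_wpM2l // lerXn2r // nnegrE // (le_trans s0).
Qed.

Lemma pgf_le1 s : 0 <= s <= 1 -> pgf mu s <= 1.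
Proof.
move=> s01; apply: limr_le; first by apply/cvg_ex; exists (pgf mu s); exact: pgf_cvg.
apply: nearW => n; apply: le_trans (S1_le n).
by apply: ler_sum => k _; rewrite ler_piMr //; case/andP: (pow01 k s01).
Qed.

(** As [mu 0 = 0], all terms but the linear one are at most [s ^+ 2]; their total weight [1 - mu 1]
    is the probability of branching. *)
Lemma pgf_le_quadratic s : mu 0%N = 0 -> 0 <= s <= 1 ->
  pgf mu s <= mu 1%N * s + (1 - mu 1%N) * s ^+ 2.
Proof.
move=> m0 s01; have /andP[s0 s1] := s01.
apply: limr_le; first by apply/cvg_ex; exists (pgf mu s); exact: pgf_cvg.
near=> n; have n2 : (2 <= n)%N by near: n; exact: nbhs_infty_ge.
rewrite -(subnKC n2) big_split_ord /= !big_ord_recl big_ord0 /= m0.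
have le k : s ^+ (2 + k) <= s ^+ 2.
  by rewrite exprD ler_piMr ?sqr_ge0 ?exprn_ile1.
apply: (@le_trans _ _ (mu 1%N * s + \sum_(i < n - 2) mu (2 + i)%N * s ^+ 2)).
  rewrite mul0r add0r addr0 /bump /= addn0 expr1 lerD2l.
  by apply: ler_sum => i _; rewrite ler_wpM2l.
rewrite lerD2l -mulr_suml ler_wpM2r ?sqr_ge0 //.
have := S1_le (2 + (n - 2)); rewrite big_split_ord /= !big_ord_recl big_ord0 /= m0.
rewrite /bump /= addn0 addr0 add0r.
by lra.
Unshelve. all: by end_near. Qed.

Lemma pgf_le_id s : mu 0%N = 0 -> 0 <= s <= 1 -> pgf mu s <= s.
Proof.
move=> m0 s01; apply: le_trans (pgf_le_quadratic m0 s01) _.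
have /andP[s0 s1] := s01.
have m1 : mu 1%N <= 1.
  by have := S1_le 2; rewrite !big_ord_recl big_ord0 /= m0 /bump /= addn0; lra.
have : (1 - mu 1%N) * s ^+ 2 <= (1 - mu 1%N) * s.
  by rewrite ler_wpM2l ?subr_ge0 // expr2 ler_piMr.
by lra.
Qed.

Let compl_cvg t : 0 <= t <= 1 ->
  (fun n => \sum_(k < n) mu k * (1 - (1 - t) ^+ k)) @ \oo --> 1 - pgf mu (1 - t).
Proof.
move=> t01; have t01' : 0 <= 1 - t <= 1 by lra.
rewrite (_ : (fun n => _) = (fun n => \sum_(k < n) mu k - \sum_(k < n) mu k * (1 - t) ^+ k)).
  exact: (cvgB hmu.2 (pgf_cvg t01')).
apply/funext => n.
by rewrite -sumrB; apply: eq_bigr => k _; rewrite mulrBr mulr1.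
Qed.

(** Bernoulli's inequality term by term; this is the first moment bound over one generation. *)
Lemma pgf_compl_le (m t : R) : (fun n => \sum_(k < n) k%:R * mu k) @ \oo --> m ->
  0 <= t <= 1 -> 1 - pgf mu (1 - t) <= m * t.
Proof.
move=> hm t01; have /andP[t0 t1] := t01.
have hmt : (fun n => (\sum_(k < n) k%:R * mu k) * t) @ \oo --> m * t by exact: cvgMl.
rewrite -(cvg_lim (@Rhausdorff R) (compl_cvg t01)) -(cvg_lim (@Rhausdorff R) hmt).
apply: ler_lim.
- by apply/cvg_ex; exists (1 - pgf mu (1 - t)); exact: compl_cvg.
- by apply/cvg_ex; exists (m * t).
apply: nearW => n; rewrite mulr_suml; apply: ler_sum => k _.
rewrite [leRHS](_ : _ = mu k * (k%:R * t)); last by ring.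
rewrite ler_wpM2l //.
have : 1 - k%:R * t <= (1 - t) ^+ k.
  elim: (k : nat) => [|j IH]; first by rewrite mul0r subr0 expr0.
  rewrite exprS.
  have : (1 - t) * (1 - j%:R * t) <= (1 - t) * (1 - t) ^+ j by rewrite ler_wpM2l // subr_ge0.
  apply: le_trans; rewrite -natr1.
  have : 0 <= j%:R * t * t by rewrite !mulr_ge0.
  by lra.
by lra.
Qed.

(** The slope at 0 is [m], but the second moment may be infinite. So only finitely many terms are
    kept, with partial mean above the midpoint [m2], and [tau] makes their quadratic error at most
    [(m2 - m') * t]. *)
Lemma pgf_compl_ge (m m' : R) : (fun n => \sum_(k < n) k%:R * mu k) @ \oo --> m ->
  m' < m -> exists2 tau : R, 0 < tau <= 1 &
  forall t, 0 <= t <= tau -> m' * t <= 1 - pgf mu (1 - t).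
Proof.
move=> hm mm; pose m2 := (m' + m) / 2.
have [N hN] : exists N, m2 < \sum_(k < N) k%:R * mu k.
  have : \forall n \near \oo, m2 < \sum_(k < n) k%:R * mu k.
    by apply: (cvgr_gt m hm); rewrite /m2; lra.
  by case=> N _ hN; exists N; exact: hN (leqnn N).
have N0 : 0 < N.+1%:R ^+ 2 :> R by rewrite exprn_gt0.
pose tau := Num.min 1 ((m2 - m') / N.+1%:R ^+ 2).
have tau0 : 0 < tau by rewrite lt_min ltr01 divr_gt0 // /m2; lra.
exists tau; first by rewrite tau0 ge_min lexx.
move=> t /andP[t0 tt]; have t1 : t <= 1 by rewrite (le_trans tt) // ge_min lexx.
have tN : t * N.+1%:R ^+ 2 <= m2 - m'.
  by rewrite -ler_pdivlMr // (le_trans tt) // ge_min lexx orbT.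
have t01 : 0 <= t <= 1 by rewrite t0.
rewrite -(cvg_lim (@Rhausdorff R) (compl_cvg t01)).
apply: limr_ge; first by apply/cvg_ex; exists (1 - pgf mu (1 - t)); exact: compl_cvg.
have quad k : k%:R * t - k%:R ^+ 2 * t ^+ 2 <= 1 - (1 - t) ^+ k.
  have b j : (1 - t) ^+ j <= 1 by rewrite exprn_ile1 //; lra.
  have c j : 1 - j%:R * t <= (1 - t) ^+ j.
    elim: j => [|j IH]; first by rewrite mul0r subr0 expr0.
    rewrite exprS.
    have : (1 - t) * (1 - j%:R * t) <= (1 - t) * (1 - t) ^+ j by rewrite ler_wpM2l // subr_ge0.
    apply: le_trans; rewrite -natr1.
    have : 0 <= j%:R * t * t by rewrite !mulr_ge0.
    by lra.
  elim: k => [|j IH]; first by rewrite expr0 expr2 !mul0r; lra.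
  have cj : t * (1 - j%:R * t) <= t * (1 - t) ^+ j by rewrite ler_wpM2l.
  rewrite [(1 - t) ^+ j.+1]exprS -natr1.
  have jt : 0 <= j%:R * t ^+ 2 by rewrite mulr_ge0 // sqr_ge0.
  have t2 : 0 <= t ^+ 2 by exact: sqr_ge0.
  move: IH cj jt t2; move: ((1 - t) ^+ j) (j%:R : R) => q r; rewrite !expr2.
  by lra.
near=> n; have Nn : (N <= n)%N by near: n; exact: nbhs_infty_ge.
have : \sum_(k < N) mu k * (1 - (1 - t) ^+ k) <= \sum_(k < n) mu k * (1 - (1 - t) ^+ k).
  rewrite -(subnKC Nn) big_split_ord /= lerDl sumr_ge0 // => k _.
  by rewrite mulr_ge0 // subr_ge0 exprn_ile1 //; lra.
apply: le_trans.
have : \sum_(k < N) mu k * (k%:R * t - k%:R ^+ 2 * t ^+ 2) <= \sum_(k < N) mu k * (1 - (1 - t) ^+ k).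
  by apply: ler_sum => k _; rewrite ler_wpM2l.
apply: le_trans.
have : (\sum_(k < N) k%:R * mu k) * t - t * (t * N.+1%:R ^+ 2) <=
    \sum_(k < N) mu k * (k%:R * t - k%:R ^+ 2 * t ^+ 2).
  have -> : \sum_(k < N) mu k * (k%:R * t - k%:R ^+ 2 * t ^+ 2) =
      (\sum_(k < N) k%:R * mu k) * t - (\sum_(k < N) mu k * k%:R ^+ 2) * t ^+ 2.
    rewrite !mulr_suml -sumrB; apply: eq_bigr => k _; ring.
  rewrite lerD2l lerN2.
  have : \sum_(k < N) mu k * k%:R ^+ 2 <= N.+1%:R ^+ 2.
    apply: (@le_trans _ _ (\sum_(k < N) mu k * N.+1%:R ^+ 2)).
      apply: ler_sum => k _; rewrite ler_wpM2l // lerXn2r ?nnegrE //.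
      by rewrite ler_nat ltnW // ltnS ltnW.
    by rewrite -mulr_suml ler_piMl // ltW.
  move=> h; have := ler_wpM2r (sqr_ge0 t) h.
  by rewrite expr2 mulrA; lra.
apply: le_trans.
have : m2 * t <= (\sum_(k < N) k%:R * mu k) * t by rewrite ler_wpM2r // ltW.
have : t * (t * N.+1%:R ^+ 2) <= t * (m2 - m') by rewrite ler_wpM2l.
by lra.
Unshelve. all: by end_near. Qed.

End generating_function.

(** * The branching walk recursion and the cascade of blocks *)

Lemma eq_imp_le (R : realType) (x y : R) : x = y -> x <= y.
Proof. by move=> ->. Qed.

Section walk_operators.
Context {R : realType}.
Implicit Types (lam c : R) (kap : tree) (phi : seq nat -> R).

Definition wdn lam (b : bool) (k : nat) : R := if b then 0 else lam / (lam + k%:R).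
Definition wup lam (b : bool) (k : nat) : R :=
  if b then k%:R^-1 else (lam + k%:R)^-1.

(* The walk killed when it leaves the tree through the (virtual) parent of the
   root, each step being weighted by [c]. *)
Definition kdn lam c (b : bool) (k : nat) : R :=
  if b then 0 else c * (lam / (lam + k%:R)).
Definition kup lam c (b : bool) (k : nat) : R := c * (lam + k%:R)^-1.

Definition walk lam := op (wdn lam) (wup lam).
Definition killed lam c := op (kdn lam c) (kup lam c).

Section fixed.
Variable lam : R.
Hypothesis lam0 : 0 < lam.

Let lamk k : 0 < lam + k%:R. Proof. by rewrite ltr_pwDl. Qed.

Lemma wdn_ge0 b k : 0 <= wdn lam b k.
Proof. by case: b => //=; rewrite divr_ge0 // ltW. Qed.
Lemma wup_ge0 b k : 0 <= wup lam b k.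
Proof. by case: b => //=; rewrite invr_ge0 // ltW. Qed.
Lemma kdn_ge0 c b k : 0 <= c -> 0 <= kdn lam c b k.
Proof. by move=> c0; case: b => //=; rewrite mulr_ge0 // divr_ge0 // ltW. Qed.
Lemma kup_ge0 c b k : 0 <= c -> 0 <= kup lam c b k.
Proof. by move=> c0; rewrite mulr_ge0 // invr_ge0 ltW. Qed.

Lemma walk_cst kap c x : (0 < kap x)%N -> walk lam kap (fun=> c) x = c.
Proof.
move=> kx; rewrite /walk /op /wdn /wup sumr_const card_ord -[c *+ _]mulr_natl.
case: (nilp x).
  by rewrite mul0r add0r mulrA mulVf ?mul1r // pnatr_eq0 -lt0n.
have := lamk (kap x); move: (kap x)%:R => k lk.
by field; rewrite gt_eqF.
Qed.

Lemma walk_le kap phi psi x : (forall y, phi y <= psi y) ->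
  walk lam kap phi x <= walk lam kap psi x.
Proof. exact: op_le wdn_ge0 wup_ge0 _ _ _. Qed.

Lemma walk_le_cst kap phi c x : (0 < kap x)%N -> (forall y, phi y <= c) ->
  walk lam kap phi x <= c.
Proof. by move=> kx h; rewrite -[leRHS](walk_cst c kx); exact: walk_le. Qed.

Lemma walk_ge0 kap phi x : (forall y, 0 <= phi y) -> 0 <= walk lam kap phi x.
Proof. exact: op_ge0 wdn_ge0 wup_ge0 _ _. Qed.

Lemma walk_compl kap phi x : (0 < kap x)%N ->
  walk lam kap (fun y => 1 - phi y) x = 1 - walk lam kap phi x.
Proof.
move=> kx; rewrite -{2}(walk_cst 1 kx) /walk.
rewrite (@op_ext _ _ _ _ _ (fun y => 1 + (-1) * phi y)) ?opD ?opZ ?mulN1r // => y.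
by rewrite mulN1r.
Qed.

Lemma killedE kap phi c x : killed lam c kap phi x = c * killed lam 1 kap phi x.
Proof.
rewrite /killed /op /kdn /kup; case: (nilp x); last by ring.
by rewrite !mul0r !add0r; ring.
Qed.

Lemma killed_le kap phi psi c x : 0 <= c -> (forall y, phi y <= psi y) ->
  killed lam c kap phi x <= killed lam c kap psi x.
Proof. by move=> c0; apply: op_le => b k; [exact: kdn_ge0|exact: kup_ge0]. Qed.

Lemma killed_cst_le kap c b x : 0 <= c -> 0 <= b -> killed lam c kap (fun=> b) x <= c * b.
Proof.
move=> c0 b0; rewrite killedE ler_wpM2l // /killed /op /kdn /kup sumr_const card_ord !mul1r.
rewrite -[b *+ _]mulr_natl; have := lamk (kap x).
have : 0 <= (kap x)%:R :> R by [].
move: (kap x)%:R => k k0 lk.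
have e : (lam + k)^-1 * (lam + k) = 1 by rewrite mulVf // gt_eqF.
have b1 : b = (lam + k)^-1 * (lam * b) + (lam + k)^-1 * (k * b).
  by rewrite -mulrDr -mulrDl mulrA e mul1r.
case: (nilp x); last by rewrite [leRHS]b1; apply: eq_imp_le; ring.
rewrite mul0r add0r [leRHS]b1 lerDr !mulr_ge0 ?invr_ge0 // ltW //.
Qed.

Lemma killed_le_cst kap phi c b x : 0 <= c -> 0 <= b -> (forall y, phi y <= b) ->
  killed lam c kap phi x <= c * b.
Proof.
by move=> c0 b0 h; apply: le_trans (killed_cst_le kap x c0 b0); exact: killed_le.
Qed.

(** Discarding the paths that leave the subtree at [x] loses mass. When [x] is the root, the killed
    kernel still gives a child [1 / (lam + k)] instead of [1 / k]. *)
Lemma walk_ge_killed kap x phi z : (forall y, 0 < kap y)%N ->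
  (forall y, 0 <= phi y) ->
  killed lam 1 (subtree kap x) (fun y => phi (y ++ x)) z <= walk lam kap phi (z ++ x).
Proof.
move=> kp p0; rewrite /killed /walk /op /kdn /kup /wdn /wup /subtree !mul1r.
have s0 : 0 <= \sum_(i < kap (z ++ x)) phi (nat_of_ord i :: z ++ x) by exact: sumr_ge0.
case: z s0 => [|i z] //= s0; case: x s0 => [|j x] s0 /=.
  rewrite !mul0r !add0r ler_wpM2r // lef_pV2 ?posrE ?ltr0n ?kp //.
  by rewrite lerDr ltW.
rewrite mul0r add0r lerDr mulr_ge0 // divr_ge0 // ltW //.
Qed.

Lemma killed_stop_le kap c h t phi z : 1 <= c -> (forall y, phi y <= 1) ->
  stop (kdn lam c) (kup lam c) kap h t phi z <= c ^+ t.
Proof.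
move=> c1 p1; have c0 : 0 <= c by rewrite (le_trans ler01).
elim: t z => [|t IH] z /=; case: ifP => _.
- by rewrite expr0.
- by rewrite expr0.
- by rewrite (le_trans (p1 z)) // exprn_ege1.
- by rewrite exprS; apply: killed_le_cst => //; rewrite exprn_ge0.
Qed.

End fixed.
End walk_operators.

Section survival.
Context {R : realType}.
Variables (mu : nat -> R) (lam : R).
Hypotheses (hmu : prob_nat mu) (lam0 : 0 < lam).

(* [fail kap n A x] is the probability that no line of descent of length [n] of
   the branching walk started at [x] stays in [A i] at each generation [i <= n]. *)
Fixpoint fail (kap : tree) (n : nat) (A : nat -> seq nat -> bool) (x : seq nat) : R :=
  if n is n'.+1 then
    if A 0%N x then pgf mu (walk lam kap (fail kap n' (fun i => A i.+1)) x) else 1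
  else (~~ A 0%N x)%:R.

Definition surv kap n A x : R := 1 - fail kap n A x.

Section fixed_tree.
Variable kap : tree.
Hypothesis kap0 : forall x, (0 < kap x)%N.

Lemma fail01 n A x : 0 <= fail kap n A x <= 1.
Proof.
elim: n A x => [|n IH] A x /=; first by case: (A 0%N x); rewrite /= ?ler01 ?lexx.
case: ifP => _; last by rewrite ler01 lexx.
have w01 : 0 <= walk lam kap (fail kap n (fun i => A i.+1)) x <= 1.
  rewrite walk_ge0 ?walk_le_cst // => y; by case/andP: (IH (fun i => A i.+1) y).
by rewrite pgf_ge0 ?pgf_le1.
Qed.

Lemma surv01 n A x : 0 <= surv kap n A x <= 1.
Proof. by have := fail01 n A x; rewrite /surv; lra. Qed.

Lemma fail_mono n (A B : nat -> seq nat -> bool) x :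
  (forall i y, A i y -> B i y) -> fail kap n B x <= fail kap n A x.
Proof.
elim: n A B x => [|n IH] A B x AB /=.
  by have := AB 0%N x; case: (A 0%N x); case: (B 0%N x) => //= h; rewrite ?ler01 //; have := h isT.
have [a|a] := boolP (A 0%N x); last first.
  by case/andP: (fail01 n.+1 B x).
rewrite AB //; apply: pgf_le => //.
- by apply: walk_ge0 => // y; case/andP: (fail01 n (fun i => B i.+1) y).
- by apply: walk_le => // y; apply: IH => i z; exact: AB.
- by apply: walk_le_cst => // y; case/andP: (fail01 n (fun i => A i.+1) y).
Qed.

(** One generation of the lower recursion. The linear bound holds only up to [tau], so it is applied
    to a minorant [b <= tau] of the one-step average. *)
Lemma surv_ge n (A : nat -> seq nat -> bool) x (m' tau b : R) : A 0%N x ->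
  tau <= 1 ->
  (forall t, 0 <= t <= tau -> m' * t <= 1 - pgf mu (1 - t)) ->
  0 <= b <= tau -> b <= walk lam kap (surv kap n (fun i => A i.+1)) x ->
  m' * b <= surv kap n.+1 A x.
Proof.
move=> Ax tau1 lin /andP[b0 bt] bw; rewrite /surv /= Ax.
apply: le_trans (lin b _) _; first by rewrite b0.
rewrite lerD2l lerN2; apply: pgf_le => //.
- by apply: walk_ge0 => // y; case/andP: (fail01 n (fun i => A i.+1) y).
- move: bw; rewrite /surv (walk_compl lam0 _ (kap0 x)); lra.
- lra.
Qed.

(** Jensen puts both lineages of a branching at the same vertex: one goes on, the other gets its
    chance there. Iteration leaves a single walk which picks up a factor at the vertices it
    visits. *)
Lemma fail_le_quadratic n (A : nat -> seq nat -> bool) x : mu 0%N = 0 -> A 0%N x ->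
  fail kap n.+1 A x <= walk lam kap (fun y => fail kap n (fun i => A i.+1) y *
    (1 - (1 - mu 1%N) * surv kap n (fun i => A i.+1) y)) x.
Proof.
move=> m0 Ax /=; rewrite Ax.
set F := fail kap n (fun i => A i.+1).
have F01 y : 0 <= F y <= 1 by exact: fail01.
have w01 : 0 <= walk lam kap F x <= 1.
  by rewrite walk_ge0 ?walk_le_cst // => y; case/andP: (F01 y).
apply: le_trans (pgf_le_quadratic hmu m0 w01) _.
have m1 : mu 1%N <= 1 := offspring_le1 hmu 1.
pose q := walk lam kap F x.
(* Jensen: [q^2 <= walk (F^2)], from [F^2 >= 2 q F - q^2]. *)
have : walk lam kap (fun y => (mu 1%N + (1 - mu 1%N) * (2 * q)) * F y +
    - ((1 - mu 1%N) * q ^+ 2)) x <=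
    walk lam kap (fun y => F y * (1 - (1 - mu 1%N) * surv kap n (fun i => A i.+1) y)) x.
  apply: walk_le => // y; rewrite /surv -/F.
  have : 0 <= (1 - mu 1%N) * (F y - q) ^+ 2 by rewrite mulr_ge0 ?sqr_ge0 // subr_ge0.
  rewrite -/q !expr2; lra.
apply: le_trans; rewrite /walk opD opZ -/(walk lam kap F x) -/q.
rewrite -/(walk lam kap _ x) walk_cst //.
by apply: eq_imp_le; rewrite !expr2; ring.
Qed.

End fixed_tree.
End survival.

Section embedded_cascade.
Context {R : realType}.
Variables (lam : R) (mt : R) (h k : nat).
Hypotheses (lam0 : 0 < lam) (mt1 : 1 <= mt).

Let mt0 : 0 <= mt. Proof. exact: le_trans ler01 mt1. Qed.

(* [casc N] bounds below, up to a constant, the probability that [N] successive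
   blocks of [h] levels are climbed, each in at most [k] steps. *)
Fixpoint casc (N : nat) (kap : tree) : R :=
  if N is N'.+1 then
    Num.min 1 (stop (kdn lam mt) (kup lam mt) kap h k
      (fun y => casc N' (subtree kap y)) [::])
  else 1.

Lemma casc01 N kap : 0 <= casc N kap <= 1.
Proof.
elim: N kap => [|N IH] kap /=; first by rewrite ler01 lexx.
rewrite le_min ler01 ge_min lexx andbT /=.
apply: stop_ge0 => [b j|b j|y]; [exact: kdn_ge0|exact: kup_ge0|].
by case/andP: (IH (subtree kap y)).
Qed.

Lemma casc_decr N kap : casc N.+1 kap <= casc N kap.
Proof.
elim: N kap => [|N IH] kap; first by rewrite /= ge_min lexx.
rewrite [leLHS]/= [leRHS]/= le_min !ge_min lexx /=; apply/orP; right.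
apply: stop_le => [b j|b j|y _]; [exact: kdn_ge0|exact: kup_ge0|exact: IH].
Qed.

Lemma casc_le M N kap : (M <= N)%N -> casc N kap <= casc M kap.
Proof.
elim: N => [|N IH]; first by rewrite leqn0 => /eqP ->.
rewrite leq_eqVlt => /orP[/eqP -> //|]; rewrite ltnS => /IH.
exact: le_trans (casc_decr N kap).
Qed.

End embedded_cascade.

Section cascade_survival.
Context {R : realType}.
Variables (mu : nat -> R) (lam : R).
Hypotheses (hmu : prob_nat mu) (lam0 : 0 < lam).
Variable kap : tree.
Hypothesis kap0 : forall x, (0 < kap x)%N.
Variables (m' tau mt : R) (h k : nat).
Hypotheses (mt1 : 1 <= mt) (m'0 : 0 < m') (m'mt : m' <= mt).
Hypotheses (h0 : (0 < h)%N) (tau01 : 0 < tau <= 1).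
Hypothesis lin : forall t, 0 <= t <= tau -> m' * t <= 1 - pgf mu (1 - t).
Variables (a C0 : R).
Hypotheses (a0 : 0 <= a) (akh : a * k%:R <= h%:R) (akC : a * k%:R <= C0).

Definition barrier (b H0 : R) (i : nat) (z : seq nat) : bool :=
  H0 + b * i%:R <= (size z)%:R.

Lemma barrierS b H0 : (fun i => barrier b H0 i.+1) = barrier b (H0 + b).
Proof.
apply/funext => i; apply/funext => z; rewrite /barrier -natr1.
by congr (_ <= _); ring.
Qed.

Let mt0 : 0 < mt. Proof. exact: lt_le_trans ltr01 mt1. Qed.
Let q : R := m' / mt.
Let c0 : R := tau * mt ^- k.

Let q01 : 0 < q <= 1.
Proof. by rewrite divr_gt0 //= ler_pdivrMr // mul1r. Qed.

(** [N] blocks are enough for [N] generations because a block lasts at least one step. A step is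
    weighted by [mt] in the cascade but earns only [m'], whence [q]; the constant [c0] keeps all
    intermediate quantities below [tau]. The slack [C0] in height covers the rise of the barrier
    during a block and is restored once the [h >= a * k] levels are climbed. *)
Lemma cascade_survival N x H0 : H0 <= (size x)%:R - C0 ->
  q ^+ N * (c0 * casc lam mt h k N (subtree kap x)) <=
  surv mu lam kap N (barrier a H0) x.
Proof.
have [tau0 tau1] := andP tau01; have [q0 q1] := andP q01.
have tau0' : 0 <= tau := ltW tau0.
have q0' : 0 <= q := ltW q0.
have mt0' : 0 <= mt := ltW mt0.
have c00 : 0 <= c0 by rewrite mulr_ge0 ?invr_ge0 ?exprn_ge0.
have casc01' M kap' : 0 <= casc lam mt h k M kap' <= 1 by exact: casc01.
have c0mt r : (r <= k)%N -> c0 * mt ^+ r <= tau.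
  move=> rk; rewrite /c0 -mulrA ler_piMr ?(ltW tau0) // mulrC ler_pdivrMr ?exprn_gt0 //.
  by rewrite mul1r ler_weXn2l.
elim/ltn_ind: N x H0 => N IH x H0 hH0.
pose phi y := casc lam mt h k N.-1 (subtree (subtree kap x) y).
have phi1 y : phi y <= 1 by case/andP: (casc01' N.-1 (subtree (subtree kap x) y)).
have phi0 y : 0 <= phi y by case/andP: (casc01' N.-1 (subtree (subtree kap x) y)).
pose S r z := stop (kdn lam mt) (kup lam mt) (subtree kap x) h r phi z.
have S0 r z : 0 <= S r z.
  by apply: stop_ge0 => // b j; [apply: kdn_ge0|apply: kup_ge0].
have Sle r z : S r z <= mt ^+ r by exact: killed_stop_le.
(* [r] is the time left in the current block and [k - r] the time spent, during which the barrier
   rises by [a * (k - r)]. *)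
suff inner r N' z H : (r <= k)%N -> (N' + (k - r) = N)%N -> (size z <= k - r)%N ->
    H <= (size x)%:R - C0 + a * (k - r)%:R ->
    q ^+ N' * (c0 * S r z) <= surv mu lam kap N' (barrier a H) (z ++ x).
  case: N IH @phi phi1 phi0 @S S0 Sle inner => [|N] IH phi phi1 phi0 S S0 Sle inner.
    rewrite expr0 mul1r /= mulr1 /surv /= /barrier mulr0 addr0.
    have b0 : H0 <= (size x)%:R.
      by apply: le_trans hH0 _; rewrite gerBl (le_trans _ akC) // mulr_ge0.
    rewrite b0 /= subr0.
    by have := c0mt 0%N isT; rewrite expr0 mulr1 => /le_trans; apply.
  have := inner k N.+1 [::] H0 (leqnn k).
  rewrite subnn addn0 mulr0 addr0 => /(_ erefl isT hH0); apply: le_trans.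
  rewrite ler_wpM2l ?exprn_ge0 // ler_wpM2l //=.
  by rewrite ge_min lexx orbT.
(* Level [h] is reached: as [h > 0], at least one generation has passed, so the outer induction
   applies at [z1 ++ x], where the slack is [C0] again. *)
have atH r1 N1 z1 H1 : (r1 <= k)%N -> (N1 + (k - r1) = N)%N ->
    (size z1 <= k - r1)%N -> H1 <= (size x)%:R - C0 + a * (k - r1)%:R ->
    size z1 = h ->
    q ^+ N1 * (c0 * S r1 z1) <= surv mu lam kap N1 (barrier a H1) (z1 ++ x).
  move=> rk1 Ne1 sz1 hH1 zh1.
  have N1N : (N1 < N)%N.
    by rewrite -Ne1 -[ltnLHS]addn0 ltn_add2l; apply: leq_trans sz1; rewrite zh1.
  rewrite /S stop_at //; apply: le_trans (IH _ N1N (z1 ++ x) H1 _).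
    rewrite ler_wpM2l ?exprn_ge0 // ler_wpM2l // /phi subtree_cat.
    by apply: casc_le => //; rewrite -ltnS prednK // (leq_trans _ N1N).
  apply: le_trans hH1 _; rewrite size_cat zh1 natrD addrAC lerD2r addrC lerD2r.
  by apply: le_trans akh; rewrite ler_wpM2l // ler_nat leq_subr.
elim: r N' z H => [|r IHr] N' z H rk Ne sz hH;
  have [zh|zh] := eqVneq (size z) h; do ?exact: atH.
  rewrite /S /= (negbTE zh) !mulr0.
  by case/andP: (surv01 hmu lam0 kap0 N' (barrier a H) (z ++ x)).
have bar : barrier a H 0 (z ++ x).
  rewrite /barrier mulr0 addr0 size_cat natrD; apply: le_trans hH _.
  have : a * (k - r.+1)%:R <= a * k%:R by rewrite ler_wpM2l // ler_nat leq_subr.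
  by have : 0 <= (size z)%:R :> R by []; move: akC; lra.
case: N' Ne => [|N'] Ne.
  rewrite expr0 mul1r /surv /= bar subr0.
  apply: le_trans tau1; apply: le_trans (c0mt r.+1 rk).
  by rewrite ler_wpM2l.
have rk' : (r <= k)%N by exact: ltnW.
have kr : (k - r = (k - r.+1).+1)%N by rewrite subnSK.
have eS : S r.+1 z = mt * killed lam 1 (subtree kap x) (S r) z.
  by rewrite /S stopS // -/(killed lam mt (subtree kap x) _ z) killedE.
rewrite eS exprS.
rewrite (_ : _ * _ = m' * (q ^+ N' * (c0 * killed lam 1 (subtree kap x) (S r) z))); last first.
  by rewrite /q; move: (q ^+ N') => qN; field; rewrite gt_eqF.
have k0 : 0 <= killed lam 1 (subtree kap x) (S r) z.
  by apply: op_ge0 => // b j; [apply: kdn_ge0|apply: kup_ge0].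
apply: (surv_ge hmu lam0 kap0 (tau := tau)) => //.
  rewrite (mulr_ge0 (exprn_ge0 _ q0') (mulr_ge0 c00 k0)) /=.
  apply: le_trans (c0mt r rk'); rewrite -[leRHS]mul1r; apply: ler_pM.
  - by rewrite exprn_ge0.
  - by rewrite mulr_ge0.
  - by rewrite exprn_ile1.
  - by rewrite ler_wpM2l // -[leRHS]mul1r; apply: killed_le_cst => //; rewrite exprn_ge0.
rewrite barrierS.
have s0 y : 0 <= surv mu lam kap N' (barrier a (H + a)) y.
  by case/andP: (surv01 hmu lam0 kap0 N' (barrier a (H + a)) y).
apply: le_trans (walk_ge_killed lam0 x z kap0 s0).
rewrite (mulrA (q ^+ N') c0) /killed -opZ; apply: op_le_in => //.
- by move=> b j; apply: kdn_ge0.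
- by move=> b j; apply: kup_ge0.
- move=> z0; rewrite -mulrA; apply: IHr => //.
  + by rewrite kr addnS -addSn.
  + by rewrite size_behead kr (leq_trans (leq_pred _)) // (leq_trans sz).
  + by rewrite kr -natr1; lra.
- move=> i ik; rewrite -mulrA; apply: IHr => //.
  + by rewrite kr addnS -addSn.
  + by rewrite /= kr ltnS.
  + by rewrite kr -natr1; lra.
Qed.

End cascade_survival.

(** * Negative moments of the cascade *)

Section negative_power.
Context {R : realType}.
Implicit Types (e x y : R).

(* [x ^ (- e)] for [x > 0] *)
Definition npow e x : R := expR (- (e * ln x)).

Lemma npow_ge0 e x : 0 <= npow e x. Proof. exact: expR_ge0. Qed.

Lemma npow1 e : npow e 1 = 1. Proof. by rewrite /npow ln1 mulr0 oppr0 expR0. Qed.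

Lemma npowM e x y : 0 < x -> 0 < y -> npow e (x * y) = npow e x * npow e y.
Proof. by move=> x0 y0; rewrite /npow lnM ?posrE // mulrDr opprD expRD. Qed.

Lemma npowS e x : 0 < x -> npow (1 + e) x = npow e x / x.
Proof.
move=> x0; rewrite /npow mulrDl mul1r opprD expRD mulrC.
by congr (_ * _); rewrite expRN lnK.
Qed.

Lemma npow_le e x y : 0 <= e -> 0 < x -> x <= y -> npow e y <= npow e x.
Proof.
move=> e0 x0 xy; rewrite ler_expR lerN2 ler_wpM2l // ler_ln ?posrE //.
exact: lt_le_trans x0 xy.
Qed.

Lemma npow_min1 e x : 0 <= e -> 0 < x -> npow e (Num.min 1 x) <= 1 + npow e x.
Proof.
move=> e0 x0; have [x1|x1] := lerP 1 x; first by rewrite npow1 lerDl npow_ge0.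
by rewrite lerDr.
Qed.

(** The convex function [x ^ (- e)] lies above its tangent at [y]; this is the form in which
    Jensen's inequality is used for blocks. *)
Lemma npow_tangent e x y : 0 <= e -> 0 < x -> 0 < y ->
  npow e y * (1 - e * (x / y - 1)) <= npow e x.
Proof.
move=> e0 x0 y0; have xy0 : 0 < x / y by rewrite divr_gt0.
have {2}-> : x = y * (x / y) by field; rewrite gt_eqF.
rewrite npowM // ler_wpM2l ?npow_ge0 //.
apply: le_trans (expR_ge1Dx _); rewrite lerD2l lerN2 ler_wpM2l //.
have {1}-> : x / y = 1 + (x / y - 1) by ring.
by apply: le_ln1Dx; lra.
Qed.

Lemma measurable_npow e : measurable_fun setT (npow e).
Proof.
apply: (measurableT_comp (f := expR)); first exact: measurable_expR.
by apply: measurableT_comp => //; apply: measurable_funM.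
Qed.

End negative_power.

Lemma integral_cst_prob d (T : measurableType d) (R : realType)
  (P : probability T R) (c : R) : (\int[P]_w c%:E = c%:E)%E.
Proof.
rewrite (integral_cst P measurableT c%:E) -[RHS]mule1; congr (_ * _)%E.
exact: probability_setT.
Qed.

Section cascade_moments.
Context {R : realType}.
Variables (lam mt : R) (h k : nat).
Hypotheses (lam0 : 0 < lam) (mt1 : 1 <= mt) (h0 : (0 < h)%N) (hk : (h <= k)%N).

Let mt0 : 0 < mt. Proof. exact: lt_le_trans ltr01 mt1. Qed.
Let dn0 b j : 0 <= kdn lam mt b j. Proof. exact/kdn_ge0/ltW. Qed.
Let up0 b j : 0 <= kup lam mt b j. Proof. exact/kup_ge0/ltW. Qed.

Definition block_mass (kap : tree) : R :=
  stop (kdn lam mt) (kup lam mt) kap h k (fun=> 1) [::].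

(** The paths that climb at every step already have this mass: [k / (lam + k) >= 1 / (1 + lam)] for
    [k >= 1], and [mt >= 1]. *)
Lemma killed_stop_ge (kap : tree) t phi z b : (forall y, 0 < kap y)%N ->
  0 <= b -> (forall y, 0 <= phi y) -> (forall y, size y = h -> b <= phi y) ->
  (size z <= h)%N -> (h - size z <= t)%N ->
  b * (1 + lam) ^- (h - size z) <= stop (kdn lam mt) (kup lam mt) kap h t phi z.
Proof.
move=> kp b0 p0 bphi; elim: t z => [|t IH] z zh ht.
  have e : size z = h by apply/eqP; rewrite eqn_leq zh -subn_eq0 -leqn0.
  by rewrite stop_at // e subnn expr0 invr1 mulr1 bphi.
have [e|ne] := eqVneq (size z) h.
  by rewrite stop_at // e subnn expr0 invr1 mulr1 bphi.
have {}zh : (size z < h)%N by rewrite ltn_neqAle ne zh.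
rewrite stopS // /op.
have S0 y : 0 <= stop (kdn lam mt) (kup lam mt) kap h t phi y by exact: stop_ge0.
set v := b * (1 + lam) ^- (h - (size z).+1).
have v0 : 0 <= v by rewrite mulr_ge0 // invr_ge0 exprn_ge0 // addr_ge0 // ltW.
have sv : v *+ kap z <= \sum_(i < kap z) stop (kdn lam mt) (kup lam mt) kap h t phi (nat_of_ord i :: z).
  rewrite -{1}(card_ord (kap z)) -sumr_const; apply: ler_sum => i _.
  by apply: (IH (nat_of_ord i :: z)) => //=; rewrite -ltnS -subSn.
apply: (@le_trans _ _ (kup lam mt (nilp z) (kap z) * (v *+ kap z))); last first.
  by rewrite -[leLHS]add0r lerD ?mulr_ge0 // ler_wpM2l.
have l0 : 0 < lam + (kap z)%:R by rewrite ltr_pwDl.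
have l1 : 0 < 1 + lam by rewrite addr_gt0.
have -> : b * (1 + lam) ^- (h - size z) = v / (1 + lam).
  by rewrite /v -subSS subSn // exprS invfM; ring.
rewrite /kup -[v *+ _]mulr_natl ler_pdivrMr //.
have k1 : 1 <= (kap z)%:R :> R by rewrite ler1n kp.
rewrite (_ : _ * _ * _ = v * (mt * (lam + (kap z)%:R)^-1 * ((kap z)%:R * (1 + lam)))); last by ring.
rewrite -[leLHS]mulr1 ler_wpM2l // -mulrA -[leLHS]mulr1 ler_pM //.
rewrite mulrC ler_pdivlMr // mul1r.
have kk : 0 <= (kap z)%:R - 1 :> R by rewrite subr_ge0.
by have := mulr_ge0 (ltW lam0) kk; lra.
Qed.

Lemma stop_cst kap h' t c z : stop (kdn lam mt) (kup lam mt) kap h' t (fun=> c) z =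
  c * stop (kdn lam mt) (kup lam mt) kap h' t (fun=> 1) z.
Proof. by rewrite -stopZ; apply: stop_ext => // y _; rewrite mulr1. Qed.

Lemma block_mass_ge (kap : tree) : (forall y, 0 < kap y)%N ->
  (1 + lam) ^- h <= block_mass kap.
Proof.
move=> kp; have := @killed_stop_ge kap k (fun=> 1) [::] 1 kp.
by rewrite subn0 mul1r; apply.
Qed.

Lemma block_mass_gt0 (kap : tree) : (forall y, 0 < kap y)%N -> 0 < block_mass kap.
Proof.
move=> kp; apply: lt_le_trans (block_mass_ge kp).
by rewrite invr_gt0 exprn_gt0 // addr_gt0.
Qed.

Lemma casc_gt0 N (kap : tree) : (forall y, 0 < kap y)%N -> 0 < casc lam mt h k N kap.
Proof.
elim: N kap => [|N IH] kap kp //=; rewrite lt_min ltr01 /=.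
pose phi y := casc lam mt h k N (subtree kap y).
have phip y : 0 < phi y by apply: IH => u; exact: kp.
suff : forall t z, (size z <= h)%N -> (h - size z <= t)%N ->
    0 < stop (kdn lam mt) (kup lam mt) kap h t phi z.
  by apply => //; rewrite subn0.
have S0 t y : 0 <= stop (kdn lam mt) (kup lam mt) kap h t phi y.
  by apply: stop_ge0 => // x; exact: ltW.
elim=> [|t IHt] z zh ht.
  have e : size z = h by apply/eqP; rewrite eqn_leq zh -subn_eq0 -leqn0.
  by rewrite stop_at.
have [e|ne] := eqVneq (size z) h; first by rewrite stop_at.
have {}zh : (size z < h)%N by rewrite ltn_neqAle ne zh.
rewrite stopS // /op ltr_wpDl ?mulr_ge0 // mulr_gt0 //.
  by rewrite mulr_gt0 // invr_gt0 ltr_pwDl.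
rewrite lt_neqAle eq_sym sumr_ge0 // andbT psumr_neq0 //.
apply/hasP; exists (Ordinal (kp z)); first by rewrite mem_index_enum.
by apply: IHt => //=; rewrite -ltnS -subSn.
Qed.

(** Jensen for the block measure normalized by its mass [W]: homogeneity gives [W ^ (- e)] and the
    normalization one more [W ^ (- 1)], whence the exponent [1 + e]. *)
Lemma block_jensen (kap : tree) (phi : seq nat -> R) e :
  (forall y, 0 < kap y)%N -> 0 <= e -> (forall y, 0 < phi y) ->
  0 < stop (kdn lam mt) (kup lam mt) kap h k phi [::] ->
  npow e (stop (kdn lam mt) (kup lam mt) kap h k phi [::]) <=
  npow (1 + e) (block_mass kap) *
  stop (kdn lam mt) (kup lam mt) kap h k (fun y => npow e (phi y)) [::].
Proof.
move=> kp e0 phi0; set B := stop _ _ _ _ _ phi _; set W := block_mass kap => B0.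
have W0 : 0 < W by exact: block_mass_gt0.
have t0 : 0 < B / W by rewrite divr_gt0.
have -> : B = W * (B / W) by field; rewrite gt_eqF.
rewrite npowM // npowS // -mulrA ler_wpM2l ?npow_ge0 // [leRHS]mulrC ler_pdivlMr //.
set t := B / W in t0 *.
apply: (@le_trans _ _ (stop (kdn lam mt) (kup lam mt) kap h k
  (fun y => npow e t * (1 + e) + (- (npow e t * e / t)) * phi y) [::])); last first.
  apply: stop_le => // y _; apply: le_trans (npow_tangent e0 (phi0 y) t0).
  by apply: eq_imp_le; field; rewrite gt_eqF.
rewrite stopD stop_cst stopZ -/(block_mass kap) -/W.
have -> : stop (kdn lam mt) (kup lam mt) kap h k phi [::] = t * W.
  by rewrite /t /B; field; rewrite gt_eqF.
by apply: eq_imp_le; field; rewrite gt_eqF.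
Qed.

Section random.
Local Open Scope ereal_scope.
Context {d : measure_display} {Om : measurableType d}.
Variables (P : probability Om R) (p : nat -> R) (K : seq nat -> Om -> nat).
Hypothesis Klaw : nat_rv_law P K p.
Hypothesis Kind : indep1 P K (fun _ => True).
Hypothesis K0 : forall u w, (0 < K u w)%N.
Variables (e r : R).
Hypotheses (e0 : (0 < e)%R) (r1 : (r < 1)%R).
Hypothesis We : \int[P]_w (npow e (block_mass (K^~ w)))%:E <= r%:E.

Let X (w : Om) : Tree := K^~ w.

Lemma measurable_casc N : measurable_fun setT (casc lam mt h k N : Tree -> R).
Proof.
elim: N => [|N IH]; first exact: measurable_cst.
apply: measurable_minr => //.
apply: (measurable_stop _ _ h k (F := fun y kap => casc lam mt h k N (subtree kap y))).
by move=> y; exact: (measurableT_comp IH (measurable_subtree y)).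
Qed.

Lemma measurable_block_mass : measurable_fun setT (block_mass : Tree -> R).
Proof. exact: (measurable_stop _ _ h k (F := fun _ _ => 1%R)). Qed.

(** If [x] bounds the moment for [N] blocks, then [1 + r * x] bounds it for one more: the cap in
    [casc] adds at most 1, and Jensen with independence of the subtrees gives the factor [r]. The
    bound is the fixed point of this map. *)
Lemma casc_moment N :
  \int[P]_w (npow e (casc lam mt h k N (X w)))%:E <= ((1 - r)^-1)%:E.
Proof.
have r0 : (0 <= r)%R.
  rewrite -lee_fin; apply: le_trans We; apply: integral_ge0 => w _.
  by rewrite lee_fin npow_ge0.
have mX := measurable_random_tree Klaw.
have mN (f : Tree -> R) : measurable_fun setT f ->
    measurable_fun setT (fun w => (npow e (f (X w)))%:E).
  move=> mf; apply/measurable_EFinP.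
  exact: (measurableT_comp (measurable_npow e) (measurableT_comp mf mX)).
elim: N => [|N IH].
  under eq_integral do rewrite npow1.
  rewrite integral_cst_prob lee_fin.
  by rewrite invr_ge1 ?unitfE ?subr_gt0 // ?gt_eqF ?subr_gt0 //; lra.
pose F := fun kap : Tree => npow e (casc lam mt h k N kap).
have mF : measurable_fun setT F.
  exact: (measurableT_comp (measurable_npow e) (measurable_casc N)).
have F0 kap : (0 <= F kap)%R by rewrite npow_ge0.
have iF0 : 0 <= \int[P]_w (F (X w))%:E by apply: integral_ge0 => w _; rewrite lee_fin.
have [c Fc] : exists c : R, \int[P]_w (F (X w))%:E = c%:E.
  exists (fine (\int[P]_w (F (X w))%:E)); rewrite fineK //.
  by rewrite ge0_fin_numE // (le_lt_trans IH) // ltry.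
pose G := fun kap : Tree => npow (1 + e) (block_mass kap).
have mG : measurable_fun setT G.
  exact: (measurableT_comp (measurable_npow (1 + e)) measurable_block_mass).
pose S := fun kap : Tree => stop (kdn lam mt) (kup lam mt) kap h k (fun y => F (subtree kap y)) [::].
have mS : measurable_fun setT S.
  apply: (measurable_stop _ _ h k (F := fun y kap => F (subtree kap y))).
  by move=> y; exact: (measurableT_comp mF (measurable_subtree y)).
have S0 kap : (0 <= S kap)%R by exact: stop_ge0.
have G0 kap : (0 <= G kap)%R by exact: npow_ge0.
apply: (@le_trans _ _ (\int[P]_w (1 + (G (X w) * S (X w))%:E))).
  apply: ge0_le_integral => //.
  - by move=> w _; rewrite lee_fin npow_ge0.
  - exact: (mN (casc lam mt h k N.+1) (measurable_casc N.+1)).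
  - apply: emeasurable_funD => //; apply/measurable_EFinP/measurable_funM.
      exact: (measurableT_comp mG mX).
    exact: (measurableT_comp mS mX).
  move=> w _; rewrite -EFinD lee_fin.
  have B0 : (0 < stop (kdn lam mt) (kup lam mt) (X w) h k
      (fun y => casc lam mt h k N (subtree (X w) y)) [::])%R.
    have := casc_gt0 N.+1 (kap := X w) (fun u => K0 u w).
    by rewrite /= lt_min => /andP[].
  apply: le_trans (npow_min1 (ltW e0) B0) _; rewrite lerD2l.
  apply: block_jensen => //; [exact: (fun u => K0 u w)|exact: ltW|].
  by move=> y; apply: casc_gt0 => u; exact: K0.
rewrite ge0_integralD //; first last.
- apply/measurable_EFinP/measurable_funM; first exact: (measurableT_comp mG mX).
  exact: (measurableT_comp mS mX).
- by move=> w _; rewrite lee_fin mulr_ge0.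
rewrite integral_cst_prob.
rewrite (stop_integral Klaw Kind dn0 up0 k mF F0 Fc mG G0) //; last first.
  move=> kap kap' ek; rewrite /G /block_mass; congr (npow _ _).
  exact: stop_local.
(* Once the subtrees are integrated out, [W ^ (- 1 - e)] multiplies the mass [W] itself, which
   leaves the moment assumed to be at most [r]. *)
rewrite (_ : \int[P]_w _ = \int[P]_w (npow e (block_mass (K^~ w)))%:E); last first.
  apply: eq_integral => w _; rewrite /G npowS ?mulfVK ?gt_eqF //;
    exact: (block_mass_gt0 (fun u => K0 u w)).
have c0 : (0 <= c)%R by rewrite -lee_fin -Fc.
have cr : (c <= (1 - r)^-1)%R by rewrite -lee_fin -Fc.
apply: (@le_trans _ _ (1 + c%:E * r%:E)).
  by rewrite leeD2l // lee_wpmul2l.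
rewrite -EFinM -EFinD lee_fin.
have r1' : (0 < 1 - r)%R by rewrite subr_gt0.
apply: (@le_trans _ _ (1 + (1 - r)^-1 * r)%R); first by rewrite lerD2l ler_wpM2r.
by apply: eq_imp_le; field; rewrite gt_eqF.
Qed.

(** Markov's inequality for the negative moment, uniformly in [N]; [s] solves [s ^ (- e) = M]. *)
Lemma casc_tail (eps : R) : (0 < eps)%R -> exists2 s : R, (0 < s)%R &
  forall N, P [set w | (casc lam mt h k N (X w) < s)%R] <= eps%:E.
Proof.
move=> eps0; have r1' : (0 < 1 - r)%R by rewrite subr_gt0.
pose M := ((1 - r)^-1 / eps)%R.
have M0 : (0 < M)%R by rewrite divr_gt0 // invr_gt0.
pose s := expR (- (e^-1 * ln M)).
have sM : npow e s = M.
  by rewrite /npow /s expRK mulrN opprK mulrA mulfV ?gt_eqF // mul1r lnK.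
have s0 : (0 < s)%R by exact: expR_gt0.
exists s => // N; have mX := measurable_random_tree Klaw.
have mc : measurable_fun setT (fun w => casc lam mt h k N (X w)).
  exact: (measurableT_comp (measurable_casc N) mX).
have mA : measurable [set w | (casc lam mt h k N (X w) < s)%R].
  rewrite (_ : mkset _ = (fun w => casc lam mt h k N (X w)) @^-1` `]-oo, s[%classic).
    by rewrite -[X in measurable X]setTI; exact: mc.
  by apply/seteqP; split => w /=; rewrite in_itv.
set A := mkset _ in mA *.
have : M%:E * P A <= ((1 - r)^-1)%:E.
  apply: le_trans (casc_moment N).
  rewrite -(integral_cst P mA) integral_mkcond; apply: ge0_le_integral => //.
  - by move=> w _; rewrite patchE; case: ifP => // _; rewrite lee_fin ltW.
  - by apply/(measurable_restrictT _ mA); exact: measurable_cst.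
  - apply/measurable_EFinP; exact: (measurableT_comp (measurable_npow e) mc).
  move=> w _; rewrite patchE; case: ifPn => [|_]; last by rewrite lee_fin npow_ge0.
  rewrite inE /A /= => ws; rewrite lee_fin -sM; apply: npow_le.
  - exact: ltW.
  - by apply: casc_gt0 => u; exact: K0.
  - exact: ltW.
have -> : ((1 - r)^-1 = M * eps)%R by rewrite /M; field; rewrite !gt_eqF.
by move=> hM; rewrite -(@lee_pmul2l _ M%:E) // -EFinM.
Qed.

(** The cascade decreases in [N], so the uniform tail bound passes to the union over all [N]. *)
Lemma casc_ae_pos : {ae P, forall w, exists2 s : R, (0 < s)%R &
  forall N, (s <= casc lam mt h k N (X w))%R}.
Proof.
have mX := measurable_random_tree Klaw.
pose A s := \bigcup_N [set w | (casc lam mt h k N (X w) < s)%R].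
have mAN s N : measurable [set w | (casc lam mt h k N (X w) < s)%R].
  have mc : measurable_fun setT (fun w => casc lam mt h k N (X w)).
    exact: (measurableT_comp (measurable_casc N) mX).
  rewrite (_ : mkset _ = (fun w => casc lam mt h k N (X w)) @^-1` `]-oo, s[%classic).
    by rewrite -[X in measurable X]setTI; exact: mc.
  by apply/seteqP; split => w /=; rewrite in_itv.
have mA s : measurable (A s) by exact: bigcupT_measurable.
have PA eps : (0 < eps)%R -> exists2 s : R, (0 < s)%R & P (A s) <= eps%:E.
  move=> /casc_tail[s s0 hs]; exists s => //.
  have nd : {homo (fun N => [set w | (casc lam mt h k N (X w) < s)%R]) : n m / (n <= m)%N >-> (n <= m)%O}.
    move=> n m nm; apply/subsetPset => w /=; apply: le_lt_trans.
    exact: casc_le.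
  have := nondecreasing_cvg_mu (mu := P) (mAN s) (mA s) nd.
  move=> /cvg_lim <- //; apply: lime_le; last by apply: nearW => N; exact: hs.
  by apply: ereal_nondecreasing_is_cvgn => n m nm; apply: le_measure; rewrite ?inE //;
     apply/subsetPset; exact: nd.
pose B := \bigcap_n A (n.+1%:R^-1)%R.
have mB : measurable B by exact: bigcapT_measurable.
exists B; split => //.
  apply/eqP; rewrite eq_le measure_ge0 andbT; apply/lee_addgt0Pr => eps eps0.
  rewrite add0e; have [s s0 hs] := PA eps eps0; apply: le_trans hs.
  have [n ns] : exists n : nat, (n.+1%:R^-1 <= s)%R.
    have [n _ hn] := near_infty_natSinv_lt (PosNum s0).
    by exists n; apply/ltW/(hn n) => /=.
  apply: le_measure; rewrite ?inE //.
  by move=> w /(_ n I) [N _ /= hN]; exists N => //=; exact: lt_le_trans ns.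
move=> w /= nw n _; apply: contrapT => nA; apply: nw.
exists (n.+1%:R^-1)%R; first by rewrite invr_gt0.
by move=> N; rewrite leNgt; apply/negP => cN; apply: nA; exists N.
Qed.

End random.
End cascade_moments.

(** * Lineages which stay above a line *)

Section new_maxima.
Context {R : realType}.
Variables (lam : R) (kap : tree).
Hypotheses (lam0 : 0 < lam) (kap0 : forall x, (0 < kap x)%N).
Implicit Types (psi phi : seq nat -> R).

Let dn0 := wdn_ge0 lam0.
Let up0 := wup_ge0 lam0.

Lemma walk_sum (I : Type) (r : seq I) (F : I -> seq nat -> R) z :
  walk lam kap (fun y => \sum_(j <- r) F j y) z = \sum_(j <- r) walk lam kap (F j) z.
Proof.
elim: r => [|j r IH].
  rewrite big_nil -[RHS](walk_cst lam0 0 (kap0 z)); apply: op_ext => y.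
  by rewrite big_nil.
rewrite big_cons -IH /walk -opD; apply: op_ext => y; exact: big_cons.
Qed.

Lemma walk_le_in phi psi z :
  (forall y, (size y <= (size z).+1)%N -> phi y <= psi y) ->
  walk lam kap phi z <= walk lam kap psi z.
Proof.
move=> h; apply: op_le_in => // [_|i _]; apply: h => //.
by rewrite size_behead (leq_trans (leq_pred _)).
Qed.

(* Expectation of the product of [psi] over the vertices at which the walk
   started at [x] first reaches a level above [l]. *)
Fixpoint newmax psi (t l : nat) (x : seq nat) : R :=
  if t is t'.+1 then
    walk lam kap (fun y => if size y == l.+1 then psi y * newmax psi t' l.+1 y
                           else newmax psi t' l y) x
  else 1.

Notation hit := (stop (wdn lam) (wup lam) kap).

Lemma hit_le1 h t z : hit h t (fun=> 1) z <= 1.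
Proof.
elim: t z => [|t IH] z /=; case: ifP => // _.
exact: (walk_le_cst lam0 (kap0 z)).
Qed.

Lemma newmax01 psi t l x : (forall y, 0 <= psi y <= 1) -> 0 <= newmax psi t l x <= 1.
Proof.
move=> p01; elim: t l x => [|t IH] l x /=; first by rewrite ler01 lexx.
have h y : 0 <= (if size y == l.+1 then psi y * newmax psi t l.+1 y
    else newmax psi t l y) <= 1.
  case: ifP => _ //; have /andP[? ?] := p01 y; have /andP[? ?] := IH l.+1 y.
  by rewrite mulr_ge0 ?mulr_ile1.
by rewrite walk_ge0 ?walk_le_cst // => y; case/andP: (h y).
Qed.

Lemma prod_le_mean (vs : seq R) (J : nat) : (0 < J)%N -> size vs = J ->
  (forall v, v \in vs -> 0 <= v) ->
  \prod_(v <- vs) v <= J%:R^-1 * \sum_(v <- vs) v ^+ J.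
Proof.
move=> J0 sJ v0; have J0' : 0 < J%:R :> R by rewrite ltr0n.
have vn i : (i < J)%N -> 0 <= nth 0 vs i by move=> iJ; apply/v0/mem_nth; rewrite sJ.
rewrite (big_nth 0) [in leRHS](big_nth 0) sJ !big_mkord.
have h : {in predT, forall i : 'I_J, 0 <= nth 0 vs i ^+ J}.
  by move=> i _; rewrite exprn_ge0 // vn.
have := (@leif_AGM R 'I_J predT (fun i => nth 0 vs i ^+ J) h).1.
rewrite card_ord prodrXl => le.
have {}le : (\prod_(i < J) nth 0 vs i) ^+ J <= (J%:R^-1 * \sum_(i < J) nth 0 vs i ^+ J) ^+ J.
  by rewrite mulrC.
have n1 : 0 <= \prod_(i < J) nth 0 vs i by apply: prodr_ge0 => i _; exact: vn.
have n2 : 0 <= J%:R^-1 * \sum_(i < J) nth 0 vs i ^+ J.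
  by rewrite mulr_ge0 ?invr_ge0 // sumr_ge0 // => i _; rewrite exprn_ge0 // vn.
by move: le; rewrite (ler_pXn2r J0) ?nnegrE.
Qed.

(** A product over several random vertices would call for joint independence along the path. The
    inequality of means replaces it by [J]-th powers at one level each, which [stop_integral] can
    treat. The first term pays for walks that do not reach level [J] in time. *)
Lemma newmax_le_mean psi J t : (0 < J)%N -> (forall y, 0 <= psi y <= 1) ->
  newmax psi t 0 [::] <= (1 - hit J t (fun=> 1) [::]) +
    J%:R^-1 * \sum_(1 <= j < J.+1) hit j t (fun y => psi y ^+ J) [::].
Proof.
move=> J0 p01.
have psiJ0 y : 0 <= psi y ^+ J by rewrite exprn_ge0 //; case/andP: (p01 y).
have J0' : 0 <= J%:R^-1 :> R by rewrite invr_ge0.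
(* [vs] lists the factors already collected, one for each of the levels [1, ..., l]. *)
suff gen l x (vs : seq R) : (l <= J)%N -> (size x <= l)%N -> size vs = l ->
    (forall v, v \in vs -> 0 <= v <= 1) ->
    \prod_(v <- vs) v * newmax psi t l x <=
    (if (l < J)%N then 1 - hit J t (fun=> 1) x else 0) +
    J%:R^-1 * (\sum_(v <- vs) v ^+ J +
               \sum_(l.+1 <= j < J.+1) hit j t (fun y => psi y ^+ J) x).
  have := gen 0%N [::] [::] (leq0n J) (leqnn _) erefl.
  by rewrite J0 !big_nil mul1r add0r; apply.
have prod01 (us : seq R) : (forall v, v \in us -> 0 <= v <= 1) ->
    0 <= \prod_(v <- us) v <= 1.
  move=> v01; rewrite big_seq prodr_ge0 ?prodr_ile1 // => v /v01 //.
  by case/andP.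
have sum0 (us : seq R) : (forall v, v \in us -> 0 <= v <= 1) ->
    0 <= \sum_(v <- us) v ^+ J.
  move=> v01; rewrite big_seq; apply: sumr_ge0 => v /v01/andP[v0 _].
  by rewrite exprn_ge0.
have hs0 l' s y : 0 <= \sum_(l'.+1 <= j < J.+1) hit j s (fun y => psi y ^+ J) y.
  by apply: sumr_ge0 => j _; exact: stop_ge0.
have endcase t' x' (us : seq R) : size us = J -> (forall v, v \in us -> 0 <= v <= 1) ->
    \prod_(v <- us) v * newmax psi t' J x' <= J%:R^-1 * \sum_(v <- us) v ^+ J.
  move=> sv v01; apply: le_trans (prod_le_mean J0 sv _); last first.
    by move=> v /v01/andP[].
  have /andP[n0 n1] := newmax01 t' J x' p01; have /andP[q0 q1] := prod01 us v01.
  by rewrite ler_piMr.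
elim: t l x vs => [|t IH] l x vs lJ xl sv v01; have [{}lJ|lJ'] := ltnP l J.
- rewrite /= mulr1; have /andP[_ pr1] := prod01 vs v01; apply: le_trans pr1 _.
  have -> : (size x == J) = false by rewrite ltn_eqF // (leq_ltn_trans xl).
  rewrite subr0 lerDl; apply: mulr_ge0 => //.
  exact: (addr_ge0 (sum0 vs v01) (hs0 l 0%N x)).
- have e : l = J by apply/eqP; rewrite eqn_leq lJ.
  rewrite add0r e; apply: le_trans (endcase 0%N x vs _ v01) _; first by rewrite sv.
  by rewrite ler_wpM2l // lerDl.
- rewrite [newmax _ _ _ _]/= /walk -opZ -/(walk lam kap _ x).
  have xJ : (size x < J)%N by exact: leq_ltn_trans lJ.
  pose Sg y := \sum_(l.+1 <= j < J.+1) hit j t (fun y => psi y ^+ J) y.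
  apply: (@le_trans _ _ (walk lam kap (fun y => (1 - hit J t (fun=> 1) y) +
     J%:R^-1 * (\sum_(v <- vs) v ^+ J + Sg y)) x)).
    apply: walk_le_in => y yx; have [yl|yl] := eqVneq (size y) l.+1.
      have vr v : v \in rcons vs (psi y) -> 0 <= v <= 1.
        by rewrite mem_rcons inE => /orP[/eqP ->|/v01].
      have := IH l.+1 y (rcons vs (psi y)) lJ _ _ vr.
      rewrite yl size_rcons sv => /(_ (leqnn _) erefl).
      rewrite -cats1 !big_cat /= !big_seq1 -mulrA => h.
      apply: le_trans h _.
      rewrite /Sg [in leRHS]big_ltn // (stop_at _ _ _ t _ yl).
      rewrite lerD //; last by rewrite ler_wpM2l // addrA.
      by case: ifP => // _; rewrite subr_ge0 hit_le1.
    have := IH l y vs (ltnW lJ); rewrite lJ; apply => //.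
    have : (size y <= l.+1)%N by exact: leq_trans yx _.
    by rewrite leq_eqVlt (negbTE yl).
  rewrite (_ : walk lam kap _ x = walk lam kap (fun y => 1 - hit J t (fun=> 1) y) x +
    J%:R^-1 * (walk lam kap (fun=> \sum_(v <- vs) v ^+ J) x + walk lam kap Sg x)); last first.
    by rewrite /walk !(opD, opZ).
  rewrite (walk_compl lam0 _ (kap0 x)) (walk_cst lam0 _ (kap0 x)) walk_sum.
  apply: eq_imp_le; congr (_ + _ * (_ + _)); first by rewrite stopS // ltn_eqF.
  apply: eq_big_nat => j /andP[lj _]; rewrite [RHS]stopS // ltn_eqF //.
  exact: leq_ltn_trans lj.
- have e : l = J by apply/eqP; rewrite eqn_leq lJ.
  rewrite add0r e; apply: le_trans (endcase t.+1 x vs _ v01) _; first by rewrite sv.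
  by rewrite ler_wpM2l // lerDl.
Qed.

Lemma stop_le_coef (dn up dn' up' : bool -> nat -> R) h t phi z :
  (forall b k, 0 <= dn b k) -> (forall b k, 0 <= up b k) ->
  (forall b k, 0 <= dn' b k) -> (forall b k, 0 <= up' b k) ->
  (forall b k, (0 < k)%N -> dn b k <= dn' b k) ->
  (forall b k, (0 < k)%N -> up b k <= up' b k) ->
  (forall y, 0 <= phi y) ->
  stop dn up kap h t phi z <= stop dn' up' kap h t phi z.
Proof.
move=> d0 u0 d0' u0' dd uu p0; elim: t z => [|t IH] z //=; case: ifP => // _.
apply: le_trans (op_le kap d0' u0' z IH).
have s0 y : 0 <= stop dn up kap h t phi y by exact: stop_ge0.
by rewrite /op lerD // ler_wpM2r ?dd ?uu // sumr_ge0.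
Qed.

Lemma hit_ge_killed h t phi z : (forall y, 0 <= phi y) ->
  stop (kdn lam 1) (kup lam 1) kap h t phi z <= hit h t phi z.
Proof.
move=> p0; apply: stop_le_coef => //.
- by move=> b k; exact: kdn_ge0.
- by move=> b k; exact: kup_ge0.
- by move=> [] k k0; rewrite /kdn /wdn ?mul1r.
- move=> [] k k0; rewrite /kup /wup mul1r // lef_pV2 ?posrE ?ltr0n ?ltr_pwDl //.
  by rewrite lerDr ltW.
Qed.

(** From any vertex below level [J], climbing straight up succeeds within [J] steps with probability
    at least [(1 + lam) ^- J]; the Markov property joins the [i] stretches of [J] steps. *)
Lemma hit_miss J i z : (size z <= J)%N ->
  1 - hit J (i * J) (fun=> 1) z <= (1 - (1 + lam) ^- J) ^+ i.
Proof.
have l1 : 1 <= 1 + lam by rewrite lerDl ltW.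
set dl := (1 + lam) ^- J.
have dl1 : dl <= 1 by rewrite invf_le1 ?exprn_gt0 ?exprn_ege1 // (lt_le_trans ltr01).
have base y : (size y <= J)%N -> dl <= hit J J (fun=> 1) y.
  move=> yJ; apply: le_trans (hit_ge_killed J J y (fun=> ler01)).
  have := @killed_stop_ge R lam 1 J lam0 (lexx 1) kap J (fun=> 1) y 1 kap0.
  rewrite mul1r => /(_ ler01 (fun=> ler01) (fun _ _ => lexx _) yJ (leq_subr _ _)).
  apply: le_trans; rewrite lef_pV2 ?posrE ?exprn_gt0 ?(lt_le_trans ltr01) //.
  by rewrite ler_weXn2l // leq_subr.
have comp B t s : (forall y, (size y <= J)%N -> 1 - hit J t (fun=> 1) y <= B) ->
    forall x, (size x <= J)%N ->
    1 - hit J (s + t) (fun=> 1) x <= B * (1 - hit J s (fun=> 1) x).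
  move=> hB; elim: s => [|s IH] x xJ; have [e|ne] := eqVneq (size x) J.
  - by rewrite !stop_at // subrr mulr0.
  - by rewrite add0n [in leRHS]/= (negbTE ne) subr0 mulr1; exact: hB.
  - by rewrite !stop_at // subrr mulr0.
  have {}xJ : (size x < J)%N by rewrite ltn_neqAle ne xJ.
  rewrite addSn !stopS // -/(walk lam kap _ x) -/(walk lam kap _ x).
  rewrite -!(walk_compl lam0 _ (kap0 x)) /walk -opZ -/(walk lam kap _ x).
  by apply: walk_le_in => y yx; apply: IH; exact: leq_trans yx xJ.
elim: i z => [|i IH] z zJ; first by rewrite mul0n expr0 gerBl stop_ge0.
rewrite mulSn exprS mulrC; apply: le_trans (comp _ _ _ IH _ zJ) _.
by rewrite ler_wpM2l ?exprn_ge0 ?subr_ge0 // lerD2l lerN2 base.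
Qed.

Section barrier.
Variables (mu : nat -> R) (a C0 : R).
Hypotheses (hmu : prob_nat mu) (mu0 : mu 0%N = 0) (a0 : 0 <= a) (C00 : 0 <= C0).

(** During the next [s] steps the barrier is at most [- C0 <= 0], so the lineage being followed
    cannot violate it. Of the branching factors it picks up, only those at first visits to new
    levels are kept, because these see fresh subtrees. *)
Lemma fail_le_newmax (e : seq nat -> R) N s n x l H0 :
  (forall y, 0 <= e y <= 1) ->
  (forall n y H, (n <= N)%N -> H <= - C0 -> e y <= surv mu lam kap n (barrier a H) y) ->
  (n <= N)%N -> H0 + a * s%:R <= - C0 ->
  fail mu lam kap n (barrier a H0) x <=
  newmax (fun y => 1 - (1 - mu 1%N) * e y) s l x.
Proof.
move=> e01 he; have m1 := offspring_le1 hmu 1; have m0 := hmu.1 1%N.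
have psi01 y : 0 <= 1 - (1 - mu 1%N) * e y <= 1.
  have /andP[ey0 ey1] := e01 y.
  have : 0 <= (1 - mu 1%N) * e y by rewrite mulr_ge0 // subr_ge0.
  have : (1 - mu 1%N) * e y <= (1 - mu 1%N) by rewrite ler_piMr // subr_ge0.
  by lra.
elim: s n x l H0 => [|s IH] n x l H0 nN hH.
  by case/andP: (fail01 hmu lam0 kap0 n (barrier a H0) x).
have as0 : 0 <= a * s%:R by rewrite mulr_ge0.
have hH' : H0 + a + a * s%:R <= - C0 by move: hH; rewrite -natr1; lra.
have bar : barrier a H0 0 x.
  rewrite /barrier mulr0 addr0; apply: (@le_trans _ _ 0) => //.
  by move: a0 C00; lra.
case: n nN => [|n] nN.
  by rewrite [leLHS]/= bar; case/andP: (newmax01 s.+1 l x psi01).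
apply: le_trans (fail_le_quadratic hmu lam0 kap0 n mu0 bar) _.
rewrite barrierS; apply: walk_le => // y.
have f01 := fail01 hmu lam0 kap0 n (barrier a (H0 + a)) y.
have /andP[f0 f1] := f01.
have sle : e y <= surv mu lam kap n (barrier a (H0 + a)) y.
  by apply: he; [exact: ltnW|lra].
have {}sle : 1 - (1 - mu 1%N) * surv mu lam kap n (barrier a (H0 + a)) y <=
    1 - (1 - mu 1%N) * e y by rewrite lerD2l lerN2 ler_wpM2l // subr_ge0.
have /andP[p0 p1] := psi01 y.
have IHl l' : fail mu lam kap n (barrier a (H0 + a)) y <=
    newmax (fun y => 1 - (1 - mu 1%N) * e y) s l' y by apply: IH => //; exact: ltnW.
apply: (@le_trans _ _ (fail mu lam kap n (barrier a (H0 + a)) y * (1 - (1 - mu 1%N) * e y))).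
  by rewrite ler_wpM2l.
case: ifP => _; first by rewrite mulrC ler_wpM2l.
by apply: le_trans (IHl l); rewrite ler_piMr.
Qed.

End barrier.
End new_maxima.

Lemma probability_bigcup_le d (T : measurableType d) (R : realType)
    (P : probability T R) (A : nat -> set T) (b : \bar R) :
  (forall n, measurable (A n)) -> (forall n m, (n <= m)%N -> A n `<=` A m) ->
  (forall n, (P (A n) <= b)%E) -> (P (\bigcup_n A n) <= b)%E.
Proof.
move=> mA nd hb.
have nd' : {homo A : n m / (n <= m)%N >-> (n <= m)%O}.
  by move=> n m nm; apply/subsetPset; exact: nd.
have := nondecreasing_cvg_mu (mu := P) mA (bigcupT_measurable _ mA) nd'.
move=> /cvg_lim <- //; apply: lime_le; last by apply: nearW => N; exact: hb.
apply: ereal_nondecreasing_is_cvgn => n m nm.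
by apply: le_measure; rewrite ?inE //; exact: nd.
Qed.

Lemma measurable_gt_set d (T : measurableType d) (R : realType) (f : T -> R) (c : R) :
  measurable_fun setT f -> measurable [set w | c < f w].
Proof.
move=> mf; rewrite (_ : mkset _ = f @^-1` `]c, +oo[%classic).
  by rewrite -[X in measurable X]setTI; exact: mf.
by apply/seteqP; split => w /=; rewrite in_itv /= andbT.
Qed.

Lemma markov_le d (T : measurableType d) (R : realType) (P : probability T R)
    (f : T -> R) (c b : R) : measurable_fun setT f -> (forall w, 0 <= f w) ->
  0 < c -> (\int[P]_w (f w)%:E <= b%:E)%E ->
  (P [set w | (c < f w)%R] <= (b / c)%:E)%E.
Proof.
move=> mf f0 c0 fb; have mA := measurable_gt_set c mf.
set A := mkset _ in mA *.
have h : (c%:E * P A <= b%:E)%E.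
  apply: le_trans fb.
  rewrite -(integral_cst P mA) integral_mkcond; apply: ge0_le_integral => //.
  - by move=> w _; rewrite patchE; case: ifP => // _; rewrite lee_fin ltW.
  - by apply/(measurable_restrictT _ mA); exact: measurable_cst.
  - exact/measurable_EFinP.
  move=> w _; rewrite patchE; case: ifPn => [|_]; last by rewrite lee_fin.
  by rewrite inE /A /= => cw; rewrite lee_fin ltW.
rewrite -(@lee_pmul2l _ c%:E) // -EFinM (_ : (c * (b / c) = b)%R) //.
by field; rewrite gt_eqF.
Qed.

Lemma exists_expr_le (R : realType) (q eps : R) : 0 <= q -> q < 1 -> 0 < eps ->
  exists n, q ^+ n <= eps.
Proof.
move=> q0 q1 e0.
have : (fun n => q ^+ n) @ \oo --> (0 : R) by apply: cvg_expr; rewrite ger0_norm.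
move=> /cvgrPdist_le /(_ _ e0)[n _ hn]; exists n.
by have := hn n (leqnn n); rewrite /= sub0r normrN ger0_norm // exprn_ge0.
Qed.

Section annealed_survival.
Context {R : realType}.
Variables (mu : nat -> R) (lam m' tau : R) (h k : nat) (a C0 : R).
Hypotheses (hmu : prob_nat mu) (mu0 : mu 0%N = 0) (mu1 : mu 1%N < 1).
Hypotheses (lam0 : 0 < lam) (m'1 : 1 <= m') (h0 : (0 < h)%N) (hk : (h <= k)%N).
Hypothesis tau01 : 0 < tau <= 1.
Hypothesis lin : forall t, 0 <= t <= tau -> m' * t <= 1 - pgf mu (1 - t).
Hypotheses (a0 : 0 <= a) (akh : a * k%:R <= h%:R) (akC : a * k%:R <= C0).
Context {d : measure_display} {Om : measurableType d}.
Variables (P : probability Om R) (p : nat -> R) (K : seq nat -> Om -> nat).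
Hypothesis Klaw : nat_rv_law P K p.
Hypothesis Kind : indep1 P K (fun _ => True).
Hypothesis K0 : forall u w, (0 < K u w)%N.
Variables (e r : R).
Hypotheses (e0 : 0 < e) (r1 : r < 1).
Hypothesis We : (\int[P]_w (npow e (block_mass lam m' h k (K^~ w)))%:E <= r%:E)%E.

Let X (w : Om) : Tree := K^~ w.
Let c0 : R := tau * m' ^- k.
Let c' : R := (1 - mu 1%N) * c0.

Let c00 : 0 < c0.
Proof.
have /andP[tau0 _] := tau01.
by rewrite mulr_gt0 // invr_gt0 exprn_gt0 // (lt_le_trans ltr01).
Qed.

Let c01 : c0 <= 1.
Proof.
have /andP[tau0 tau1] := tau01.
rewrite /c0 ler_pdivrMr ?exprn_gt0 ?(lt_le_trans ltr01) // mul1r.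
by rewrite (le_trans tau1) // exprn_ege1.
Qed.

Let c'0 : 0 < c'. Proof. by rewrite mulr_gt0 // subr_gt0. Qed.
Let c'1 : c' <= 1.
Proof.
rewrite mulr_ile1 ?(ltW c00) ?subr_ge0 ?(ltW mu1) //.
by have := hmu.1 1%N; lra.
Qed.

Let psi N (kap : tree) : R := 1 - c' * casc lam m' h k N kap.

Let psi01 N kap : 0 <= psi N kap <= 1.
Proof.
have /andP[q0 q1] := casc01 h k lam0 m'1 N kap.
have : 0 <= c' * casc lam m' h k N kap by rewrite mulr_ge0 // ltW.
have : c' * casc lam m' h k N kap <= 1 by rewrite mulr_ile1 // ltW.
by rewrite /psi; lra.
Qed.

Let mpsi N : measurable_fun setT (psi N : Tree -> R).
Proof.
apply: measurable_funB => //; apply: measurable_funM => //.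
exact: measurable_casc.
Qed.

Let bnd J t N (kap : tree) : R :=
  (1 - stop (wdn lam) (wup lam) kap J t (fun=> 1) [::]) +
    J%:R^-1 * \sum_(1 <= j < J.+1)
      stop (wdn lam) (wup lam) kap j t (fun y => psi N (subtree kap y) ^+ J) [::].

Let fail_le_bnd J t N w : (0 < J)%N ->
  fail mu lam (X w) N (barrier a (- (C0 + a * t%:R))) [::] <= bnd J t N (X w).
Proof.
move=> J0; have Xw0 x : (0 < X w x)%N := K0 x w.
have C00 : 0 <= C0 by rewrite (le_trans _ akC) // mulr_ge0.
have m'0 : 0 < m' by exact: lt_le_trans m'1.
apply: le_trans (newmax_le_mean lam0 Xw0 t J0 _); last by move=> y; exact: psi01.
have := @fail_le_newmax R lam (X w) lam0 Xw0 mu a C0 hmu mu0 a0 C00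
  (fun y => c0 * casc lam m' h k N (subtree (X w) y)) N t N [::] 0%N
  (- (C0 + a * t%:R)).
rewrite opprD subrK => /(_ _ _ (leqnn N) (lexx _)) H.
apply: le_trans (H _ _) _.
- move=> y; have /andP[q0 q1] := casc01 h k lam0 m'1 N (subtree (X w) y).
  by rewrite mulr_ge0 ?(ltW c00) //= mulr_ile1 // ltW.
- move=> n y H0 nN hH0.
  have := @cascade_survival R mu lam hmu lam0 (X w) Xw0 m' tau m' h k m'1 m'0
    (lexx m') h0 tau01 lin a C0 a0 akh akC n y H0.
  rewrite divff ?gt_eqF // expr1n mul1r => H1.
  apply: le_trans (H1 _); first by rewrite ler_wpM2l ?(ltW c00) // casc_le.
  by apply: le_trans hH0 _; rewrite lerDr.
apply: eq_imp_le; congr (newmax _ _ _ _ _ _); apply/funext => y.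
by rewrite /psi /c' mulrA.
Qed.

Let bnd_mono J t M N w : (M <= N)%N -> bnd J t M (X w) <= bnd J t N (X w).
Proof.
move=> MN; rewrite lerD2l ler_wpM2l ?invr_ge0 //; apply: ler_sum => j _.
apply: stop_le; [exact: wdn_ge0|exact: wup_ge0|move=> y _].
have /andP[p0 _] := psi01 M (subtree (X w) y).
have /andP[q0 _] := psi01 N (subtree (X w) y).
rewrite lerXn2r ?nnegrE // lerD2l lerN2 ler_wpM2l ?(ltW c'0) //.
exact: casc_le.
Qed.

Let mbnd J t N : measurable_fun setT (fun w => bnd J t N (X w)).
Proof.
have mX := measurable_random_tree Klaw.
suff mb : measurable_fun setT (bnd J t N : Tree -> R) by exact: (measurableT_comp mb mX).
apply: measurable_funD.
  apply: measurable_funB => //.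
  exact: (measurable_stop _ _ J t (F := fun _ _ => 1)).
apply: measurable_funM => //; apply: measurable_sum => j.
apply: (measurable_stop _ _ j t (F := fun y kap => psi N (subtree kap y) ^+ J)) => y.
apply: measurable_funX; exact: (measurableT_comp (mpsi N) (measurable_subtree y)).
Qed.

Let bnd_ge0 J t N w : 0 <= bnd J t N (X w).
Proof.
rewrite addr_ge0 // ?subr_ge0; first exact: (hit_le1 lam0 (fun x => K0 x w)).
rewrite mulr_ge0 ?invr_ge0 //; apply: sumr_ge0 => j _.
apply: stop_ge0; [exact: wdn_ge0|exact: wup_ge0|move=> y].
by rewrite exprn_ge0 //; case/andP: (psi01 N (subtree (X w) y)).
Qed.

(** Three errors of [eps / 3]: [s] bounds the probability of a bad subtree, then [J] makes the
    [J]-th power small on good subtrees, and finally [i] makes it unlikely to miss level [J] during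
    [i * J] steps. *)
Lemma annealed_bound (eps : R) : 0 < eps -> exists J t : nat, (0 < J)%N /\
  forall N, (\int[P]_w (bnd J t N (X w))%:E <= eps%:E)%E.
Proof.
move=> eps0; have e3 : 0 < eps / 3 by rewrite divr_gt0.
have mX := measurable_random_tree Klaw.
have [s s0 hs] := casc_tail lam0 m'1 hk Klaw Kind K0 e0 r1 We e3.
pose s1 := Num.min s 1.
have s10 : 0 < s1 by rewrite lt_min s0 ltr01.
have s11 : s1 <= 1 by rewrite ge_min lexx orbT.
have cs1 : 0 < c' * s1 by rewrite mulr_gt0.
have cs2 : c' * s1 <= 1 by rewrite mulr_ile1 // ltW.
have [J' hJ'] : exists n, (1 - c' * s1) ^+ n <= eps / 3.
  by apply: exists_expr_le => //; lra.
pose J := J'.+1.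
have hJ : (1 - c' * s1) ^+ J <= eps / 3.
  by rewrite /J exprS; apply: le_trans hJ'; rewrite ler_piMl ?exprn_ge0; lra.
pose dl := (1 + lam) ^- J.
have dl0 : 0 < dl by rewrite invr_gt0 exprn_gt0 // addr_gt0.
have dl1 : dl <= 1.
  by rewrite invf_le1 ?exprn_gt0 ?exprn_ege1 ?addr_gt0 // lerDl ltW.
have [i hi] : exists n, (1 - dl) ^+ n <= eps / 3.
  by apply: exists_expr_le => //; lra.
exists J, (i * J)%N; split => // N.
have hF : (\int[P]_w ((psi N (X w)) ^+ J)%:E <= (eps / 3 + eps / 3)%:E)%E.
  pose A := [set w | (casc lam m' h k N (X w) < s)%R].
  have mA : measurable A.
    have mc : measurable_fun setT (fun w => - casc lam m' h k N (X w)).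
      apply: measurableT_comp => //.
      exact: (measurableT_comp (measurable_casc _ _ _ _ N) mX).
    have := measurable_gt_set (- s) mc; congr (measurable _).
    by apply/seteqP; split => w; rewrite /A /= ltrN2.
  apply: (@le_trans _ _ (\int[P]_w ((\1_A w)%:E + (eps / 3)%:E))%E).
    apply: ge0_le_integral => //.
    - by move=> w _; rewrite lee_fin exprn_ge0 //; case/andP: (psi01 N (X w)).
    - apply/measurable_EFinP; apply: measurable_funX.
      exact: (measurableT_comp (mpsi N) mX).
    - apply: emeasurable_funD => //; apply/measurable_EFinP.
      exact: measurable_indic.
    move=> w _; rewrite -EFinD lee_fin.
    have /andP[p0 p1] := psi01 N (X w).
    have [cs|cs] := ltP (casc lam m' h k N (X w)) s.
      rewrite indicE mem_set //.
      by apply: le_trans (exprn_ile1 J p0 p1) _; rewrite lerDl ltW.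
    rewrite indicE memNset ?add0r; last by rewrite /A /=; apply/negP; rewrite -leNgt.
    apply: le_trans hJ; rewrite lerXn2r ?nnegrE //; first lra.
    rewrite lerD2l lerN2 ler_wpM2l ?(ltW c'0) // (le_trans _ cs) //.
    by rewrite ge_min lexx.
  have mi : measurable_fun setT (fun w => (\1_A w)%:E : \bar R).
    by apply/measurable_EFinP; exact: measurable_indic.
  rewrite ge0_integralD //; last by move=> w _; rewrite lee_fin ltW.
  rewrite integral_cst_prob integral_indic // setIT EFinD leeD2r //; exact: hs.
have [c Fc] : exists c : R, (\int[P]_w ((psi N (X w)) ^+ J)%:E = c%:E)%E.
  exists (fine (\int[P]_w ((psi N (X w)) ^+ J)%:E)); rewrite fineK //.
  rewrite ge0_fin_numE ?(le_lt_trans hF) ?ltry //.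
  by apply: integral_ge0 => w _; rewrite lee_fin exprn_ge0 //; case/andP: (psi01 N (X w)).
have ce : c <= eps / 3 + eps / 3 by rewrite -lee_fin -Fc.
have cc0 : 0 <= c.
  rewrite -lee_fin -Fc; apply: integral_ge0 => w _.
  by rewrite lee_fin exprn_ge0 //; case/andP: (psi01 N (X w)).
have mF : measurable_fun setT (fun kap : Tree => psi N kap ^+ J) by exact: measurable_funX.
have F0 (kap : Tree) : 0 <= psi N kap ^+ J.
  by rewrite exprn_ge0 //; case/andP: (psi01 N kap).
pose hj j w := stop (wdn lam) (wup lam) (X w) j (i * J) (fun y => psi N (subtree (X w) y) ^+ J) [::].
have hj0 j w : 0 <= hj j w.
  by apply: stop_ge0; [exact: wdn_ge0|exact: wup_ge0|move=> y; exact: F0].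
have mhj j : measurable_fun setT (hj j).
  have mS := measurable_stop (wdn lam) (wup lam) j (i * J)
    (F := fun y kap => psi N (subtree kap y) ^+ J) [::].
  apply: (measurableT_comp (mS _) mX) => y.
  apply: measurable_funX; exact: (measurableT_comp (mpsi N) (measurable_subtree y)).
have ihj j : (\int[P]_w (hj j w)%:E <= c%:E)%E.
  have := @stop_integral _ _ _ P p K Klaw Kind (wdn lam) (wup lam)
    (wdn_ge0 lam0) (wup_ge0 lam0) _ _ j (i * J) (fun=> 1) [::] mF F0 Fc.
  move=> /(_ (measurable_cst _) (fun=> ler01) (fun _ _ _ => erefl) isT).
  under eq_integral do rewrite mul1r.
  rewrite -/(hj j) => ->; rewrite -[leRHS]mule1 lee_wpmul2l ?lee_fin //.
  rewrite -(integral_cst_prob P 1); apply: ge0_le_integral => //.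
  - move=> w _; rewrite lee_fin mul1r.
    by apply: stop_ge0; [exact: wdn_ge0|exact: wup_ge0|].
  - apply/measurable_EFinP/measurable_funM => //.
    have mS := measurable_stop (wdn lam) (wup lam) j (i * J) (F := fun _ _ => 1) [::].
    exact: (measurableT_comp (mS (fun=> measurable_cst _)) mX).
  - by move=> w _; rewrite lee_fin mul1r; exact: (hit_le1 lam0 (fun x => K0 x w)).
have Jn : 0 < J%:R :> R by rewrite ltr0n.
apply: (@le_trans _ _ (\int[P]_w ((eps / 3)%:E +
    \sum_(1 <= j < J.+1) (J%:R^-1 * hj j w)%:E))%E).
  apply: ge0_le_integral => //.
  - by move=> w _; rewrite lee_fin bnd_ge0.
  - exact/measurable_EFinP/mbnd.
  - apply: emeasurable_funD => //; apply: emeasurable_sum => j.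
    by apply/measurable_EFinP/measurable_funM.
  move=> w _; rewrite sumEFin -EFinD lee_fin /bnd mulr_sumr lerD //.
  by apply: le_trans hi; exact: (hit_miss lam0 (fun x => K0 x w)).
rewrite ge0_integralD //; last 3 first.
- by move=> w _; rewrite lee_fin ltW.
- by move=> w _; apply: sume_ge0 => j _; rewrite lee_fin mulr_ge0 // invr_ge0.
- by apply: emeasurable_sum => j; apply/measurable_EFinP/measurable_funM.
rewrite integral_cst_prob ge0_integral_sum //; last 2 first.
- by move=> j; apply/measurable_EFinP/measurable_funM.
- by move=> j w _; rewrite lee_fin mulr_ge0 // invr_ge0.
apply: (@le_trans _ _ ((eps / 3)%:E + \sum_(1 <= j < J.+1) (J%:R^-1 * c)%:E)%E).
  rewrite leeD2l //; apply: lee_sum => j _.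
  under eq_integral do rewrite EFinM.
  rewrite [leLHS](_ : _ = (J%:R^-1)%:E * \int[P]_w (hj j w)%:E)%E; last first.
    apply: ge0_integralZl.
    - exact: measurableT.
    - exact/measurable_EFinP.
    - by move=> w _; rewrite lee_fin.
    - by rewrite lee_fin invr_ge0.
  by rewrite EFinM lee_wpmul2l // lee_fin invr_ge0.
rewrite sumEFin big_const_nat iter_addr addr0 subn1 /= -EFinD lee_fin.
have -> : (J%:R^-1 * c) *+ J = c by rewrite -mulr_natl mulrA mulfV ?gt_eqF // mul1r.
by lra.
Qed.

(** [bnd] increases with [N], so Markov's inequality controls the union over all [N]; along a
    sequence of bounds tending to 0 the exceptional events have null intersection. *)
Lemma fail_ae_small : {ae P, forall w, forall eta : R, 0 < eta ->
  exists C : R, forall N, fail mu lam (X w) N (barrier a (- C)) [::] <= eta}.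
Proof.
suff H (j : nat) : {ae P, forall w, exists C : R, forall N,
    fail mu lam (X w) N (barrier a (- C)) [::] <= j.+1%:R^-1}.
  have := ae_foralln H; apply: filterS => w Hw eta eta0.
  have [n _ hn] := near_infty_natSinv_lt (PosNum eta0).
  have [C hC] := Hw n; exists C => N; apply: le_trans (hC N) _.
  by apply/ltW/(hn n) => /=.
set eta := j.+1%:R^-1; have eta0 : 0 < eta by rewrite invr_gt0.
have ev n := annealed_bound (eps := n.+1%:R^-1) (ltac:(by rewrite invr_gt0)).
pose Jn n := projT1 (cid (ev n)).
have [Jt hJt] : {Jt : nat -> nat * nat & forall n, (0 < (Jt n).1)%N /\
    forall N, (\int[P]_w (bnd (Jt n).1 (Jt n).2 N (X w))%:E <= (n.+1%:R^-1)%:E)%E}.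
  have ch n : {Jt : nat * nat & (0 < Jt.1)%N /\
      forall N, (\int[P]_w (bnd Jt.1 Jt.2 N (X w))%:E <= (n.+1%:R^-1)%:E)%E}.
    by have [J /cid[t Jt]] := cid (ev n); exists (J, t).
  by exists (fun n => projT1 (ch n)) => n; exact: (projT2 (ch n)).
pose B n N := [set w | eta < bnd (Jt n).1 (Jt n).2 N (X w)].
have mB n N : measurable (B n N) by apply: measurable_gt_set; exact: mbnd.
pose Bu n := \bigcup_N B n N.
have mBu n : measurable (Bu n) by exact: bigcupT_measurable.
have PB n : (P (Bu n) <= (n.+1%:R^-1 / eta)%:E)%E.
  apply: probability_bigcup_le => // [N M NM w|N].
    by rewrite /B /= => /lt_le_trans; apply; exact: bnd_mono.
  apply: markov_le; [exact: mbnd|exact: bnd_ge0|exact: eta0|exact: (hJt n).2].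
exists (\bigcap_n Bu n); split.
- exact: bigcapT_measurable.
- apply/eqP; rewrite eq_le measure_ge0 andbT; apply/lee_addgt0Pr => ep ep0.
  rewrite add0e.
  have ee0 : 0 < ep * eta by rewrite mulr_gt0.
  have [n _ hn] := near_infty_natSinv_lt (PosNum ee0).
  apply: (@le_trans _ _ (P (Bu n))).
    apply: le_measure; rewrite ?inE //; first exact: bigcapT_measurable.
    by move=> w; exact.
  apply: le_trans (PB n) _; rewrite lee_fin ler_pdivrMr //.
  by apply/ltW/(hn n) => /=.
move=> w /= nw n _; apply: contrapT => nB; apply: nw.
exists (C0 + a * (Jt n).2%:R) => N.
apply: le_trans (fail_le_bnd (Jt n).2 N w (hJt n).1) _.
by rewrite leNgt; apply/negP => lt; apply: nB; exists N.
Qed.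

End annealed_survival.

(** * Hitting times and large deviations *)

Section hitting_estimates.
Context {R : realType}.
Variables (lam : R) (kap : tree).
Hypotheses (lam0 : 0 < lam) (kap0 : forall x, (0 < kap x)%N).

Let dn0 := wdn_ge0 lam0.
Let up0 := wup_ge0 lam0.
Let kd0 c (c0 : 0 <= c) b k : 0 <= kdn lam c b k. Proof. exact: kdn_ge0. Qed.
Let ku0 c (c0 : 0 <= c) b k : 0 <= kup lam c b k. Proof. exact: kup_ge0. Qed.

Notation hit := (stop (wdn lam) (wup lam) kap).

Definition walkn (n : nat) (phi : seq nat -> R) := iter n (walk lam kap) phi.

Definition above (h : nat) (x : seq nat) : R := (h <= size x)%N%:R.

Lemma above01 h x : 0 <= above h x <= 1.
Proof. by rewrite /above; case: (_ <= _)%N; rewrite ?ler01 ?lexx. Qed.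

Lemma walkn_ge0 n phi x : (forall y, 0 <= phi y) -> 0 <= walkn n phi x.
Proof. by move=> p0; elim: n x => [|n IH] x //=; exact: walk_ge0. Qed.

Lemma walkn_le n phi psi x : (forall y, phi y <= psi y) -> walkn n phi x <= walkn n psi x.
Proof. by move=> h; elim: n x => [|n IH] x //=; exact: walk_le. Qed.

Lemma walkn_le_cst n phi c x : (forall y, phi y <= c) -> walkn n phi x <= c.
Proof. by move=> h; elim: n x => [|n IH] x //=; exact: walk_le_cst. Qed.

Lemma walkn_above_eq0 n h x : (size x + n < h)%N -> walkn n (above h) x = 0.
Proof.
elim: n x => [|n IH] x hx.
  by rewrite /= /above leqNgt -[size x]addn0 hx.
rewrite /= -(walk_cst lam0 0 (kap0 x)); apply/eqP; rewrite eq_le; apply/andP; split.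
  apply: (walk_le_in kap lam0) => y yx; rewrite IH //.
  by apply: leq_ltn_trans hx; rewrite addnS -addSn leq_add2r.
by apply: walk_le => // y; apply: walkn_ge0 => z; case/andP: (above01 h z).
Qed.

Lemma walkn_le_hit r h z : (size z <= h)%N ->
  walkn r (above h) z <= hit h r (fun=> 1) z.
Proof.
elim: r z => [|r IH] z zh.
  by rewrite /= /above eqn_leq zh /=; case: (_ <= _)%N.
have [e|ne] := eqVneq (size z) h.
  rewrite [leRHS]stop_at //; apply: walkn_le_cst => y.
  by case/andP: (above01 h y).
rewrite [leRHS]stopS //; apply: (walk_le_in kap lam0) => y yz; apply: IH.
by apply: leq_trans yz _; rewrite ltn_neqAle ne.
Qed.

Lemma hit_le_sum h r z : hit h r (fun=> 1) z <= \sum_(t < r.+1) walkn t (above h) z.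
Proof.
elim: r z => [|r IH] z.
  rewrite big_ord1 /= /above; case: eqP => [->|_]; rewrite ?leqnn //.
have w0 t y : 0 <= walkn t (above h) y.
  by apply: walkn_ge0 => u; case/andP: (above01 h u).
rewrite big_ord_recl; have [e|ne] := eqVneq (size z) h.
  rewrite stop_at // [walkn _ _ _]/= {1}/above e leqnn lerDl.
  by apply: sumr_ge0 => i _; exact: w0.
rewrite stopS //; apply: (@le_trans _ _ (\sum_(i < r.+1) walkn (bump 0 i) (above h) z)).
  rewrite (eq_bigr (fun i : 'I_r.+1 => walk lam kap (walkn i (above h)) z)) //.
  by rewrite -(walk_sum lam0 kap0); exact: walk_le.
by rewrite lerDr w0.
Qed.

(** Probability of reaching level [h] within [r] steps and without visiting the root, starting point
    included. *)
Fixpoint nret (h r : nat) (z : seq nat) : R :=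
  if nilp z then 0 else if size z == h then 1 else
  if r is r'.+1 then walk lam kap (nret h r') z else 0.

Lemma nret_ge0 h r z : 0 <= nret h r z.
Proof.
elim: r z => [|r IH] z /=; case: ifP => // _; case: ifP => // _.
exact: walk_ge0.
Qed.

Lemma nret_leS h r z : nret h r z <= nret h r.+1 z.
Proof.
elim: r z => [|r IH] z; rewrite /=; case: ifP => // _; case: ifP => // _.
  by apply: walk_ge0 => // y; case: ifP => // _; case: ifP.
by apply: walk_le => // y; exact: IH.
Qed.

Lemma hit_le_nret h r z : ~~ nilp z ->
  hit h r (fun=> 1) z <= nret h r z + hit h r (fun=> 1) [::].
Proof.
have s0 r' z' : 0 <= hit h r' (fun=> 1) z' by exact: stop_ge0.
elim: r z => [|r IH] z nz.
  by rewrite [nret _ _ _]/= (negbTE nz) [leLHS]/= lerDl.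
have [e|ne] := eqVneq (size z) h.
  by rewrite stop_at // [nret _ _ _]/= (negbTE nz) e eqxx lerDl.
rewrite stopS // [nret _ _ _]/= (negbTE nz) (negbTE ne).
apply: (@le_trans _ _ (walk lam kap (fun y => nret h r y + hit h r (fun=> 1) [::]) z)).
  apply: walk_le => // y; have [ny|ny] := boolP (nilp y); last exact: IH.
  by rewrite (nilP ny) lerDr nret_ge0.
rewrite /walk opD -!/(walk lam kap _ _) (walk_cst lam0 _ (kap0 z)) lerD2l.
by apply: stop_leS.
Qed.

Definition climb (h r : nat) : R := walk lam kap (nret h r) [::].

(** Union bound over the visits to the root: the last one before level [h] is reached starts a
    [climb], and there are at most [k + 1] candidates. *)
Lemma hit_root_le h k : (0 < h)%N -> hit h k.+1 (fun=> 1) [::] <= k.+1%:R * climb h k.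
Proof.
move=> h0; have h0' : size ([::] : seq nat) != h by rewrite eq_sym -lt0n.
have st j : hit h j.+1 (fun=> 1) [::] <= climb h j + hit h j (fun=> 1) [::].
  rewrite stopS // -/(walk lam kap _ _).
  apply: (@le_trans _ _ (walk lam kap (fun y => nret h j y + hit h j (fun=> 1) [::]) [::])).
    apply: walk_le => // y; have [ny|ny] := boolP (nilp y); last exact: hit_le_nret.
    by rewrite (nilP ny) lerDr nret_ge0.
  by rewrite /walk opD -!/(walk lam kap _ _) (walk_cst lam0 _ (kap0 _)).
elim: k => [|k IH].
  by apply: le_trans (st 0%N) _; rewrite /= (negbTE h0') addr0 mul1r.
apply: le_trans (st k.+1) _; rewrite -[k.+2%:R]natr1 mulrDl mul1r addrC lerD2r.
apply: le_trans IH _; rewrite ler_wpM2l //.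
by apply: walk_le => // y; exact: nret_leS.
Qed.

Lemma nret_le_killed h r z :
  nret h r z <= stop (kdn lam 1) (kup lam 1) kap h r (fun=> 1) z.
Proof.
have s0 r' z' : 0 <= stop (kdn lam 1) (kup lam 1) kap h r' (fun=> 1) z'.
  by apply: stop_ge0 => //; [exact: kd0|exact: ku0].
elim: r z => [|r IH] z /=; first by case: ifP => // _; case: ifP.
case: ifPn => [_|nz]; first by case: ifP => // _; apply: op_ge0 => //; [exact: kd0|exact: ku0].
case: ifP => // _; rewrite /walk /op /kdn /kup /wdn /wup (negbTE nz) !mul1r.
rewrite lerD //; first by rewrite ler_wpM2l // divr_ge0 ?addr_ge0 ?(ltW lam0).
rewrite ler_wpM2l ?invr_ge0 ?addr_ge0 ?(ltW lam0) //.
by apply: ler_sum => i _.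
Qed.

(** Killing below the root costs a polynomial factor, invisible on the exponential scale: [k + 1]
    for the choice of the excursion and [1 + lam] for its first step, whose killed weight is
    [1 / (lam + j)] instead of [1 / j] at a root with [j] children. *)
Lemma killed_hit_ge h k : (0 < h)%N ->
  hit h k.+1 (fun=> 1) [::] <=
  k.+1%:R * (1 + lam) * stop (kdn lam 1) (kup lam 1) kap h k.+1 (fun=> 1) [::].
Proof.
move=> h0; have h0' : size ([::] : seq nat) != h by rewrite eq_sym -lt0n.
apply: le_trans (hit_root_le k h0) _; rewrite -mulrA ler_wpM2l //.
rewrite stopS // /climb /walk /op /= !mul0r !add0r /kup mul1r.
have s0 : 0 <= \sum_(i < kap [::]) nret h k [:: nat_of_ord i].
  by apply: sumr_ge0 => i _; exact: nret_ge0.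
have s1 : \sum_(i < kap [::]) nret h k [:: nat_of_ord i] <=
    \sum_(i < kap [::]) stop (kdn lam 1) (kup lam 1) kap h k (fun=> 1) [:: nat_of_ord i].
  by apply: ler_sum => i _; exact: nret_le_killed.
have k1 : 1 <= (kap [::])%:R :> R by rewrite ler1n.
have k0 : 0 < (kap [::])%:R :> R by rewrite ltr0n.
rewrite mulrA; apply: ler_pM => //.
rewrite ler_pdivlMr ?addr_gt0 // mulrC ler_pdivrMr //.
have : 0 <= lam * ((kap [::])%:R - 1) by rewrite mulr_ge0 ?(ltW lam0) ?subr_ge0.
by lra.
Qed.

(** Paths that enter level [h] after time [s] carry at least the weight [mt ^+ s]. *)
Lemma block_mass_ge_killed mt h k s : 1 <= mt -> (s <= k)%N ->
  mt ^+ s * (stop (kdn lam 1) (kup lam 1) kap h k (fun=> 1) [::] -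
             stop (kdn lam 1) (kup lam 1) kap h s (fun=> 1) [::]) <=
  block_mass lam mt h k kap.
Proof.
move=> mt1; rewrite /block_mass.
have mt0 : 0 <= mt by exact: le_trans mt1.
elim: k s [::] => [|k IH] [|s] z sk //.
- by rewrite expr0 mul1r subrr; apply: stop_ge0 => //; [exact: kd0|exact: ku0].
- rewrite expr0 mul1r.
  apply: (@le_trans _ _ (stop (kdn lam 1) (kup lam 1) kap h k.+1 (fun=> 1) z)).
    by rewrite gerBl; apply: stop_ge0 => //; [exact: kd0|exact: ku0].
  apply: stop_le_coef => //; [exact: kd0|exact: ku0|exact: kd0|exact: ku0| |].
    move=> [] j j0 //=; rewrite ler_wpM2r // divr_ge0 ?addr_ge0 ?(ltW lam0) //.
  by move=> [] j j0 /=; rewrite ler_wpM2r // invr_ge0 addr_ge0 ?(ltW lam0).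
have [e|ne] := eqVneq (size z) h; first by rewrite !stop_at // subrr mulr0.
rewrite ![stop _ _ _ _ _.+1 _ _]stopS // -!/(killed lam _ kap _ z).
rewrite [leRHS]killedE exprS -mulrA ler_wpM2l //.
rewrite (_ : mt ^+ s * _ = killed lam 1 kap (fun y => mt ^+ s *
  (stop (kdn lam 1) (kup lam 1) kap h k (fun=> 1) y + -1 *
   stop (kdn lam 1) (kup lam 1) kap h s (fun=> 1) y)) z); last first.
  by rewrite /killed opZ opD opZ; ring.
by apply: killed_le => // y; rewrite mulN1r; exact: IH.
Qed.

Definition loop (t : nat) : R :=
  iter t (killed lam 1 kap) (fun y => (nilp y)%:R) [::].

(* Waiting at the root costs [loop t] per [t] steps but gains [mt ^+ t]. *)
Lemma block_mass_loop mt h k t : 1 <= mt -> (t < h)%N -> 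
  mt ^+ t * loop t * block_mass lam mt h k kap <= block_mass lam mt h (t + k) kap.
Proof.
move=> mt1 th; have mt0 : 0 <= mt by exact: le_trans mt1.
rewrite /loop /block_mass.
have s0 r' z' : 0 <= stop (kdn lam mt) (kup lam mt) kap h r' (fun=> 1) z'.
  by apply: stop_ge0 => //; [exact: kd0|exact: ku0].
suff gen z j : (size z + j < h)%N ->
    mt ^+ j * iter j (killed lam 1 kap) (fun y => (nilp y)%:R) z *
    stop (kdn lam mt) (kup lam mt) kap h k (fun=> 1) [::] <=
    stop (kdn lam mt) (kup lam mt) kap h (j + k) (fun=> 1) z by exact: gen.
elim: j z => [|j IH] z zh.
  rewrite expr0 mul1r add0n [iter _ _ _ _]/=; case: z {zh} => [|i z]; first by rewrite mul1r.
  by rewrite mul0r; exact: s0.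
have zh' : size z != h by rewrite ltn_eqF // (leq_ltn_trans (leq_addr _ _) zh).
rewrite addSn stopS // -/(killed lam mt kap _ z) [leRHS]killedE exprS -!mulrA ler_wpM2l //.
rewrite iterS (_ : mt ^+ j * _ = killed lam 1 kap (fun y => mt ^+ j *
  (stop (kdn lam mt) (kup lam mt) kap h k (fun=> 1) [::] *
   iter j (killed lam 1 kap) (fun y => (nilp y)%:R) y)) z); last first.
  by rewrite /killed !opZ; ring.
apply: op_le_in => //; [exact: kd0|exact: ku0| |].
- move=> z0; rewrite mulrCA mulrC; apply: IH; apply: leq_ltn_trans zh.
  by rewrite size_behead addnS -addSn leq_add2r (leq_trans (leq_pred _)).
- move=> i _; rewrite mulrCA mulrC; apply: IH; apply: leq_ltn_trans zh.
  by rewrite /= addSnnS.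
Qed.

End hitting_estimates.

Section real_bounds.
Context {R : realType}.

(** Meaningful for [x >= 0] only, because of the absolute value. *)
Definition ceiln (x : R) : nat := `|Num.ceil x|%N.

Lemma ceiln_le (x : R) (n : nat) : 0 <= x -> (ceiln x <= n)%N = (x <= n%:R).
Proof.
move=> x0; have c0 : 0 <= Num.ceil x by rewrite ceil_ge0 (lt_le_trans _ x0) // ltrN10.
rewrite /ceiln; have := ceil_le_int x n%:Z; rewrite -pmulrn => <-.
by rewrite -{2}(gez0_abs c0) lez_nat.
Qed.

Lemma ceiln_ge (x : R) : 0 <= x -> x <= (ceiln x)%:R.
Proof. by move=> x0; rewrite -ceiln_le. Qed.

Lemma poly_le_exp (A dl : R) : 0 < dl ->
  \forall k \near \oo, A * k.+1%:R ^+ 2 <= expR (dl * k%:R).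
Proof.
move=> dl0; near=> k.
have k1 : 1 <= k%:R :> R by rewrite ler1n; near: k; exact: nbhs_infty_ge.
have kA : 24 * `|A| / dl ^+ 3 <= k%:R by near: k; exact: nbhs_infty_ger.
have dk0 : 0 <= dl * k%:R by rewrite mulr_ge0 // ltW.
have := expR_ge1Dxn 2 dk0; rewrite (_ : 3`!%:R = 6 :> R) //.
have : A * k.+1%:R ^+ 2 <= (dl * k%:R) ^+ 3 / 6; last by lra.
have A1 : A * k.+1%:R ^+ 2 <= `|A| * (4 * k%:R ^+ 2).
  apply: (@le_trans _ _ (`|A| * k.+1%:R ^+ 2)).
    by rewrite ler_wpM2r ?exprn_ge0 // ler_norm.
  rewrite ler_wpM2l // -natr1.
  have : 0 <= (k%:R - 1) * (3 * k%:R + 1) :> R by rewrite mulr_ge0 ?subr_ge0 // addr_ge0 // mulr_ge0.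
  by rewrite !expr2; lra.
apply: le_trans A1 _.
move: kA; rewrite ler_pdivrMr ?exprn_gt0 // => kA.
have k20 : 0 <= k%:R ^+ 2 / 6 :> R by rewrite divr_ge0 // exprn_ge0.
have := ler_wpM2l k20 kA.
by congr (_ <= _); field.
Unshelve. all: by end_near. Qed.

End real_bounds.

(** * Growth of the block mass from large deviations *)

Section large_deviations.
Context {R : realType}.
Variables (lam : R) (kap : tree) (v : R) (I : R -> R).
Hypotheses (lam0 : 0 < lam) (kap0 : forall x, (0 < kap x)%N).
Hypotheses (v0 : 0 <= v) (Ipos : forall y, v < y <= 1 -> 0 < I y).

Definition tail (n h : nat) : R := walkn lam kap n (above h) [::].

Hypothesis ldp : forall y : R, v < y <= 1 ->
  (fun n => ln (tail n (ceiln (y * n%:R))) / n%:R) @ \oo --> - I y.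

Let tail01 n h : 0 <= tail n h <= 1.
Proof.
by rewrite walkn_ge0 ?walkn_le_cst // => y; case/andP: (@above01 R h y).
Qed.

Let tail_decr n h h' : (h <= h')%N -> tail n h' <= tail n h.
Proof.
move=> hh; apply: walkn_le => // y; rewrite /above ler_nat.
by case: (leqP h' (size y)) => // /(leq_trans hh) ->.
Qed.

Let tail_eq0 n h : (n < h)%N -> tail n h = 0.
Proof. by move=> nh; rewrite /tail walkn_above_eq0. Qed.

Lemma ldp_bounds y dl : v < y <= 1 -> 0 < dl ->
  \forall n \near \oo, expR (- (n%:R * (I y + dl))) <= tail n (ceiln (y * n%:R))
    <= expR (- (n%:R * (I y - dl))).
Proof.
move=> vy dl0; have Iy := Ipos vy.
have /cvgrPdist_lt ev := ldp vy.
have m0 : 0 < Num.min dl (I y) by rewrite lt_min dl0.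
near=> n.
have n1 : 0 < n%:R :> R by rewrite ltr0n; near: n; exact: nbhs_infty_gt.
have : `|- I y - ln (tail n (ceiln (y * n%:R))) / n%:R| < Num.min dl (I y).
  by near: n; exact: ev.
set t := tail n _; rewrite lt_min => /andP[h1 h2].
have t0 : 0 < t.
  have [//|tn] := ltP 0 t.
  by move: h2; rewrite (ln0 tn) mul0r subr0 normrN gtr0_norm ?ltxx.
have e : ln t = n%:R * (ln t / n%:R) by field; rewrite gt_eqF.
have /andP[l1 l2] : - I y - dl <= ln t / n%:R <= - I y + dl.
  by move: h1; rewrite ltr_norml => /andP[? ?]; apply/andP; split; lra.
rewrite -[t]lnK ?posrE // !ler_expR e; apply/andP; split.
  rewrite -mulrN ler_wpM2l ?(ltW n1) //; lra.
rewrite -mulrN ler_wpM2l ?(ltW n1) //; lra.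
Unshelve. all: by end_near. Qed.

(** The large deviation principle is a limit for each slope separately, whereas all times and
    heights are needed at once. A grid of slopes of mesh [g] reduces this to finitely many limits at
    a cost of [be * g <= dl / 2]. *)
Lemma uniform_upper (y1 v1 be dl : R) : v < y1 -> 0 <= v1 -> 0 <= be -> 0 < dl ->
  (forall y, y1 <= y <= 1 -> be * (y - v1) <= I y) ->
  exists2 C : R, 0 < C & forall t h : nat, y1 * t%:R <= h%:R ->
    tail t h <= C * expR (dl * t%:R - be * (h%:R - v1 * t%:R)).
Proof.
move=> vy1 v10 be0 dl0 hI.
have y10 : 0 < y1 by exact: le_lt_trans vy1.
pose g := dl / (2 * (be + 1)).
have be1 : 0 < 2 * (be + 1) by rewrite mulr_gt0 // ltr_wpDl.
have g0 : 0 < g by rewrite divr_gt0.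
have beg : be * g <= dl / 2.
  have -> : be * g = dl / 2 * (be / (be + 1)) by rewrite /g; field; rewrite gt_eqF // ltr_wpDl.
  by rewrite ler_piMr ?divr_ge0 ?(ltW dl0) // ler_pdivrMr ?ltr_wpDl // mul1r lerDl.
pose y i := y1 + i%:R * g.
have ev M : exists T, forall t i, (T <= t)%N -> (i < M)%N -> y i <= 1 ->
    tail t (ceiln (y i * t%:R)) <= expR (- (t%:R * (I (y i) - dl / 2))).
  elim: M => [|M [T hT]]; first by exists 0%N.
  have [yM|yM] := leP (y M) 1; last first.
    exists T => t i Tt; rewrite ltnS leq_eqVlt => /orP[/eqP ->|iM]; last exact: hT.
    by move=> /(lt_le_trans yM); rewrite ltxx.
  have vyM : v < y M <= 1.
    by rewrite yM andbT (lt_le_trans vy1) // lerDl mulr_ge0 // ltW.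
  have d20 : 0 < dl / 2 by rewrite divr_gt0.
  have [T' _ hT'] := ldp_bounds vyM d20.
  exists (maxn T T') => t i; rewrite geq_max => /andP[Tt T't].
  rewrite ltnS leq_eqVlt => /orP[/eqP -> _|iM]; last exact: hT.
  by have /andP[] := hT' t T't.
have [T hT] := ev (Num.truncn (1 / g)).+1.
(* [C] takes care of the times [t < T]: either [h > t] and the tail vanishes, or [h <= T] and the
   bound exceeds 1. *)
exists (expR (be * T%:R)); first exact: expR_gt0.
move=> t h yth.
have [th|ht] := ltnP t h; first by rewrite tail_eq0 // mulr_ge0 // expR_ge0.
have htR : h%:R <= t%:R :> R by rewrite ler_nat.
rewrite -expRD.
have t0 : 0 <= t%:R :> R by [].
have dt0 : 0 <= dl * t%:R by rewrite mulr_ge0 // ltW.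
have vt0 : 0 <= be * (v1 * t%:R) by rewrite !mulr_ge0.
have [tT|Tt] := ltnP t T.
  case/andP: (tail01 t h) => _ /le_trans; apply; rewrite -[leLHS]expR0 ler_expR.
  have : be * h%:R <= be * T%:R by rewrite ler_wpM2l // ler_nat (leq_trans ht) // ltnW.
  by lra.
have [t00|tpos] := posnP t.
  case/andP: (tail01 t h) => _ /le_trans; apply; rewrite -[leLHS]expR0 ler_expR.
  have -> : h = 0%N by apply/eqP; rewrite -leqn0 -t00.
  have : 0 <= be * T%:R by rewrite mulr_ge0.
  by lra.
have tp : 0 < t%:R :> R by rewrite ltr0n.
pose i := Num.truncn ((h%:R / t%:R - y1) / g).
have r0 : 0 <= (h%:R / t%:R - y1) / g.
  by rewrite divr_ge0 ?(ltW g0) // subr_ge0 ler_pdivlMr.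
have i1 : i%:R * g <= h%:R / t%:R - y1.
  by rewrite -ler_pdivlMr // truncn_le.
have i2 : h%:R / t%:R - y1 < (i%:R + 1) * g.
  by rewrite -ltr_pdivrMr // natr1 truncnS_gt.
have ht1 : h%:R / t%:R <= 1 :> R by rewrite ler_pdivrMr // mul1r.
have yi1 : y i <= h%:R / t%:R by rewrite /y; lra.
have iM : (i < (Num.truncn (1 / g)).+1)%N.
  rewrite ltnS; apply: le_truncn; rewrite ler_pM2r ?invr_gt0 //; lra.
apply: (@le_trans _ _ (tail t (ceiln (y i * t%:R)))).
  apply: tail_decr; rewrite ceiln_le.
    by rewrite -ler_pdivlMr.
  by rewrite mulr_ge0 // addr_ge0 ?(ltW y10) // mulr_ge0 // ltW.
apply: le_trans (hT t i Tt iM (le_trans yi1 ht1)) _; rewrite ler_expR.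
have Iy : be * (y i - v1) <= I (y i).
  by apply: hI; rewrite (le_trans yi1 ht1) andbT lerDl mulr_ge0 // ltW.
have {}Iy := ler_wpM2l t0 Iy.
have hy : h%:R <= (y i + g) * t%:R.
  by rewrite -ler_pdivrMr // /y; lra.
have {}hy := ler_wpM2l be0 hy.
have {}beg := ler_wpM2r t0 beg.
have bT : 0 <= be * T%:R by rewrite mulr_ge0.
by lra.
Qed.

Variables (a : R).
Hypothesis va : v < a <= 1.

Let a0 : 0 < a. Proof. by case/andP: va => h _; exact: le_lt_trans h. Qed.
Let a1 : a <= 1. Proof. by case/andP: va. Qed.
Let hk (k : nat) := ceiln (a * k%:R).

Let hk0 k : (0 < k)%N -> (0 < hk k)%N.
Proof.
move=> k0; rewrite ltnNge ceiln_le ?mulr_ge0 ?(ltW a0) // -ltNge.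
by rewrite mulr_gt0 // ltr0n.
Qed.

Let hit_lower dl : 0 < dl -> \forall k \near \oo,
  expR (- (k%:R * (I a + dl))) / (k%:R * (1 + lam)) <=
  stop (kdn lam 1) (kup lam 1) kap (hk k) k (fun=> 1) [::].
Proof.
move=> dl0; near=> k.
have k0 : (0 < k)%N by near: k; exact: nbhs_infty_gt.
have : expR (- (k%:R * (I a + dl))) <= tail k (hk k) <= expR (- (k%:R * (I a - dl))).
  by near: k; exact: ldp_bounds.
move=> /andP[lo _].
rewrite ler_pdivrMr ?mulr_gt0 ?ltr0n ?addr_gt0 // [leRHS]mulrC.
apply: (le_trans lo); apply: le_trans (walkn_le_hit lam0 kap0 k (z := [::]) (leq0n _)) _.
by have := killed_hit_ge lam0 kap0 k.-1 (hk0 k0); rewrite (prednK k0).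
Unshelve. all: by end_near. Qed.

(** Entering level [a * k] before time [(1 - eps) * k] requires a slope of at least [a / (1 - eps)],
    where the linear minorant of [I] gives a cost of at least [I a + 3 * dl], negligible against
    [I a + dl]. The other paths carry the weight of [(1 - eps) * k] steps, up to rounding. *)
Lemma block_mass_concentrated (mt v1 be dl eps gam : R) :
  1 <= mt -> 0 <= v1 -> 0 <= be -> 0 < dl -> 0 < eps < 1 ->
  (forall y, a / (1 - eps) <= y <= 1 -> be * (y - v1) <= I y) ->
  I a + 4 * dl <= be * (a - v1 * (1 - eps)) ->
  I a + 2 * dl + gam <= (1 - eps) * ln mt ->
  \forall k \near \oo, expR (gam * k%:R) <= block_mass lam mt (hk k) k kap.
Proof.
move=> mt1 v10 be0 dl0 /andP[eps0 eps1] hI hbe hmt.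
have e10 : 0 < 1 - eps by rewrite subr_gt0.
have vy1 : v < a / (1 - eps).
  case/andP: va => va' _; apply: (lt_le_trans va').
  rewrite ler_pdivlMr // ler_piMr ?(ltW a0) //; lra.
have mt0 : 0 < mt by exact: lt_le_trans mt1.
have x0 : 0 <= ln mt by exact: ln_ge0.
have [C C0 hC] := uniform_upper vy1 v10 be0 dl0 hI.
near=> k.
have kpos : (0 < k)%N by near: k; exact: nbhs_infty_gt.
have kR : 0 < k%:R :> R by rewrite ltr0n.
have lo : expR (- (k%:R * (I a + dl))) / (k%:R * (1 + lam)) <=
    stop (kdn lam 1) (kup lam 1) kap (hk k) k (fun=> 1) [::].
  by near: k; exact: hit_lower.
(* [expR (ln mt)] pays for the rounding in [s], [1 + lam] for the killing, and 2 for the subtraction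
   of [Hs]. *)
pose A := C + 2 * (1 + lam) * expR (ln mt).
have hA : A * k.+1%:R ^+ 2 <= expR (dl * k%:R).
  by near: k; exact: poly_le_exp.
pose s := Num.truncn ((1 - eps) * k%:R).
have ek0 : 0 <= (1 - eps) * k%:R by rewrite mulr_ge0 // ltW.
have s1 : s%:R <= (1 - eps) * k%:R by rewrite truncn_le.
have s2 : (1 - eps) * k%:R < s%:R + 1 by rewrite natr1 truncnS_gt.
have sk : (s <= k)%N.
  by rewrite -(ler_nat R); apply: (le_trans s1); rewrite ler_piMl // ?(ltW kR) //; lra.
apply: le_trans (block_mass_ge_killed lam0 kap0 (hk k) mt1 sk).
set Hs := stop _ _ _ _ s _ _; set Hk := stop _ _ _ _ k _ _ in lo *.
have ak : a * k%:R <= (hk k)%:R by rewrite ceiln_ge // mulr_ge0 // ltW.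
(* The hitting times before [s] contribute a negligible part. *)
have Hs_le : Hs <= k.+1%:R * (C * expR (- (k%:R * (I a + 3 * dl)))).
  apply: le_trans (hit_ge_killed lam0 kap0 _ _ _ _) _ => //.
  apply: le_trans (hit_le_sum lam0 kap0 _ _ _) _.
  apply: (@le_trans _ _ (\sum_(t < s.+1) C * expR (- (k%:R * (I a + 3 * dl))))); last first.
    rewrite sumr_const card_ord -[leLHS]mulr_natl ler_wpM2r ?mulr_ge0 ?expR_ge0 ?(ltW C0) //.
    by rewrite ler_nat ltnS.
  apply: ler_sum => t _; rewrite -/(tail t (hk k)).
  have ts : t%:R <= s%:R :> R by rewrite ler_nat -ltnS ltn_ord.
  have ts' : t%:R <= (1 - eps) * k%:R by exact: le_trans s1.
  apply: le_trans (hC t (hk k) _) _.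
    apply: le_trans ak; rewrite mulrAC ler_pdivrMr // -mulrA ler_wpM2l ?(ltW a0) //.
    by rewrite mulrC.
  rewrite ler_wpM2l ?(ltW C0) // ler_expR.
  have h1 := ler_wpM2l (ltW kR) hbe.
  have h2 : be * (v1 * t%:R) <= be * (v1 * ((1 - eps) * k%:R)) by rewrite !ler_wpM2l.
  have h3 := ler_wpM2l be0 ak.
  have h4 : dl * t%:R <= dl * k%:R.
    rewrite ler_wpM2l ?(ltW dl0) // (le_trans ts') // ler_piMl // ?(ltW kR) //; lra.
  lra.
set D := expR (- (k%:R * (I a + 2 * dl))).
have D0 : 0 < D by exact: expR_gt0.
have E0 : 0 < expR (dl * k%:R) by exact: expR_gt0.
have e1 : expR (- (k%:R * (I a + 3 * dl))) = D / expR (dl * k%:R).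
  by rewrite -expRN -expRD; congr expR; ring.
have e2 : expR (- (k%:R * (I a + dl))) = D * expR (dl * k%:R).
  by rewrite -expRD; congr expR; ring.
have l1 : 0 < 1 + lam by rewrite addr_gt0.
have xe : 0 < expR (ln mt) by exact: expR_gt0.
have k1 : 1 <= k.+1%:R :> R by rewrite ler1n.
have kk : k%:R <= k.+1%:R :> R by rewrite ler_nat.
have k2 : k.+1%:R <= k.+1%:R ^+ 2 :> R by rewrite expr2 ler_peMl.
have B0 : 0 < 2 * (1 + lam) * expR (ln mt) by rewrite !mulr_gt0.
have hC1 : C * k.+1%:R <= expR (dl * k%:R).
  apply: le_trans hA; apply: (@le_trans _ _ (A * k.+1%:R)).
    by rewrite ler_wpM2r // /A lerDl ltW.
  by rewrite ler_wpM2l // /A addr_ge0 ?ltW.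
have hB1 : 2 * (1 + lam) * expR (ln mt) * k%:R <= expR (dl * k%:R).
  apply: le_trans hA; apply: (@le_trans _ _ (A * k.+1%:R)).
    by rewrite ler_pM ?(ltW B0) // /A lerDr ltW.
  by rewrite ler_wpM2l // /A addr_ge0 ?ltW.
have Hs2 : Hs <= D.
  apply: le_trans Hs_le _; rewrite e1.
  rewrite (_ : _ * _ = C * k.+1%:R * D / expR (dl * k%:R)); last by ring.
  by rewrite ler_pdivrMr // [leRHS]mulrC ler_wpM2r // ltW.
have Hk2 : 2 * expR (ln mt) * D <= Hk.
  apply: le_trans lo; rewrite e2 ler_pdivlMr ?mulr_gt0 //.
  have := ler_wpM2l (ltW D0) hB1; congr (_ <= _); ring.
have xe1 : 1 <= expR (ln mt) by rewrite lnK.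
have HH : expR (ln mt) * D <= Hk - Hs.
  have : D <= expR (ln mt) * D by rewrite ler_peMl // ltW.
  by lra.
have hs : expR (ln mt) ^+ s = mt ^+ s by rewrite lnK.
rewrite -hs -expRM_natr; apply: (@le_trans _ _ (expR (ln mt * s%:R) * (expR (ln mt) * D))).
  rewrite /D -!expRD ler_expR.
  have h1 := ler_wpM2l (ltW kR) hmt.
  have h2 := ler_wpM2l x0 (ltW s2).
  lra.
by rewrite ler_wpM2l ?expR_ge0.
Unshelve. all: by end_near. Qed.

(** An early arrival is postponed by waiting at the root beforehand. Waiting [t] steps multiplies
    the mass by at least [q ^+ t] with [ln q = ln mt - eps], so almost no weight is wasted. *)
Lemma block_mass_waiting (mt dl eps gam : R) t :
  1 <= mt -> 0 < dl -> (0 < t)%N -> expR (- (eps * t%:R)) <= loop lam kap t ->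
  0 <= eps <= ln mt ->
  I a + 2 * dl + gam <= ln mt - eps ->
  \forall k \near \oo, expR (gam * k%:R) <= block_mass lam mt (hk k) k kap.
Proof.
move=> mt1 dl0 t0 hloop /andP[eps0 epsx] hmt.
have mt0 : 0 < mt by exact: lt_le_trans mt1.
pose x := ln mt - eps; have x0 : 0 <= x by rewrite subr_ge0.
pose q := expR x; have q1 : 1 <= q by rewrite -[leLHS]expR0 ler_expR.
have q0 : 0 <= q by exact: le_trans q1.
have qmt : q <= mt by rewrite -[leRHS]lnK ?posrE // ler_expR gerBl.
have qt : q ^+ t <= mt ^+ t * loop lam kap t.
  rewrite /q -expRM_natr /x mulrBl expRD expRM_natr lnK ?posrE // ler_wpM2l //.
  by rewrite exprn_ge0 // ltW.
pose H h k := stop (kdn lam 1) (kup lam 1) kap h k (fun=> 1) [::].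
have H0 h k : 0 <= H h k.
  by apply: stop_ge0 => // b j; [exact: kdn_ge0|exact: kup_ge0].
(* Paths that enter level [h] after time [j - t] carry enough weight by themselves; for the others
   the estimate at time [j - t] is used after a wait of [t] steps. Each round of the induction
   spends one more copy of the mass, whence the factor [j.+1]. *)
have main h j : (t < h)%N -> q ^+ (j - t) * H h j / j.+1%:R <= block_mass lam mt h j kap.
  move=> th; elim/ltn_ind: j => j IH.
  have Bs s : (s <= j)%N -> mt ^+ s * (H h j - H h s) <= block_mass lam mt h j kap.
    exact: block_mass_ge_killed.
  have j1 : 0 < j.+1%:R :> R by rewrite ltr0n.
  have Hmono s : (s <= j)%N -> H h s <= H h j.
    by move=> sj; apply: stop_le_t => // b i; [exact: kdn_ge0|exact: kup_ge0].
  rewrite ler_pdivrMr //.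
  have B00 : 0 <= block_mass lam mt h j kap.
    by apply: stop_ge0 => // b i; [apply: kdn_ge0|apply: kup_ge0] => //; exact: ltW.
  have [jt|tj] := ltnP j t.
    have -> : (j - t = 0)%N by apply/eqP; rewrite subn_eq0 ltnW.
    rewrite expr0 mul1r.
    have h00 : H h 0 = 0 by rewrite /H /= eq_sym gtn_eqF // (leq_ltn_trans _ th).
    have := Bs 0%N isT; rewrite expr0 mul1r h00 subr0 => /le_trans; apply.
    by rewrite ler_peMr // ler1n.
  have jtj : (j - t < j)%N by rewrite ltn_subrL t0 (leq_trans t0 tj).
  have b1 : q ^+ (j - t) * (H h j - H h (j - t)%N) <= block_mass lam mt h j kap.
    apply: le_trans (Bs (j - t)%N (leq_subr _ _)).
    rewrite ler_wpM2r ?subr_ge0 ?Hmono ?leq_subr //.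
    by rewrite lerXn2r ?nnegrE // ltW.
  have b2 : q ^+ (j - t) * H h (j - t)%N <= j%:R * block_mass lam mt h j kap.
    have IHj := IH _ jtj.
    have := block_mass_loop kap lam0 (j - t)%N mt1 th; rewrite subnKC // => bl.
    have jt1 : 0 < (j - t).+1%:R :> R by rewrite ltr0n.
    have bm0 : 0 <= block_mass lam mt h (j - t) kap.
      by apply: stop_ge0 => // b i; [apply: kdn_ge0|apply: kup_ge0] => //; exact: ltW.
    move: IHj; rewrite ler_pdivrMr // => IHj.
    have c1 : q ^+ t * (q ^+ (j - t - t) * H h (j - t)%N) <=
        (j - t).+1%:R * block_mass lam mt h j kap.
      apply: (@le_trans _ _ (q ^+ t * (block_mass lam mt h (j - t) kap * (j - t).+1%:R))).
        by rewrite ler_wpM2l // exprn_ge0.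
      rewrite mulrA mulrC ler_wpM2l //; apply: le_trans bl.
      by rewrite ler_wpM2r.
    apply: (@le_trans _ _ (q ^+ t * (q ^+ (j - t - t) * H h (j - t)%N))).
      rewrite mulrA -exprD ler_wpM2r // ler_weXn2l //.
      by rewrite -leq_subLR.
    apply: le_trans c1 _; rewrite ler_wpM2r // ler_nat ltn_subrL t0 //.
    exact: leq_trans t0 tj.
  have := lerD b1 b2; rewrite -mulrDr subrK -natr1 => /le_trans; apply.
  by apply: eq_imp_le; ring.
near=> k.
have k0 : (0 < k)%N by near: k; exact: nbhs_infty_gt.
have kR : 0 < k%:R :> R by rewrite ltr0n.
have th : (t < hk k)%N.
  rewrite ltnNge ceiln_le ?mulr_ge0 ?(ltW a0) // -ltNge -ltr_pdivrMl //.
  by near: k; exact: nbhs_infty_gtr.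
have tk : (t <= k)%N by near: k; exact: nbhs_infty_ge.
have lo : expR (- (k%:R * (I a + dl))) / (k%:R * (1 + lam)) <= H (hk k) k.
  by near: k; exact: hit_lower.
have l1 : 0 < 1 + lam by rewrite addr_gt0.
have hA : (1 + lam) * expR (x * t%:R) * k.+1%:R ^+ 2 <= expR (dl * k%:R).
  by near: k; exact: poly_le_exp.
apply: le_trans (main (hk k) k th).
have k1 : 0 < k.+1%:R :> R by rewrite ltr0n.
apply: (@le_trans _ _ (q ^+ (k - t) * (expR (- (k%:R * (I a + dl))) / (k%:R * (1 + lam))) / k.+1%:R)); last first.
  by rewrite ler_wpM2r ?invr_ge0 ?(ltW k1) // ler_wpM2l // exprn_ge0.
have hA' : (1 + lam) * expR (x * t%:R) * (k%:R * k.+1%:R) <= expR (dl * k%:R).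
  apply: le_trans hA; rewrite ler_wpM2l ?mulr_ge0 ?expR_ge0 ?(ltW l1) // expr2.
  by rewrite ler_wpM2r // ler_nat.
rewrite ler_pdivlMr // mulrA ler_pdivlMr ?mulr_gt0 //.
rewrite /q -expRM_natr natrB // -expRD.
have hx : x * k%:R - dl * k%:R - x * t%:R - k%:R * (I a + dl) >=
    gam * k%:R - x * t%:R.
  have := ler_wpM2l (ltW kR) hmt; rewrite -/x; lra.
apply: (@le_trans _ _ (expR (gam * k%:R - x * t%:R) * expR (dl * k%:R))); last first.
  by rewrite -expRD ler_expR; lra.
rewrite [X in _ <= X * _]expRD -[leLHS]mulrA -[leRHS]mulrA ler_wpM2l ?expR_ge0 //.
rewrite expRN ler_pdivlMl ?expR_gt0 //.
by apply: le_trans hA'; apply: eq_imp_le; ring.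
Unshelve. all: by end_near. Qed.

End large_deviations.

(** * A negative moment below one *)

Section moment_below_one.
Context {R : realType}.
Variables (lam mt gam : R) (hk : nat -> nat).
Hypotheses (lam0 : 0 < lam) (mt1 : 1 <= mt) (gam0 : 0 < gam).
Hypothesis hkk : forall k, (hk k <= k)%N.
Context {d : measure_display} {Om : measurableType d}.
Variables (P : probability Om R) (p : nat -> R) (K : seq nat -> Om -> nat).
Hypothesis Klaw : nat_rv_law P K p.
Hypothesis K0 : forall u w, (0 < K u w)%N.

Let X (w : Om) : Tree := K^~ w.
Let W k w := block_mass lam mt (hk k) k (X w).

Hypothesis W_large : {ae P, forall w, \forall k \near \oo, expR (gam * k%:R) <= W k w}.

(** Where [W k >= expR (gam * k)], the power [- 1 / k] gives at most [expR (- gam)]; elsewhere the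
    deterministic bound on the mass gives at most [1 + lam], whatever [k]. So it suffices that the
    exceptional probability tends to 0. *)
Lemma exists_moment_lt1 : exists k : nat, (0 < k)%N /\
  (\int[P]_w (npow k%:R^-1 (block_mass lam mt (hk k) k (K^~ w)))%:E <=
    ((1 + expR (- gam)) / 2)%:E)%E.
Proof.
have mX := measurable_random_tree Klaw.
have mW k : measurable_fun setT (W k).
  exact: (measurableT_comp (measurable_block_mass _ _ _ _) mX).
pose B k := [set w | (- expR (gam * k%:R) < - W k w)%R].
have mB k : measurable (B k).
  by apply: measurable_gt_set; exact: measurableT_comp.
have mi k : measurable_fun setT (\1_(B k) : Om -> R).
  by apply: measurable_indic; exact: mB.
have E1 : expR (- gam) < 1 by rewrite expR_lt1 oppr_lt0.
have l0 : 0 < 1 + lam by rewrite addr_gt0.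
(* Chosen so that [(1 + lam) * ep] is half the gap between [expR (- gam)] and 1. *)
pose ep := (1 - expR (- gam)) / 2 / (1 + lam).
have ep0 : 0 < ep by rewrite !divr_gt0 ?subr_gt0.
have PB0 : P (lim_sup_set B) = 0%E.
  have [N [mN N0 hN]] := W_large.
  apply/eqP; rewrite eq_le measure_ge0 andbT -N0; apply: le_measure; rewrite ?inE //.
    by apply: bigcapT_measurable => n; apply: bigcup_measurable.
  move=> w hw; apply: hN => /= -[n _ hn].
  have [j nj] := hw n I; rewrite /B /= ltrN2 ltNge => /negP; apply.
  exact: hn.
have cv : (P (\bigcup_(k >= n) B k) @[n --> \oo] --> 0%E).
  rewrite -PB0; apply: lim_sup_set_cvg => //.
  by rewrite (le_lt_trans (probability_le1 P _)) ?ltry //; apply: bigcup_measurable.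
have : \forall n \near \oo, (P (\bigcup_(k >= n) B k) < ep%:E)%E.
  move/fine_cvgP : cv => [fin_n /cvgrPdist_lt /(_ _ ep0) ev].
  near=> n; have fn : P (\bigcup_(k >= n) B k) \is a fin_num by near: n; exact: fin_n.
  rewrite -(fineK fn) lte_fin.
  have : `|0 - fine (P (\bigcup_(k >= n) B k))| < ep by near: n; exact: ev.
  by rewrite sub0r normrN ger0_norm ?fine_ge0.
case=> n _ hn; pose k := n.+1.
exists k; split => //.
have PBk : (P (B k) <= ep%:E)%E.
  apply: le_trans (ltW (hn k (leqnSn n))).
  apply: le_measure; rewrite ?inE //; first exact: bigcup_measurable.
  by move=> w Bw; exists k => /=.
have k0 : 0 < k%:R :> R by rewrite ltr0n.
have ki0 : 0 <= k%:R^-1 :> R by rewrite invr_ge0.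
apply: (@le_trans _ _ (\int[P]_w ((expR (- gam))%:E + ((1 + lam) * \1_(B k) w)%:E))%E).
  apply: ge0_le_integral => //.
  - by move=> w _; rewrite lee_fin npow_ge0.
  - by apply/measurable_EFinP; exact: (measurableT_comp (measurable_npow _) (mW k)).
  - apply: emeasurable_funD => //; apply/measurable_EFinP/measurable_funM => //.
  move=> w _; rewrite -EFinD lee_fin -/(W k w).
  have W0 : 0 < W k w by apply: block_mass_gt0 => // u; exact: K0.
  have [Wl|Wl] := leP (expR (gam * k%:R)) (W k w).
    apply: (@le_trans _ _ (expR (- gam))); last first.
      by rewrite lerDl mulr_ge0 // ltW.
    apply: le_trans (npow_le ki0 (expR_gt0 _) Wl) _.
    rewrite /npow expRK ler_expR lerN2 mulrCA mulVf ?mulr1 // gt_eqF //.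
  rewrite indicE mem_set /=; last by rewrite /B /= ltrN2.
  rewrite mulr1; apply: le_trans (_ : _ <= 1 + lam) _; last by rewrite lerDr expR_ge0.
  have lh : 0 < (1 + lam) ^- hk k by rewrite invr_gt0 exprn_gt0.
  have := block_mass_ge lam0 mt1 (hkk k) (kap := X w) (fun u => K0 u w).
  move=> /(npow_le ki0 lh)/le_trans; apply.
  rewrite /npow lnV ?posrE ?exprn_gt0 // mulrN opprK lnXn // -[leRHS]lnK ?posrE //.
  rewrite ler_expR -(mulr_natl (ln (1 + lam)) (hk k)) mulrA ler_piMl //.
    by rewrite ln_ge0 // lerDl ltW.
  by rewrite mulrC ler_pdivrMr // mul1r ler_nat.
have m1 : measurable_fun setT (fun w => ((1 + lam) * \1_(B k) w)%:E : \bar R).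
  by apply/measurable_EFinP/measurable_funM => //; exact: mi.
have g1 w : setT w -> (0 <= ((1 + lam) * \1_(B k) w)%:E)%E.
  by rewrite lee_fin mulr_ge0 // ltW.
have g2 (w : Om) : setT w -> (0 <= (expR (- gam))%:E)%E.
  by rewrite lee_fin expR_ge0.
rewrite (ge0_integralD _ measurableT g2 _ g1 m1) //.
rewrite integral_cst_prob.
rewrite [X in (_ + X)%E](_ : _ = (1 + lam)%:E * P (B k))%E; last first.
  under eq_integral do rewrite EFinM.
  rewrite -[X in P X]setIT -integral_indic //.
  apply: ge0_integralZl => //.
    by apply/measurable_EFinP; exact: mi.
  by rewrite lee_fin ltW.
apply: (@le_trans _ _ ((expR (- gam))%:E + (1 + lam)%:E * ep%:E)%E).
  by rewrite leeD2l // lee_wpmul2l // lee_fin ltW.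
rewrite -EFinM -EFinD lee_fin /ep; apply: eq_imp_le.
by field; rewrite gt_eqF.
Unshelve. all: by end_near. Qed.

End moment_below_one.

(** * Decay of loops at the root *)

Section loop_decay.
Context {R : realType}.
Variable lam : R.
Hypothesis lam0 : 0 < lam.

Definition loops_decay (eps : R) : set Tree :=
  [set kap | forall t, loop lam kap t <= expR (- (eps * t%:R))].

Lemma measurable_loop t : measurable_fun setT (fun kap : Tree => loop lam kap t).
Proof.
rewrite /loop; elim: t [::] => [|t IH] z; first exact: measurable_cst.
rewrite [X in measurable_fun _ X](_ : _ = fun kap : Tree => op (kdn lam 1) (kup lam 1) kap
  (fun y => iter t (killed lam 1 kap) (fun y => (nilp y)%:R) y) z) //.
exact: (measurable_op _ _ (F := fun y kap => iter t (killed lam 1 kap) (fun y => (nilp y)%:R) y)).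
Qed.

Lemma measurable_loops_decay eps : measurable (loops_decay eps).
Proof.
rewrite (_ : loops_decay eps = \bigcap_t [set kap | loop lam kap t <= expR (- (eps * t%:R))]); last first.
  by apply/seteqP; split => kap h t; [move=> _|]; exact: h.
apply: bigcapT_measurable => t.
rewrite (_ : [set _ | _] = (fun kap => loop lam kap t) @^-1` `]-oo, expR (- (eps * t%:R))]).
  by rewrite -[X in measurable X]setTI; exact: measurable_loop.
by apply/seteqP; split => kap /=; rewrite in_itv.
Qed.

Lemma iter_killed_ge0 kap t phi x : (forall y, 0 <= phi y) ->
  0 <= iter t (killed lam 1 kap) phi x.
Proof.
move=> p0; elim: t x => [|t IH] x //=.
by apply: op_ge0 => [b k|b k|y]; [exact: kdn_ge0|exact: kup_ge0|exact: IH].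
Qed.

Lemma iter_killed_le kap t phi psi x : (forall y, phi y <= psi y) ->
  iter t (killed lam 1 kap) phi x <= iter t (killed lam 1 kap) psi x.
Proof. by move=> h; elim: t x => [|t IH] x //=; exact: killed_le. Qed.

Lemma iter_killedZ kap t (c : R) phi x :
  iter t (killed lam 1 kap) (fun y => c * phi y) x = c * iter t (killed lam 1 kap) phi x.
Proof.
elim: t x => [|t IH] x //=; rewrite /killed -opZ; congr (op _ _ _ _ _).
by apply/funext => y; rewrite -IH.
Qed.

Let dlt (z y : seq nat) : R := (y == z)%:R.

Lemma loopE kap t : loop lam kap t = iter t (killed lam 1 kap) (dlt [::]) [::].
Proof. by rewrite /loop; congr (iter t _ _ [::]); apply/funext => -[]. Qed.

Lemma loop_mul kap s t : loop lam kap s * loop lam kap t <= loop lam kap (s + t).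
Proof.
rewrite !loopE iterD mulrC -iter_killedZ; apply: iter_killed_le => y.
rewrite [X in _ * X]/dlt; have [->|_] := eqVneq y [::]; first by rewrite mulr1.
by rewrite mulr0; apply: iter_killed_ge0 => u; rewrite /dlt ler0n.
Qed.

Lemma loop_ge0 kap t : 0 <= loop lam kap t.
Proof. by rewrite loopE; apply: iter_killed_ge0 => u; rewrite /dlt ler0n. Qed.

Lemma loop_exp kap t j : loop lam kap t ^+ j <= loop lam kap (j * t).
Proof.
elim: j => [|j IH]; first by rewrite mul0n expr0.
rewrite exprS mulSn; apply: le_trans (loop_mul _ _ _).
by rewrite ler_wpM2l // loop_ge0.
Qed.

Lemma killed_subtree_le kap z phi x : (forall y, 0 <= phi y) ->
  killed lam 1 (subtree kap z) (fun y => phi (y ++ z)) x <=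
  killed lam 1 kap phi (x ++ z).
Proof.
move=> p0; rewrite /killed /op /kdn /kup /subtree /=.
case: x => [|i x] //=; rewrite mul0r add0r lerDr.
by case: (nilp _); rewrite ?mul0r // mulr_ge0 // mulr_ge0 // divr_ge0 ?addr_ge0 // ltW.
Qed.

(** Step to child 0, loop inside its subtree, step back. *)
Lemma loop_subtree kap t : (forall x, 0 < kap x)%N ->
  (lam + (kap [::])%:R)^-1 * (lam / (lam + (kap [:: 0%N])%:R)) *
  loop lam (subtree kap [:: 0%N]) t <= loop lam kap t.+2.
Proof.
move=> k0; have lk x : 0 < lam + (kap x)%:R by rewrite ltr_wpDr.
set c0 := _^-1; set c1 := lam / _.
have c00 : 0 <= c0 by rewrite invr_ge0 ltW.
have c10 : 0 <= c1 by rewrite divr_ge0 ?ltW.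
have s1 y : c1 * dlt [:: 0%N] y <= killed lam 1 kap (dlt [::]) y.
  rewrite {1}/dlt; have [->|_] := eqVneq y _; last first.
    by rewrite mulr0; apply: (@iter_killed_ge0 _ 1) => u; rewrite /dlt ler0n.
  rewrite mulr1 /killed /op /= /dlt eqxx /= mulr1 mul1r lerDl.
  by rewrite mulr_ge0 ?divr_ge0 ?sumr_ge0 // ltW.
have s2 y j : iter j (killed lam 1 (subtree kap [:: 0%N])) (dlt [::]) y <=
    iter j (killed lam 1 kap) (dlt [:: 0%N]) (y ++ [:: 0%N]).
  elim: j y => [|j IH] y.
    by rewrite /= /dlt; case: y => [|i [|? ?]] //=; rewrite ler0n.
  rewrite !iterS; apply: le_trans (killed_subtree_le _ _ _ _); last first.
    by move=> u; apply: iter_killed_ge0 => u'; rewrite /dlt ler0n.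
  exact: killed_le.
apply: (@le_trans _ _ (c0 * iter t.+1 (killed lam 1 kap) (dlt [::]) [:: 0%N])).
  rewrite -mulrA ler_wpM2l // iterSr.
  apply: (@le_trans _ _ (c1 * iter t (killed lam 1 kap) (dlt [:: 0%N]) [:: 0%N])).
    by rewrite ler_wpM2l // loopE; exact: (s2 [::] t).
  by rewrite -iter_killedZ; exact: iter_killed_le.
have kr phi : killed lam 1 kap phi [::] = c0 * \sum_(i < kap [::]) phi [:: nat_of_ord i].
  by rewrite /killed /op /kdn /kup /= mul0r add0r mul1r.
rewrite loopE [in leRHS]iterS kr ler_wpM2l //.
have g0 y : 0 <= iter t.+1 (killed lam 1 kap) (dlt [::]) y.
  by apply: iter_killed_ge0 => u; rewrite /dlt ler0n.
move: (k0 [::]); case: (kap [::]) => // n _.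
by rewrite big_ord_recl lerDl sumr_ge0.
Qed.

(** Passing to the subtree loses a constant. Loops can be concatenated, so a violation at time [t]
    has its [j]-th power as a violation at time [j * t], which beats the constant for large [j]. *)
Lemma loops_decay_subtree eps kap : 0 <= eps -> (forall x, 0 < kap x)%N ->
  loops_decay eps kap -> loops_decay eps (subtree kap [:: 0%N]).
Proof.
move=> e0 k0 h t; rewrite leNgt; apply/negP => lt.
have lk x : 0 < lam + (kap x)%:R by rewrite ltr_wpDr.
set c := (lam + (kap [::])%:R)^-1 * (lam / (lam + (kap [:: 0%N])%:R)).
have c0 : 0 < c by rewrite mulr_gt0 ?invr_gt0 ?divr_gt0.
set x := loop lam _ t in lt; set y := expR _ in lt.
have y0 : 0 < y := expR_gt0 _.
have bd j : c * (x / y) ^+ j <= 1.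
  rewrite expr_div_n mulrA ler_pdivrMr ?exprn_gt0 // mul1r.
  apply: (@le_trans _ _ (c * loop lam (subtree kap [:: 0%N]) (j * t))).
    by rewrite ler_wpM2l ?(ltW c0) //; exact: loop_exp.
  apply: le_trans (loop_subtree _ k0) _; apply: le_trans (h _) _.
  rewrite /y -expRM_natl ler_expR.
  rewrite mulrN lerN2 mulrCA ler_wpM2l // -natrM ler_nat.
  by rewrite (leq_trans (leqnSn _)) // leqnSn.
have d0 : 0 < x / y - 1 by rewrite subr_gt0 ltr_pdivlMr // mul1r.
pose j := (Num.truncn (c^-1 / (x / y - 1))).+1.
have := bd j; apply/negP; rewrite -ltNge -ltr_pdivrMl // mulr1.
have bern : j%:R * (x / y - 1) <= (x / y) ^+ j.
  move: d0; set b := x / y => d0; move: j => j.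
  suff : 1 + j%:R * (b - 1) <= b ^+ j by apply: le_trans; rewrite lerDr.
  elim: j => [|j IH]; first by rewrite mul0r addr0 expr0.
  rewrite exprS -natr1; apply: le_trans (ler_wpM2l _ IH); last by move: d0; lra.
  have : 0 <= j%:R * (b - 1) ^+ 2 by rewrite mulr_ge0 ?sqr_ge0.
  by move: (j%:R) d0 => n; rewrite expr2; nra.
apply: lt_le_trans bern; rewrite -ltr_pdivrMr //; exact: truncnS_gt.
Qed.

End loop_decay.

Section zero_one.
Context {R : realType} {d : measure_display} {Om : measurableType d}.
Variables (P : probability Om R) (p : nat -> R) (K : seq nat -> Om -> nat).
Hypothesis Klaw : nat_rv_law P K p.
Hypothesis Kind : indep1 P K (fun _ => True).
Hypothesis K0 : forall u w, (0 < K u w)%N.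

Let X (w : Om) : Tree := K^~ w.

(* An event inherited by the subtrees along the leftmost ray differs by a null
   set from the same event for the subtree at level [h], hence is independent
   of the first [h] levels for every [h], so of itself. *)
Lemma hereditary_zero_one (G : set Tree) : measurable G ->
  (forall kap, (forall x, 0 < kap x)%N -> G kap -> G (subtree kap [:: 0%N])) ->
  P (X @^-1` G) = 0%E \/ P (X @^-1` G) = 1%E.
Proof.
move=> mG her; have mX := measurable_random_tree Klaw.
have mC : measurable (X @^-1` G) by rewrite -[X in measurable X]setTI; exact: mX.
set C := X @^-1` G in mC *.
have herh h w : C w -> G (subtree (X w) (nseq h 0%N)).
  rewrite /C /= => Gw; elim: h => [|h IH]; first by rewrite subtree_nil.
  rewrite -[nseq h.+1 _]/([:: 0%N] ++ nseq h 0%N) -subtree_cat; apply: her IH => x.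
  exact: K0.
pose G0 : set (set Om) := [set E | exists h B, measurable (B : set Tree) /\
  E = (fun w => mask h (X w) : Tree) @^-1` B].
have mmask h : measurable_fun setT (fun w => mask h (X w) : Tree).
  exact: (measurableT_comp (measurable_mask h) mX).
have G0m : G0 `<=` measurable.
  by move=> _ [h [B [mB ->]]]; rewrite -[X in measurable X]setTI; exact: mmask.
have maskK h1 h2 kap : (h1 <= h2)%N -> mask h1 (mask h2 kap) = mask h1 kap.
  move=> h12; apply/funext => u; rewrite /mask; case: ifP => // uh.
  by rewrite (leq_trans uh h12).
have G0I : setI_closed G0.
  move=> _ _ [h1 [B1 [mB1 ->]]] [h2 [B2 [mB2 ->]]].
  exists (maxn h1 h2), ((mask h1 : Tree -> Tree) @^-1` B1 `&` (mask h2 : Tree -> Tree) @^-1` B2); split.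
    apply: measurableI; rewrite -[X in measurable X]setTI; exact: measurable_mask.
  by apply/seteqP; split => w /=; rewrite !maskK ?leq_maxl ?leq_maxr.
have ind E : G0 E -> P (E `&` C) = (P E * P C)%E.
  move=> [h [B [mB EB]]]; have mE : measurable E by apply: G0m; exists h, B.
  pose z := nseq h 0%N; have sz : size z = h by rewrite size_nseq.
  pose D := (fun w => subtree (X w) z) @^-1` G.
  have mD : measurable D.
    rewrite -[X in measurable X]setTI.
    exact: (measurableT_comp (measurable_subtree z) mX).
  have CD : C `<=` D by move=> w; exact: herh.
  have PCD : P C = P D by rewrite /D (subtree_law Klaw Kind z mG).
  (* [C] is contained in [D] and has the same probability, since every subtree has the law of the
     whole tree. *)
  have PDC : P (D `\` C) = 0%E.
    rewrite measureD //; last by rewrite (le_lt_trans (probability_le1 P mD)) // ltry.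
    rewrite [X in (_ - X)%E](_ : _ = P D) ?subee ?fin_num_measure //.
    by rewrite setIC (setIidl CD).
  have -> : P (E `&` C) = P (E `&` D).
    apply/eqP; rewrite eq_le; apply/andP; split.
      by apply: le_measure; rewrite ?inE //; [exact: measurableI|exact: measurableI|exact: setIS].
    have -> : (P (E `&` C) = P (E `&` C) + P (D `\` C))%E by rewrite [P (D `\` C)]PDC adde0.
    apply: le_trans (measureU2 _ _ _); [|exact: measurableI|exact: measurableD].
    apply: le_measure; rewrite ?inE; [exact: measurableI| |].
      by apply: measurableU; [exact: measurableI|exact: measurableD].
    move=> w [Ew Dw]; have [Cw|Cw] := pselect (C w); first by left.
    by right.
  rewrite PCD EB; have := tree_indep Klaw Kind z mB mG.
  by rewrite sz.
have sC : <<s G0 >> C.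
  have : measurable_fun setT (X : g_sigma_algebraType G0 -> Tree).
    apply: measurable_to_tree => u k; apply: sub_sigma_algebra.
    exists (size u).+1, [set kap : Tree | kap u = k]; split.
      by apply: sub_sigma_algebra; exists u, k.
    by apply/seteqP; split => w /=; rewrite /mask ltnSn.
  by move=> /(_ measurableT _ mG); rewrite setTI.
have := (indep_sigma_half G0I G0m mC ind sC).2.
rewrite setIid -(fineK (fin_num_measure P _ mC)) -EFinM => -[e].
have /eqP : fine (P C) * (fine (P C) - 1) = 0 by rewrite mulrBr mulr1 -e subrr.
rewrite mulf_eq0 subr_eq0 => /orP[] /eqP ->; [by left|by right].
Qed.

(** Zero-one law for decay at rate [eps]: if no rate has probability 1, each has probability 0. A
    violation cannot occur at time 0, where both sides equal 1, so the slow time is positive. *)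
Lemma loops_dichotomy (lam : R) : 0 < lam ->
  (exists2 eps, 0 < eps & {ae P, forall w, loops_decay lam eps (X w)}) \/
  (forall eps, 0 < eps -> {ae P, forall w, exists2 t, (0 < t)%N & expR (- (eps * t%:R)) <= loop lam (X w) t}).
Proof.
move=> lam0; have mX := measurable_random_tree Klaw.
have mC eps : measurable (X @^-1` loops_decay lam eps).
  rewrite -[X in measurable X]setTI; apply: mX => //; exact: measurable_loops_decay.
have [[eps e0 ae1]|no] := pselect (exists2 eps, 0 < eps & P (X @^-1` loops_decay lam eps) = 1%E).
  left; exists eps => //; exists (~` (X @^-1` loops_decay lam eps)); split => //.
    exact: measurableC.
  by rewrite probability_setC // ae1 subee.
right => eps e0; have [P0|P1] := hereditary_zero_one (measurable_loops_decay lam eps)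
  (fun kap k0 h => loops_decay_subtree lam0 (ltW e0) k0 h); last first.
  by exfalso; apply: no; exists eps.
exists (X @^-1` loops_decay lam eps); split => // w /= h; apply: contrapT => nd.
apply: nd => -[|t]; first by rewrite mulr0 oppr0 expR0 loopE.
rewrite leNgt; apply/negP => lt; apply: h; exists t.+1 => //; exact: ltW.
Qed.

End zero_one.

(** * Return times by reversibility *)

Section reversibility.
Context {R : realType}.
Variables (lam : R) (kap : tree).
Hypotheses (lam0 : 0 < lam) (kap0 : forall x, (0 < kap x)%N).

Let lk x : 0 < lam + (kap x)%:R. Proof. by rewrite ltr_wpDr. Qed.

Fixpoint vert (z : seq nat) : bool :=
  if z is i :: z' then (i < kap z')%N && vert z' else true.

Fixpoint level (j : nat) : seq (seq nat) :=
  if j is j'.+1 then flatten [seq [seq i :: z | i <- iota 0 (kap z)] | z <- level j']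
  else [:: [::]].

Definition kids (phi : seq nat -> R) (z : seq nat) : R :=
  \sum_(i < kap z) phi (nat_of_ord i :: z).

Lemma mem_level z : vert z -> z \in level (size z).
Proof.
elim: z => [|i z IH] //= /andP[ik vz]; apply/flattenP.
exists [seq i :: z | i <- iota 0 (kap z)]; first by apply: map_f; exact: IH.
by apply/mapP; exists i; rewrite // mem_iota.
Qed.

Lemma vert_level j z : z \in level j -> vert z.
Proof.
elim: j z => [|j IH] z /=; first by rewrite inE => /eqP ->.
move=> /flattenP[_ /mapP[y yl ->] /mapP[i]]; rewrite mem_iota /= add0n => ik -> /=.
by rewrite ik IH.
Qed.

Lemma level_size j z : z \in level j -> size z = j.
Proof.
elim: j z => [|j IH] z /=; first by rewrite inE => /eqP ->.
by move=> /flattenP[_ /mapP[y yl ->] /mapP[i _ ->]] /=; rewrite (IH y).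
Qed.

Lemma level_sum j (phi : seq nat -> R) :
  \sum_(z <- level j) phi z = iter j kids phi [::].
Proof.
elim: j phi => [|j IH] phi; first by rewrite big_seq1.
rewrite iterSr -IH /= big_flatten big_map /=; apply: eq_bigr => z _.
by rewrite big_map /kids -[RHS](big_mkord xpredT (fun i => phi (i :: z))) /index_iota subn0.
Qed.

Let dlt (z y : seq nat) : R := (y == z)%:R.
Let Pt t phi x := iter t (killed lam 1 kap) phi x.

Definition neighbors (x : seq nat) : seq (seq nat) :=
  (if x is _ :: x' then [:: x'] else [::]) ++ [seq i :: x | i <- iota 0 (kap x)].

Let c (x u : seq nat) : R := (if (size u < size x)%N then lam else 1) / (lam + (kap x)%:R).

Let killed_nb phi x : killed lam 1 kap phi x = \sum_(u <- neighbors x) c x u * phi u.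
Proof.
rewrite /killed /op /kdn /kup /neighbors big_cat big_map /=; congr (_ + _).
  case: x => [|i x] /=; first by rewrite big_nil mul0r.
  by rewrite big_seq1 /c /= ltnSn mul1r.
rewrite mulr_sumr -[iota 0 _]/(iota 0 _) -(subn0 (kap x)) -/(index_iota 0 (kap x)) subn0 big_mkord.
by apply: eq_bigr => i _; rewrite /c /= ltnNge leqnSn.
Qed.

Lemma neighbors_uniq x : uniq (neighbors x).
Proof.
have ui : uniq [seq i :: x | i <- iota 0 (kap x)].
  by rewrite map_inj_uniq ?iota_uniq // => i j [].
case: x ui => [|i x] ui //; rewrite /neighbors cat_uniq ui andbT /=.
apply/hasPn => y /mapP[j _ ->]; rewrite inE; apply/negP => /eqP /(congr1 size) /= /eqP.
by rewrite -addn2 -{2}[size x]addn0 eqn_add2l.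
Qed.

(** Symmetry holds for vertices of the tree only: a word outside the tree has its parent as neighbor
    without being a neighbor of it. This is why the statements below are restricted to [vert]. *)
Let nb_sym x z : vert x -> vert z -> z \in neighbors x -> x \in neighbors z.
Proof.
move=> vx vz; rewrite /neighbors mem_cat => /orP[|].
  case: x vx => [|i x] //= /andP[ik vx]; rewrite inE => /eqP ->.
  by rewrite mem_cat; apply/orP; right; apply/mapP; exists i; rewrite // mem_iota.
by move=> /mapP[i _ ->]; rewrite /= inE eqxx.
Qed.

Let nb_vert x z : vert x -> z \in neighbors x -> vert z.
Proof.
move=> vx; rewrite /neighbors mem_cat => /orP[|].
  by case: x vx => [|i x] //= /andP[ik vx]; rewrite inE => /eqP ->.
by move=> /mapP[i]; rewrite mem_iota /= add0n => ik -> /=; rewrite ik.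
Qed.

Let big_dlt (s : seq (seq nat)) (f : seq nat -> R) x : uniq s ->
  \sum_(u <- s) f u * dlt u x = if x \in s then f x else 0.
Proof.
move=> us; case: ifPn => xs.
  rewrite (bigD1_seq x) //= /dlt eqxx mulr1 big1 ?addr0 // => u ux.
  by rewrite eq_sym (negPf ux) mulr0.
rewrite big_seq big1 // => u us'; rewrite /dlt; case: eqP => [e|_]; last by rewrite mulr0.
by rewrite e us' in xs.
Qed.

Let Pt_sum t (s : seq (seq nat)) (f : seq nat -> R) (g : seq nat -> seq nat -> R) x :
  Pt t (fun z => \sum_(u <- s) f u * g u z) x = \sum_(u <- s) f u * Pt t (g u) x.
Proof.
rewrite /Pt; elim: t x => [|t IH] x //=.
transitivity (killed lam 1 kap (fun y => \sum_(u <- s) f u * iter t (killed lam 1 kap) (g u) y) x).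
  by apply: op_ext.
rewrite killed_nb /=; under eq_bigr do rewrite mulr_sumr.
rewrite exchange_big /=; apply: eq_bigr => u _.
by rewrite killed_nb mulr_sumr; apply: eq_bigr => y _; rewrite mulrCA.
Qed.

Let Pt_vert_le t phi psi x : vert x -> (forall y, vert y -> phi y <= psi y) ->
  Pt t phi x <= Pt t psi x.
Proof.
rewrite /Pt => vx h; elim: t x vx => [|t IH] x vx /=; first exact: h.
rewrite !killed_nb !big_seq; apply: ler_sum => u ux; rewrite ler_wpM2l //.
  by rewrite /c divr_ge0 ?(ltW (lk _)) //; case: ifP => // _; exact: ltW.
by apply: IH; exact: nb_vert ux.
Qed.

Let Pt_vert_eq t phi psi x : vert x -> (forall y, vert y -> phi y = psi y) ->
  Pt t phi x = Pt t psi x.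
Proof.
by move=> vx h; apply/eqP; rewrite eq_le !Pt_vert_le // => y vy; rewrite h.
Qed.

(* The reversible measure of the walk (up to its value at the root). *)
Definition revm (x : seq nat) : R := lam ^- size x * (lam + (kap x)%:R).

Lemma revm_gt0 x : 0 < revm x.
Proof. by rewrite mulr_gt0 // invr_gt0 exprn_gt0. Qed.

Let rev1 x u : u \in neighbors x -> revm x * c x u = revm u * c u x.
Proof.
have e y b : revm y * (b / (lam + (kap y)%:R)) = lam ^- size y * b.
  by rewrite /revm -mulrA [_ * (b / _)]mulrCA divff ?mulr1 // gt_eqF.
rewrite /c !e /neighbors mem_cat => /orP[|].
  case: x => [|i x] //=; rewrite inE => /eqP ->; rewrite ltnSn ltnNge leqnSn /= mulr1.
  by rewrite exprSr invfM mulfVK // gt_eqF.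
move=> /mapP[i _ ->] /=; rewrite ltnSn ltnNge leqnSn /= mulr1.
by rewrite exprSr invfM mulfVK // gt_eqF.
Qed.

(** Detailed balance on each edge turns the first step of a path into the last step of the reversed
    path. *)
Lemma killed_reversible t x y : vert x -> vert y ->
  revm x * Pt t (dlt y) x = revm y * Pt t (dlt x) y.
Proof.
elim: t x y => [|t IH] x y vx vy.
  by rewrite /Pt /= /dlt eq_sym; case: eqP => [->|]; rewrite ?mulr0.
transitivity (revm y * Pt t (fun z => \sum_(u <- neighbors x) c u x * dlt u z) y).
  rewrite Pt_sum /Pt iterS killed_nb !mulr_sumr !big_seq; apply: eq_bigr => u ux.
  have := IH u y (nb_vert vx ux) vy; rewrite /Pt => IHu.
  rewrite mulrA rev1 // [RHS]mulrCA -IHu.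
  by rewrite [RHS]mulrCA mulrA.
congr (_ * _); rewrite /Pt iterSr; apply: Pt_vert_eq => // z vz.
rewrite big_dlt ?neighbors_uniq // killed_nb.
rewrite [RHS](_ : _ = \sum_(u <- neighbors z) c z u * dlt u x); last first.
  by apply: eq_bigr => u _; rewrite /dlt eq_sym.
rewrite big_dlt ?neighbors_uniq //; case: ifPn => h; first by rewrite nb_sym.
by case: ifPn => // h'; rewrite (nb_sym vz vx h') in h.
Qed.

Let Pt_ge0 t z x : 0 <= Pt t (dlt z) x.
Proof. by apply: iter_killed_ge0 => // y; rewrite /dlt ler0n. Qed.

(** Going to [z] in [t] steps and back in [t] steps makes a loop of length [2 * t]. By reversibility
    the two passages differ by the factor [r], so the square of one is at most [r] times the square
    of [E]; the square root of [r] is bounded by [1 + r]. *)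
Lemma killed_point_le eps t z : vert z -> loops_decay lam eps kap ->
  iter t (killed lam 1 kap) (fun y => (y == z)%:R) [::] <=
  (1 + revm z / revm [::]) * expR (- (eps * t%:R)).
Proof.
move=> vz dec; rewrite -/(dlt z) -/(Pt t (dlt z) [::]).
set x := Pt _ _ _; set r := _ / _; set E := expR _.
have r0 : 0 <= r by rewrite divr_ge0 // ltW // revm_gt0.
have E0 : 0 < E := expR_gt0 _.
have x0 : 0 <= x by exact: Pt_ge0.
have back : Pt t (dlt [::]) z = revm [::] / revm z * x.
  have := killed_reversible t (x := [::]) (y := z) isT vz; rewrite -/x => e.
  by rewrite mulrAC e mulrAC divff ?mul1r // gt_eqF // revm_gt0.
have l1 : Pt t (dlt [::]) z * x <= E ^+ 2.
  apply: (@le_trans _ _ (loop lam kap (t + t))); last first.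
    apply: le_trans (dec _) _; rewrite expr2 -expRD ler_expR natrD.
    by apply: eq_imp_le; ring.
  rewrite loopE iterD /x /Pt -iter_killedZ; apply: iter_killed_le => // y.
  rewrite [X in _ * X]/dlt; have [->|_] := eqVneq y z; first by rewrite mulr1.
  by rewrite mulr0; exact: Pt_ge0.
have l2 : x ^+ 2 <= r * E ^+ 2.
  rewrite -(ler_pM2l (_ : 0 < revm [::] / revm z)); last by rewrite divr_gt0 ?revm_gt0.
  have e1 : revm [::] / revm z * r = 1.
    by rewrite /r mulrA divfK ?divff // gt_eqF // revm_gt0.
  by rewrite [leRHS]mulrA e1 mul1r expr2 mulrA -back.
rewrite -ler_sqr ?nnegrE // ?mulr_ge0 ?addr_ge0 ?(ltW E0) //.
apply: le_trans l2 _; rewrite exprMn ler_wpM2r ?sqr_ge0 //.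
by move: r0; rewrite expr2; nra.
Qed.

(** A surviving walk is either at a vertex below level [h], each of them being unlikely and their
    number bounded by the growth of the generations, or at level [h] or above. *)
Lemma killed_survival_le eps t h (Cz b : R) : loops_decay lam eps kap ->
  0 <= Cz -> 1 <= b ->
  (forall j, iter j kids (fun=> 1) [::] <= Cz * b ^+ j) ->
  iter t (killed lam 1 kap) (fun=> 1) [::] <=
  h%:R * (Cz * (2 + b / lam) * (b * (1 + lam^-1)) ^+ h) * expR (- (eps * t%:R)) +
  walkn lam kap t (above h) [::].
Proof.
move=> dec Cz0 b1 Zb; have b0 : 0 <= b by exact: le_trans b1.
set B := b * (1 + lam^-1).
have li0 : 0 < lam^-1 by rewrite invr_gt0.
have B1 : 1 <= B by rewrite /B; move: li0 b1; nra.
have B0 : 0 <= B by exact: le_trans B1.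
pose s := flatten [seq level j | j <- iota 0 h].
set E := expR _; have E0 : 0 < E := expR_gt0 _.
have Pt1 : Pt t (fun=> 1) [::] <= \sum_(z <- s) Pt t (dlt z) [::] + Pt t (above h) [::].
  have -> : \sum_(z <- s) Pt t (dlt z) [::] = \sum_(z <- s) 1 * Pt t (dlt z) [::].
    by apply: eq_bigr => z _; rewrite mul1r.
  rewrite -Pt_sum.
  have PtD phi psi x : Pt t (fun y => phi y + psi y) x = Pt t phi x + Pt t psi x.
    rewrite /Pt; elim: {E E0}t x => [|t' IH] x //=.
    by rewrite /killed -opD; apply: op_ext.
  rewrite -PtD; apply: Pt_vert_le => // y vy.
  have a0 : 0 <= above h y by case/andP: (above01 (R := R) h y).
  have s0 : 0 <= \sum_(u <- s) 1 * dlt u y.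
    by apply: sumr_ge0 => u _; rewrite mul1r /dlt ler0n.
  have [yh|yh] := leqP h (size y).
    by rewrite /above yh lerDr.
  rewrite -[leLHS]addr0; apply: lerD => //.
  have ys : y \in s.
    apply/flattenP; exists (level (size y)); last exact: mem_level.
    by apply: map_f; rewrite mem_iota.
  rewrite (big_rem y) //= mul1r {1}/dlt eqxx lerDl.
  by apply: sumr_ge0 => u _; rewrite mul1r /dlt ler0n.
apply: le_trans Pt1 _; apply: lerD; last first.
  rewrite /Pt /walkn; elim: {E E0}t [::] => [|t' IH] x //=.
  have a0 y : 0 <= above h y :> R by case/andP: (above01 (R := R) h y).
  apply: (@le_trans _ _ (killed lam 1 kap (walkn lam kap t' (above h)) x)).
    exact: killed_le.
  have w0 y : 0 <= walkn lam kap t' (above h) y by exact: walkn_ge0.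
  rewrite /killed /walk /op /kdn /kup /wdn /wup; case: x => [|i x] /=; last by rewrite !mul1r.
  rewrite !mul0r !add0r mul1r ler_wpM2r ?sumr_ge0 //.
  by rewrite lef_pV2 ?posrE ?ltr0n // lerDr ltW.
rewrite /s big_flatten big_map -[iota 0 h]/(iota 0 h) -{1}(subn0 h) -/(index_iota 0 h) big_mkord.
rewrite -mulrA mulr_natl -[X in _ <= _ *+ X]card_ord -sumr_const; apply: ler_sum => j _.
pose l := lam^-1; have rl z : z \in level j ->
    1 + revm z / revm [::] <= 1 + l ^+ j + l ^+ j * l * (kap z)%:R.
  move=> /level_size sz; rewrite -addrA lerD2l /revm sz expr0 invr1 mul1r -exprVn -/l.
  rewrite -[leRHS](_ : l ^+ j * (1 + l * (kap z)%:R) = _); last by ring.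
  rewrite -[leLHS]mulrA ler_wpM2l ?exprn_ge0 ?(ltW li0) // ler_pdivrMr //.
  have k1 : 1 <= (kap [::])%:R :> R by rewrite ler1n.
  have ll : l * lam = 1 by rewrite mulVf // gt_eqF.
  have kz : 0 <= (kap z)%:R :> R by [].
  apply: (@le_trans _ _ ((1 + l * (kap z)%:R) * lam)).
    by rewrite mulrDl mul1r mulrAC ll mul1r.
  rewrite ler_wpM2l ?addr_ge0 ?mulr_ge0 ?(ltW li0) //.
  by rewrite lerDl (le_trans _ k1).
have S1 : \sum_(z <- level j) 1 <= Cz * b ^+ j by rewrite level_sum.
have S2 : \sum_(z <- level j) (kap z)%:R <= Cz * b ^+ j.+1.
  apply: le_trans (Zb _); rewrite iterSr -level_sum; apply: ler_sum => z _.
  by rewrite /kids sumr_const card_ord.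
apply: (@le_trans _ _ (\sum_(z <- level j) (1 + l ^+ j + l ^+ j * l * (kap z)%:R) * E)).
  rewrite !big_seq; apply: ler_sum => z zl.
  apply: le_trans (killed_point_le _ (vert_level zl) dec) _.
  by rewrite ler_wpM2r ?(ltW E0) // rl.
rewrite -mulr_suml ler_wpM2r ?(ltW E0) // big_split /= -mulr_sumr.
rewrite (_ : \sum_(i <- level j) (1 + l ^+ j) = (1 + l ^+ j) * \sum_(i <- level j) 1); last first.
  by rewrite mulr_sumr; apply: eq_bigr => i _; rewrite mulr1.
have lj : 0 <= l ^+ j by rewrite exprn_ge0 // ltW.
have lb1 : b ^+ j <= B ^+ h.
  apply: (@le_trans _ _ (B ^+ j)); last by rewrite ler_weXn2l // ltnW.
  by rewrite lerXn2r ?nnegrE ?B0 // /B ler_peMr // lerDl ltW.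
have lb2 : l ^+ j * b ^+ j <= B ^+ h.
  rewrite -exprMn; apply: (@le_trans _ _ (B ^+ j)); last by rewrite ler_weXn2l // ltnW.
  rewrite lerXn2r ?nnegrE ?B0 ?mulr_ge0 ?(ltW li0) // /B mulrC.
  by rewrite ler_wpM2l // lerDr.
apply: (@le_trans _ _ ((1 + l ^+ j) * (Cz * b ^+ j) + l ^+ j * l * (Cz * b ^+ j.+1))).
  by apply: lerD; rewrite ler_wpM2l // ?addr_ge0 ?mulr_ge0 ?(ltW li0).
rewrite exprS (_ : _ + _ = Cz * (b ^+ j + l ^+ j * b ^+ j + b * l * (l ^+ j * b ^+ j))); last by ring.
rewrite -[leRHS]mulrA ler_wpM2l // -/l.
have bl : 0 <= b * l by rewrite mulr_ge0 // ltW.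
have := ler_wpM2l bl lb2; move: lb1 lb2; lra.
Qed.

End reversibility.

(** * Growth of the generations of the random tree *)

Section generation_growth.
Context {R : realType}.
Context {d : measure_display} {Om : measurableType d}.
Variables (P : probability Om R) (p : nat -> R) (K : seq nat -> Om -> nat).
Hypothesis Klaw : nat_rv_law P K p.
Hypothesis Kind : indep1 P K (fun _ => True).
Hypothesis K0 : forall u w, (0 < K u w)%N.
Hypothesis p0 : forall k, 0 <= p k.
Variable mB : R.
Hypothesis hmB : (fun n => \sum_(k < n) (k%:R * p k)) @ \oo --> mB.

Let X (w : Om) : Tree := K^~ w.

Lemma offspring_mean u : (\int[P]_w (K u w)%:R%:E = mB%:E)%E.
Proof.
pose f (k : nat) (w : Om) : \bar R := (k%:R * \1_(K u @^-1` [set k]) w)%:E.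
have mf k : measurable_fun setT (f k).
  apply/measurable_EFinP/measurable_funM => //; apply: measurable_indic; exact: Klaw.1.
have f0 k w : (0 <= f k w)%E by rewrite lee_fin mulr_ge0.
have fE w : (K u w)%:R%:E = (\sum_(k <oo) f k w)%E.
  rewrite (nneseriesD1 (n := K u w)) // [X in (_ + X)%E]eseries0 ?adde0.
    by rewrite /f indicE mem_set // mulr1.
  move=> k _ kn; rewrite /f indicE memNset ?mulr0 //= => e.
  by rewrite e eqxx in kn.
under eq_integral do rewrite fE.
rewrite integral_nneseries //.
transitivity (\sum_(k <oo) (k%:R * p k)%:E)%E.
  apply: eq_eseriesr => k _; rewrite /f; under eq_integral do rewrite EFinM.
  have mk : measurable (K u @^-1` [set k]) by exact: Klaw.1.
  rewrite ge0_integralZl //; last by apply/measurable_EFinP/measurable_indic.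
  by rewrite integral_indic // setIT EFinM; congr (_ * _)%E; exact: Klaw.2.
apply: cvg_lim => //.
rewrite (_ : (fun n => _) = EFin \o (fun n => \sum_(k < n) (k%:R * p k))); last first.
  by apply/funext => n; rewrite /= sumEFin big_mkord.
by apply: cvg_EFin => //; exact: nearW.
Qed.

Lemma mean_ge1 : 1 <= mB.
Proof.
rewrite -lee_fin -(offspring_mean [::]) -[leLHS](integral_cst_prob P 1).
apply: ge0_le_integral => //.
- apply/measurable_EFinP.
  exact: (measurableT_comp (measurable_coord_fun (fun n => n%:R : R) [::])
    (measurable_random_tree Klaw)).
- by move=> w _; rewrite lee_fin ler1n.
Qed.

Lemma measurable_generation j z :
  measurable_fun setT (fun kap : Tree => iter j (kids kap) (fun=> 1) z : R).
Proof.
elim: j z => [|j IH] z; first exact: measurable_cst.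
exact: (measurable_childsum (F := fun i kap => iter j (kids kap) (fun=> 1) (i :: z))).
Qed.

Lemma generation_subtree kap j y z :
  iter j (kids kap) (fun=> 1 : R) (y ++ z) = iter j (kids (subtree kap z)) (fun=> 1) y.
Proof.
by elim: j y => [|j IH] y //=; rewrite /kids /subtree; apply: eq_bigr => i _; rewrite -IH.
Qed.

(** The first generation is a block of height 1 for the weights [dn = 0] and [up = 1], so
    [stop_integral] gives the recursion. *)
Lemma generation_mean j : (\int[P]_w (iter j (kids (X w)) (fun=> 1) [::])%:E = (mB ^+ j)%:E)%E.
Proof.
pose F j (kap : Tree) : R := iter j (kids kap) (fun=> 1) [::].
have F0 i kap : 0 <= F i kap.
  by rewrite /F; elim: i [::] => [|i IH] z //=; apply: sumr_ge0.
have st kap (phi : seq nat -> R) :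
    stop (fun _ _ => 0) (fun _ _ => 1) kap 1 1 phi [::] = \sum_(i < kap [::]) phi [:: nat_of_ord i].
  by rewrite /stop /op /= mul0r add0r mul1r.
elim: j => [|j IH]; first by rewrite expr0 /= integral_cst_prob.
under eq_integral => w _.
  rewrite (_ : iter _ _ _ _ = 1 * stop (fun _ _ => 0) (fun _ _ => 1) (X w) 1 1
    (fun y => F j (subtree (X w) y)) [::]); last first.
    rewrite mul1r st /= /kids; apply: eq_bigr => i _.
    exact: (generation_subtree (X w) j [::] [:: nat_of_ord i]).
  over.
have H := @stop_integral _ _ _ P p K Klaw Kind (fun _ _ => 0) (fun _ _ => 1) (fun _ _ => lexx 0)
  (fun _ _ => ler01) (F j) (mB ^+ j) 1 1 (fun=> 1) [::] (measurable_generation j [::]) (F0 j) IH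
  (measurable_cst _) (fun=> ler01).
rewrite H //.
under eq_integral do rewrite mul1r st sumr_const card_ord.
by rewrite offspring_mean -EFinM exprSr.
Qed.

(** The series with weights [2 ^- j.+1] has expectation at most 1, hence is almost surely finite and
    bounds each of its terms. *)
Lemma ae_bounded_of_mean (f : nat -> Om -> R) :
  (forall j, measurable_fun setT (f j)) -> (forall j w, 0 <= f j w) ->
  (forall j, (\int[P]_w (f j w)%:E <= 1)%E) ->
  {ae P, forall w, exists2 C : R, 0 <= C & forall j, f j w <= C * 2 ^+ j}.
Proof.
move=> mf f0 f1; pose g j w := (2 ^- j.+1 * f j w)%:E : \bar R.
have mg j : measurable_fun setT (g j) by apply/measurable_EFinP/measurable_funM.
have g0 j w : (0 <= g j w)%E by rewrite lee_fin mulr_ge0 ?invr_ge0.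
have ig : (\int[P]_w (\sum_(j <oo) g j w) <= 1)%E.
  rewrite integral_nneseries //.
  apply: le_trans (epsilon_trick0 (eps := 1) xpredT ler01).
  apply: lee_nneseries => [j _ _|j _]; first exact: integral_ge0.
  rewrite /g; under eq_integral do rewrite EFinM.
  have k0 : (0 <= (2 ^- j.+1 : R)%:E)%E by rewrite lee_fin invr_ge0.
  have fj0 w : setT w -> (0 <= (f j w)%:E)%E by rewrite lee_fin.
  have mfj : measurable_fun setT (fun w => (f j w)%:E) by exact/measurable_EFinP.
  rewrite (ge0_integralZl _ measurableT mfj fj0 k0).
  by rewrite natrX mul1r -[leRHS]mule1 lee_wpmul2l.
have ms : measurable_fun setT (fun w => \sum_(j <oo) g j w)%E.
  exact: ge0_emeasurable_sum.
have s0 w : (0 <= \sum_(j <oo) g j w)%E by exact: nneseries_ge0.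
have int : P.-integrable setT (fun w => \sum_(j <oo) g j w)%E.
  apply/integrableP; split => //.
  under eq_integral do rewrite gee0_abs //.
  by rewrite (le_lt_trans ig) // ltry.
have := integrable_ae measurableT int; apply: filterS => w /(_ I) fin.
exists (2 * fine (\sum_(j <oo) g j w)%E); first by rewrite mulr_ge0 // fine_ge0.
move=> j; have : (g j w <= \sum_(j <oo) g j w)%E.
  by rewrite (nneseriesD1 (n := j)) // leeDl // nneseries_ge0.
rewrite -[leRHS]fineK // lee_fin ler_pdivrMl ?exprn_gt0 // exprS.
by move=> h; apply: le_trans h _; apply: eq_imp_le; ring.
Qed.

Lemma generation_growth : {ae P, forall w, exists2 C : R, 0 <= C &
  forall j, iter j (kids (X w)) (fun=> 1) [::] <= C * (2 * mB) ^+ j}.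
Proof.
have mB1 := mean_ge1; have mB0 : 0 < mB by exact: lt_le_trans mB1.
have mX := measurable_random_tree Klaw.
have Z0 j w : 0 <= iter j (kids (X w)) (fun=> 1 : R) [::].
  by elim: j [::] => [|i IH] z //=; apply: sumr_ge0.
have mZ j : measurable_fun setT (fun w => iter j (kids (X w)) (fun=> 1 : R) [::]).
  exact: (measurableT_comp (measurable_generation j [::]) mX).
have := @ae_bounded_of_mean (fun j w => mB ^- j * iter j (kids (X w)) (fun=> 1) [::]).
have H j : (\int[P]_w (mB ^- j * iter j (kids (X w)) (fun=> 1) [::])%:E <= 1)%E.
  under eq_integral do rewrite EFinM.
  have k0 : (0 <= (mB ^- j : R)%:E)%E by rewrite lee_fin invr_ge0 exprn_ge0 // ltW.
  have Zj0 w : setT w -> (0 <= (iter j (kids (X w)) (fun=> 1 : R) [::])%:E)%E.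
    by rewrite lee_fin.
  have mZj : measurable_fun setT (fun w => (iter j (kids (X w)) (fun=> 1 : R) [::])%:E).
    exact/measurable_EFinP.
  rewrite (ge0_integralZl _ measurableT mZj Zj0 k0).
  by rewrite generation_mean -EFinM mulVf // gt_eqF ?exprn_gt0.
move=> /(_ _ _ H); move=> /(_ (fun j => measurable_funM (measurable_cst _) (mZ j))).
have g0 j w : 0 <= mB ^- j * iter j (kids (X w)) (fun=> 1 : R) [::].
  by rewrite mulr_ge0 // invr_ge0 exprn_ge0 // ltW.
move=> /(_ g0); apply: filterS => w [C C0 hC]; exists C => // j.
have := hC j; rewrite ler_pdivrMl ?exprn_gt0 // exprMn => h.
by apply: le_trans h _; apply: eq_imp_le; ring.
Qed.

End generation_growth.

(** * Growth at the root *)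

Section root_recursion.
Context {R : realType}.
Variables (mu : nat -> R) (lam : R) (kap : tree).
Hypotheses (hmu : prob_nat mu) (mu0 : mu 0%N = 0) (mu1 : mu 1%N < 1).
Hypotheses (lam0 : 0 < lam) (kap0 : forall x, (0 < kap x)%N).

Fixpoint hit_root (r : nat) (x : seq nat) : R :=
  if nilp x then 1 else if r is r'.+1 then walk lam kap (hit_root r') x else 0.

(** Probability that the first return to the root takes more than [r + 1] steps. *)
Definition return_tail (r : nat) : R := 1 - walk lam kap (hit_root r) [::].

(** A constraint on generation [n] alone, through which the event that some particle is high at time
    [n] becomes an instance of [surv]. *)
Definition final (n : nat) (H : R) (i : nat) (z : seq nat) : bool :=
  (i == n) ==> (H <= (size z)%:R).

Definition reach (H : R) (n : nat) : seq nat -> R := surv mu lam kap n (final n H).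

Lemma hit_root01 r x : 0 <= hit_root r x <= 1.
Proof.
elim: r x => [|r IH] x /=; case: ifP => _; rewrite ?ler01 ?lexx //.
rewrite walk_ge0 ?walk_le_cst // => y; by case/andP: (IH y).
Qed.

Lemma hit_root_compl_le r x : 1 - hit_root r x <= iter r (killed lam 1 kap) (fun=> 1) x.
Proof.
elim: r x => [|r IH] x.
  by rewrite gerBl /=; case: ifP.
case: x => [|i x].
  by rewrite /= subrr; apply: (@iter_killed_ge0 _ _ lam0 _ r.+1).
rewrite [hit_root _ _]/= -(walk_compl lam0 _ (kap0 _)) iterS.
apply: (@le_trans _ _ (killed lam 1 kap (fun y => 1 - hit_root r y) (i :: x))).
  by rewrite /walk /killed /op /wdn /wup /kdn /kup /= !mul1r.
exact: killed_le.
Qed.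

Lemma return_tail01 r : 0 <= return_tail r <= 1.
Proof.
have : 0 <= walk lam kap (hit_root r) [::] <= 1.
  by rewrite walk_ge0 ?walk_le_cst // => y; case/andP: (hit_root01 r y).
by rewrite /return_tail; lra.
Qed.

Lemma return_tail_le r :
  return_tail r <= (1 + lam) * iter r.+1 (killed lam 1 kap) (fun=> 1) [::].
Proof.
rewrite /return_tail -(walk_compl lam0 _ (kap0 _)) iterS.
set f := iter r _ _; have f0 y : 0 <= f y by exact: iter_killed_ge0.
apply: (@le_trans _ _ (walk lam kap f [::])).
  by apply: walk_le => // y; exact: hit_root_compl_le.
rewrite /walk /killed /op /wdn /wup /kdn /kup /= !mul0r !add0r mul1r mulrA.
rewrite ler_wpM2r ?sumr_ge0 //.
have k1 : 1 <= (kap [::])%:R :> R by rewrite ler1n.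
have k0 : 0 < (kap [::])%:R :> R by rewrite ltr0n.
rewrite ler_pdivlMr ?addr_gt0 // mulrC ler_pdivrMr //.
have : 0 <= lam * ((kap [::])%:R - 1) by rewrite mulr_ge0 ?(ltW lam0) ?subr_ge0.
by lra.
Qed.

Lemma finalS n H : (fun i => final n.+1 H i.+1) = final n H.
Proof. by apply/funext => i; apply/funext => z; rewrite /final eqSS. Qed.

Lemma reach_ge H n x m' tau b : tau <= 1 ->
  (forall t, 0 <= t <= tau -> m' * t <= 1 - pgf mu (1 - t)) ->
  0 <= b <= tau -> b <= walk lam kap (reach H n) x ->
  m' * b <= reach H n.+1 x.
Proof.
by move=> t1 lin b0 bw; apply: (surv_ge hmu lam0 kap0 _ t1 lin).
Qed.

Lemma reach01 H n x : 0 <= reach H n x <= 1.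
Proof. exact: surv01. Qed.

Lemma reach_le H H' n x : H <= H' -> reach H' n x <= reach H n x.
Proof.
move=> HH; rewrite /reach /surv lerD2l lerN2; apply: fail_mono => // i y.
by rewrite /final; case: (i == n) => //=; exact: le_trans.
Qed.

(* Decompose the path from [x] at its first visit to the root. *)
Lemma reach_via_root H m' tau (B : nat -> R) r n x : tau <= 1 ->
  (forall t, 0 <= t <= tau -> m' * t <= 1 - pgf mu (1 - t)) ->
  (forall j, 0 <= B j <= tau) -> (forall j, B j.+1 <= m' * B j) ->
  (r <= n)%N -> (forall j, (n - r <= j <= n)%N -> B j <= reach H j [::]) ->
  B n * hit_root r x <= reach H n x.
Proof.
move=> t1 lin B0 BS; elim: r n x => [|r IH] n x rn Bj.
  case: x => [|i x] /=; first by rewrite mulr1 Bj // subn0 leqnn.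
  by rewrite mulr0; case/andP: (reach01 H n (i :: x)).
case: x => [|i x]; first by rewrite /= mulr1 Bj // leqnn leq_subr.
case: n rn Bj => // n rn Bj.
set x' := i :: x; have /andP[h0 h1] := hit_root01 r.+1 x'; have /andP[b0 bt] := B0 n.
apply: (@le_trans _ _ (m' * (B n * hit_root r.+1 x'))).
  by rewrite mulrA ler_wpM2r.
apply: (reach_ge t1 lin).
  rewrite mulr_ge0 //=; apply: le_trans bt; exact: ler_piMr.
rewrite [hit_root _ _]/= /walk -opZ; apply: walk_le => // y; apply: IH => // j jn.
apply: Bj; move: jn => /andP[j1 j2]; rewrite subSS j1 (leq_trans j2) //.
Qed.

Lemma reach_root_step H m' tau (B : nat -> R) r n : tau <= 1 ->
  (forall t, 0 <= t <= tau -> m' * t <= 1 - pgf mu (1 - t)) ->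
  (forall j, 0 <= B j <= tau) -> (forall j, B j.+1 <= m' * B j) ->
  (r <= n)%N -> (forall j, (n - r <= j <= n)%N -> B j <= reach H j [::]) ->
  B n * (1 - return_tail r) <= walk lam kap (reach H n) [::].
Proof.
move=> t1 lin B0 BS rn Bj; rewrite /return_tail subKr /walk -opZ.
by apply: walk_le => // y; exact: (reach_via_root y t1 lin).
Qed.

Lemma reach_growth H m' tau nu U N r : 0 < tau <= 1 ->
  (forall t, 0 <= t <= tau -> m' * t <= 1 - pgf mu (1 - t)) ->
  expR nu <= m' * (1 - return_tail r) -> 0 <= nu -> 0 < U ->
  (forall j, (N <= j <= N + r)%N -> U <= reach H j [::]) ->
  forall n, (N <= n)%N ->
    Num.min tau (U * expR (nu * (n%:R - (N + r)%:R))) <= reach H n [::].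
Proof.
move=> /andP[t0 t1] lin th nu0 U0 base.
pose B (j : nat) := Num.min tau (U * expR (nu * (j%:R - (N + r)%:R))).
have B0 j : 0 <= B j <= tau.
  by rewrite ge_min lexx andbT le_min (ltW t0) mulr_ge0 ?expR_ge0 // ltW.
have enu : 1 <= expR nu by rewrite -expR0 ler_expR.
have m'e : expR nu <= m'.
  apply: (le_trans th); have /andP[q0 q1] := return_tail01 r.
  rewrite ler_piMr ?gerBl //.
  have : 0 < m' * (1 - return_tail r) by apply: lt_le_trans th; exact: expR_gt0.
  have [//|n0] := leP 0 m'; move: q0 q1 n0; nra.
have BSe j : B j.+1 <= expR nu * B j.
  rewrite /B minr_pMr ?expR_ge0 // le_min !ge_min; apply/andP; split.
    by rewrite ler_peMl // ltW.
  apply/orP; right; rewrite mulrCA -expRD ler_wpM2l ?(ltW U0) // ler_expR -natr1.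
  by apply: eq_imp_le; ring.
have BS j : B j.+1 <= m' * B j.
  by apply: le_trans (BSe j) _; rewrite ler_wpM2r //; case/andP: (B0 j).
move=> n; elim/ltn_ind: n => n IH Nn.
have [nr|nr] := leqP n (N + r).
  apply: (@le_trans _ _ U); last by apply: base; rewrite Nn.
  rewrite ge_min; apply/orP; right; rewrite ler_piMr ?(ltW U0) // -[leRHS]expR0 ler_expR.
  by rewrite mulr_ge0_le0 // subr_le0 ler_nat.
case: n nr IH Nn => // n nr IH Nn.
have rn : (r <= n)%N by rewrite -ltnS (leq_trans _ nr) // ltnS leq_addl.
have win j : (n - r <= j <= n)%N -> B j <= reach H j [::].
  move=> /andP[j1 j2]; apply: IH => //; apply: leq_trans j1.
  by rewrite leq_subRL // addnC -ltnS.
have step := reach_root_step t1 lin B0 BS rn win.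
have /andP[q0 q1] := return_tail01 r; have /andP[b0 bt] := B0 n.
apply: le_trans (reach_ge t1 lin _ step); last first.
  rewrite mulr_ge0 ?subr_ge0 //=; apply: le_trans bt.
  by rewrite ler_piMr // gerBl.
apply: le_trans (BSe n) _; rewrite [leLHS]mulrC [leRHS]mulrCA.
by rewrite ler_wpM2l.
Qed.

Lemma reachS H n x :
  reach H n.+1 x = 1 - pgf mu (1 - walk lam kap (reach H n) x).
Proof.
rewrite /reach /surv [fail _ _ _ n.+1 _ _]/= -/(final n.+1 H) finalS.
congr (1 - pgf _ _); rewrite -(walk_compl lam0 _ (kap0 _)); apply: op_ext => y.
by rewrite subKr.
Qed.

(* A visit to the root every [r] steps gives each time a chance [tau / m] of
   branching into a successful lineage. *)
Lemma root_fail_decay (H m tau : R) r n1 :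
  (fun n => \sum_(k < n) k%:R * mu k) @ \oo --> m -> 1 < m -> 0 < tau <= 1 ->
  (forall j, (n1 <= j)%N -> tau <= reach H j [::]) ->
  forall i n, (n1 + i * r.+1 <= n)%N ->
    1 - reach H n [::] <= (1 - (1 - mu 1%N) * tau / m) ^+ i +
      return_tail r / ((1 - mu 1%N) * tau / m).
Proof.
move=> hm m1 /andP[t0 t1] base.
have m0 : 0 < m by exact: lt_trans m1.
have M0 : 0 <= mu 1%N := hmu.1 1%N.
set c := (1 - mu 1%N) * tau / m; set q := return_tail r.
have /andP[q0 q1] : 0 <= q <= 1 by exact: return_tail01.
have c0 : 0 < c by rewrite !mulr_gt0 ?subr_gt0 ?invr_gt0.
have c1 : c <= 1.
  rewrite /c ler_pdivrMr // mul1r; apply: le_trans (ltW m1).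
  by apply: mulr_ile1; rewrite ?(ltW t0) ?subr_ge0 ?(ltW mu1) // gerBl.
elim=> [|i IH] n ni.
  rewrite expr0; apply: (@le_trans _ _ 1).
    by rewrite gerBl; case/andP: (reach01 H n [::]).
  by rewrite lerDl divr_ge0 // ltW.
have n0 : (0 < n)%N by rewrite (leq_trans _ ni) // mulSn addnA addn_gt0 addnS.
case: n n0 ni => // n _ ni.
set s := (1 - c) ^+ i + q / c in IH *.
have s0 : 0 <= s by rewrite addr_ge0 ?exprn_ge0 ?subr_ge0 // divr_ge0 // ltW.
pose B := Num.max 0 (1 - s).
have B01 : 0 <= B <= 1 by rewrite le_max lexx ge_max ler01 gerBl.
have rn : (n1 + i * r.+1 + r <= n)%N by rewrite -ltnS -addnS -addnA [(_ * _ + _)%N]addnC -mulSn.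
have y1 : B * (1 - q) <= walk lam kap (reach H n) [::].
  apply: (@reach_root_step H 1 1 (fun=> B)) => //.
  - by move=> t t01; rewrite mul1r; have := @pgf_le_id _ _ hmu (1 - t) mu0; move: t01; lra.
  - by move=> _; rewrite mul1r.
  - by rewrite (leq_trans _ rn) // leq_addl.
  move=> j /andP[j1 _]; rewrite ge_max; apply/andP; split.
    by case/andP: (reach01 H j [::]).
  by rewrite lerBlDl -lerBlDr; apply: IH; apply: leq_trans j1; rewrite leq_subRL ?(leq_trans _ rn) ?leq_addl // addnC.
set W := walk _ _ _ _ in y1.
have W01 : 0 <= W <= 1.
  by rewrite /W walk_ge0 ?walk_le_cst // => y; case/andP: (reach01 H n y).
have rE : reach H n.+1 [::] = 1 - pgf mu (1 - W) by rewrite reachS.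
(* A generation multiplies by at most [m], and [reach] is at least [tau] after the branching, so it
   is at least [tau / m] before. *)
have W1 : tau / m <= W.
  rewrite ler_pdivrMr // mulrC; apply: le_trans (base n.+1 _) _.
    by rewrite (leq_trans _ ni) // leq_addr.
  by rewrite rE; exact: pgf_compl_le.
rewrite rE subKr.
have W01' : 0 <= 1 - W <= 1 by move: W01; lra.
apply: le_trans (pgf_le_quadratic hmu mu0 W01') _.
apply: (@le_trans _ _ ((1 - c) * (1 - W))).
  rewrite (_ : mu 1%N * _ + _ = (1 - (1 - mu 1%N) * W) * (1 - W)); last by ring.
  rewrite ler_wpM2r //; first by case/andP: W01'.
  by rewrite lerD2l lerN2 /c -mulrA ler_wpM2l // subr_ge0 ltW.
apply: (@le_trans _ _ ((1 - c) * (s + q))).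
  rewrite ler_wpM2l ?subr_ge0 //; move: y1; rewrite /B; have [s1|s1] := leP (1 - s) 0.
    by move=> _; move: W01 q0 s1; lra.
  by move: q0 s0; nra.
rewrite mulrDr /s mulrDr -exprS -addrA lerD2l.
have -> : (1 - c) * (q / c) = q / c - q by field; rewrite gt_eqF.
have : 0 <= c * q by rewrite mulr_ge0 // ltW.
by lra.
Qed.

End root_recursion.

Section return_time.
Context {R : realType}.
Variables (lam : R) (kap : tree) (I : R -> R).
Hypotheses (lam0 : 0 < lam) (kap0 : forall x, (0 < kap x)%N).
Hypotheses (Ipos : forall y, 0 < y <= 1 -> 0 < I y).
Hypothesis ldp : forall y : R, 0 < y <= 1 ->
  (fun n => ln (tail lam kap n (ceiln (y * n%:R))) / n%:R) @ \oo --> - I y.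
Variables (eps Cz b : R).
Hypotheses (eps0 : 0 < eps) (dec : loops_decay lam eps kap) (Cz0 : 0 <= Cz) (b1 : 1 <= b).
Hypothesis Zb : forall j, iter j (kids kap) (fun=> 1) [::] <= Cz * b ^+ j.

(** Below level [de * t] the number of vertices costs a rate of about [eps / 4] against the decay
    rate [eps]; being above that level has probability of order [expR (- I de * t)], and [I de > 0]
    since the speed is 0. *)
Lemma return_tail_exp : exists2 g : R, 0 < g &
  \forall r \near \oo, return_tail lam kap r <= expR (- (g * r%:R)).
Proof.
have b0 : 0 <= b by exact: le_trans b1.
set B := b * (1 + lam^-1).
have li0 : 0 < lam^-1 by rewrite invr_gt0.
have B1 : 1 <= B by rewrite /B; move: li0 b1; nra.
have B0 : 0 < B by exact: lt_le_trans B1.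
have lB : 0 <= ln B by exact: ln_ge0.
pose de := Num.min 1 (eps / (4 * (ln B + 1))).
have d4 : 0 < 4 * (ln B + 1) by rewrite mulr_gt0 // ltr_wpDl.
have de0 : 0 < de by rewrite lt_min ltr01 divr_gt0.
have de1 : de <= 1 by rewrite ge_min lexx.
have deB : de * ln B <= eps / 4.
  apply: (@le_trans _ _ (eps / (4 * (ln B + 1)) * (ln B + 1))); last first.
    by apply: eq_imp_le; field; rewrite gt_eqF // ltr_wpDl.
  apply: ler_pM => //; first exact: ltW.
    by rewrite /de ge_min lexx orbT.
  by rewrite lerDl.
have Id : 0 < I de by apply: Ipos; rewrite de0.
pose g := Num.min (eps / 8) (I de / 8).
have g0 : 0 < g by rewrite lt_min !divr_gt0.
have ge : g <= eps / 8 by rewrite /g ge_min lexx.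
have gI : g <= I de / 8 by rewrite /g ge_min lexx orbT.
pose C2 := Cz * (2 + b / lam).
have C20 : 0 <= C2 by rewrite mulr_ge0 // addr_ge0 // divr_ge0 // ltW.
have I20 : 0 < I de / 2 by rewrite divr_gt0.
have e8 : 0 < eps / 8 by rewrite divr_gt0.
have de01 : 0 < de <= 1 by rewrite de0.
have [n1 _ hn1] := ldp_bounds Ipos ldp de01 I20.
have [n2 _ hn2] := poly_le_exp (C2 * B) e8.
exists g => //; near=> r.
have rn1 : (n1 <= r.+1)%N by rewrite leqW //; near: r; exact: nbhs_infty_ge.
have rn2 : (n2 <= r.+1)%N by rewrite leqW //; near: r; exact: nbhs_infty_ge.
have r3 : ln (2 * (1 + lam)) / g <= r%:R by near: r; exact: nbhs_infty_ger.
have {hn1}/andP[_ ld] := hn1 _ rn1; have {hn2}/= po := hn2 _ rn2.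
apply: le_trans (return_tail_le lam0 kap0 r) _.
have tr : r%:R <= r.+1%:R :> R by rewrite ler_nat.
move: r.+1 tr {rn1 rn2} ld po => t tr ld po.
set h := ceiln _ in ld.
have ht : (h <= t)%N by rewrite ceiln_le ?mulr_ge0 ?(ltW de0) // ler_piMl.
have hd : h%:R <= de * t%:R + 1.
  have d0 : 0 <= de * t%:R by rewrite mulr_ge0 // ltW.
  apply: (@le_trans _ _ (Num.truncn (de * t%:R)).+1%:R).
    by rewrite ler_nat ceiln_le // ltW // truncnS_gt.
  by rewrite -natr1 lerD2r truncn_le.
have sv := killed_survival_le lam0 kap0 t h dec Cz0 b1 Zb.
rewrite -/B -/C2 -/(tail lam kap t h) in sv.
have t0 : 0 <= t%:R :> R by [].
clearbody h C2 g de B.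
have first : h%:R * (C2 * B ^+ h) * expR (- (eps * t%:R)) <= expR (- (eps / 2 * t%:R)).
  have Bh : B ^+ h <= B * expR (eps / 4 * t%:R).
    rewrite -[X in X ^+ h]lnK ?posrE // -expRM_natl -[X in X * expR _]lnK ?posrE // -expRD ler_expR.
    apply: (@le_trans _ _ ((de * t%:R + 1) * ln B)); first by rewrite ler_wpM2r.
    rewrite mulrDl mul1r addrC lerD2l mulrAC ler_wpM2r //.
  apply: (@le_trans _ _ (expR (eps / 8 * t%:R) * expR (eps / 4 * t%:R) * expR (- (eps * t%:R)))).
    rewrite ler_wpM2r ?expR_ge0 //.
    apply: (@le_trans _ _ (C2 * B * t.+1%:R ^+ 2 * expR (eps / 4 * t%:R))); last first.
      by rewrite ler_wpM2r ?expR_ge0.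
    rewrite mulrCA.
    rewrite (_ : C2 * B * _ * _ = C2 * (B * (t.+1%:R ^+ 2 * expR (eps / 4 * t%:R)))); last by ring.
    rewrite ler_wpM2l //.
    apply: (@le_trans _ _ (h%:R * (B * expR (eps / 4 * t%:R)))); first by rewrite ler_wpM2l.
    rewrite mulrCA ler_wpM2l ?(ltW B0) // ler_wpM2r ?expR_ge0 //.
    rewrite -natrX ler_nat (leq_trans ht) // (leq_trans (leqnSn t)) //.
    by rewrite expnS expn1 leq_pmulr.
  rewrite -!expRD ler_expR; have := mulr_ge0 (ltW e8) t0; lra.
have sec : tail lam kap t h <= expR (- (I de / 2 * t%:R)).
  apply: le_trans ld _; rewrite ler_expR; apply: eq_imp_le; lra.
have f1 : expR (- (eps / 2 * t%:R)) <= expR (- (2 * g * t%:R)).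
  by rewrite ler_expR lerN2 ler_wpM2r //; move: ge e8; lra.
have f2 : expR (- (I de / 2 * t%:R)) <= expR (- (2 * g * t%:R)).
  by rewrite ler_expR lerN2 ler_wpM2r //; move: gI I20; lra.
have l1 : 0 < 1 + lam by rewrite addr_gt0.
apply: (@le_trans _ _ ((1 + lam) * (2 * expR (- (2 * g * t%:R))))).
  by rewrite ler_wpM2l ?(ltW l1) //; move: sv first sec f1 f2; lra.
have l2 : 0 < 2 * (1 + lam) by rewrite mulr_gt0.
rewrite mulrA [_ * 2]mulrC -[X in X * _]lnK ?posrE // -expRD ler_expR.
move: r3; rewrite ler_pdivrMr // => r3.
have := ler_wpM2r (ltW g0) tr; move: r3; nra.
Unshelve. all: by end_near. Qed.

End return_time.

Section linear_reach.
Context {R : realType}.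
Variables (mu : nat -> R) (lam : R) (kap : tree).
Hypotheses (hmu : prob_nat mu) (mu0 : mu 0%N = 0).
Hypotheses (lam0 : 0 < lam) (kap0 : forall x, (0 < kap x)%N).

(* The cascade survives [N] steps above slope [ab] at the cost
   [(m' / mt) ^+ N]; the growth at the root makes up for it by time
   [N * ab / a]. *)
Lemma reach_linear (m' tau mt : R) (h k : nat) (ab a nu s : R) (r : nat) :
  1 <= m' -> m' <= mt -> (0 < h)%N -> 0 < tau <= 1 ->
  (forall t, 0 <= t <= tau -> m' * t <= 1 - pgf mu (1 - t)) ->
  0 < a <= ab -> ab * k%:R <= h%:R -> 0 < nu ->
  ln mt - ln m' <= nu * (ab / a - 1) ->
  0 < s -> (forall N, s <= casc lam mt h k N kap) ->
  expR nu <= m' * (1 - return_tail lam kap r) ->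
  exists C : R, exists n0 : nat, forall n, (n0 <= n)%N ->
    tau <= reach mu lam kap (a * n%:R - C) n [::].
Proof.
move=> m'1 m'mt h0 tau01 lin /andP[a0 aab] abk nu0 hmt s0 hs th.
have /andP[tau0 tau1] := tau01.
have m'0 : 0 < m' by exact: lt_le_trans m'1.
have mt1 : 1 <= mt by exact: le_trans m'mt.
have mt0 : 0 < mt by exact: lt_le_trans mt1.
have ab0 : 0 < ab by exact: lt_le_trans aab.
pose q := m' / mt; have q0 : 0 < q by rewrite divr_gt0.
have q1 : q <= 1 by rewrite ler_pdivrMr // mul1r.
pose c := tau / mt ^+ k * s.
have tk0 : 0 < tau / mt ^+ k by rewrite divr_gt0 // exprn_gt0.
have c0 : 0 < c by rewrite mulr_gt0.
pose C0 := ab * k%:R.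
have s1 : s <= 1 by apply: le_trans (hs 0%N) _.
have lns : ln s <= 0 by exact: ln_le0.
pose K1 := (k%:R * ln mt - ln s) / nu.
have K10 : 0 <= K1.
  by rewrite divr_ge0 ?(ltW nu0) // subr_ge0 (le_trans lns) // mulr_ge0 // ln_ge0.
pose H N := ab * N%:R - C0.
have base N j : (N <= j <= N + r)%N -> q ^+ (N + r) * c <= reach mu lam kap (H N) j [::].
  move=> /andP[Nj jr].
  have := cascade_survival hmu lam0 kap0 mt1 m'0 m'mt h0 tau01 lin (ltW ab0) abk
    (lexx (ab * k%:R)) j (x := [::]) (H0 := - C0).
  rewrite /= sub0r => /(_ (lexx _)); rewrite subtree_nil => surv_j.
  apply: (@le_trans _ _ (surv mu lam kap j (barrier ab (- C0)) [::])).
    apply: le_trans surv_j; apply: ler_pM.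
    - by rewrite exprn_ge0 // ltW.
    - exact: ltW.
    - by rewrite -/q ler_wiXn2l // ltW.
    - by rewrite /c ler_wpM2l // ltW.
  rewrite /reach /surv lerD2l lerN2; apply: fail_mono => // i y.
  rewrite /barrier /final; case: eqP => //= -> le_y; apply: le_trans le_y.
  by rewrite /H addrC lerD2l ler_wpM2l ?(ltW ab0) // ler_nat.
have grow N n : (N <= n)%N -> (N + r)%:R * (ab / a) + K1 <= n%:R ->
    tau <= reach mu lam kap (H N) n [::].
  move=> Nn hn.
  have U0 : 0 < q ^+ (N + r) * c by rewrite mulr_gt0 // exprn_gt0.
  apply: le_trans (reach_growth hmu lam0 kap0 tau01 lin th (ltW nu0) U0 (base N) Nn).
  rewrite le_min lexx /=.
  have -> : q ^+ (N + r) * c * expR (nu * (n%:R - (N + r)%:R)) =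
      tau * expR (nu * (n%:R - (N + r)%:R) - (N + r)%:R * (ln mt - ln m') - k%:R * ln mt + ln s).
    rewrite !expRD [expR (ln s)]lnK ?posrE // !expRN !expRM_natl expRD expRN !lnK ?posrE //.
    rewrite /c /q expr_div_n exprMn exprVn; field.
    by rewrite !gt_eqF ?exprn_gt0 ?mulr_gt0 ?invr_gt0 ?exprn_gt0.
  rewrite ler_peMr ?(ltW tau0) // -[leLHS]expR0 ler_expR.
  have h1 := ler_wpM2l (ler0n R (N + r)) hmt.
  have h2 := ler_wpM2l (ltW nu0) hn.
  have h3 : nu * K1 = k%:R * ln mt - ln s by rewrite /K1 mulrC divfK // gt_eqF.
  rewrite mulrDr h3 in h2; move: h1 h2; lra.
have ia : 0 < ab / a by rewrite divr_gt0.
exists (K1 * a + ab * r.+1%:R + C0), (Num.truncn (K1 + r%:R * (ab / a))).+1 => n nn.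
have nr : K1 + r%:R * (ab / a) <= n%:R.
  by apply: le_trans (ltW (truncnS_gt _)) _; rewrite ler_nat.
(* The cascade is run up to the time [N], close to [y], at which slope [ab] has gained the height
   [a * n] up to a constant; the remaining time is left for the growth at the root. *)
pose y := (n%:R - K1) * (a / ab).
have yr : r%:R <= y.
  rewrite /y -ler_pdivrMr ?divr_gt0 // invf_div lerBrDl //.
have y0 : 0 <= y by exact: le_trans yr.
pose N := (Num.truncn y - r)%N.
have Nr : (N + r = Num.truncn y)%N.
  by rewrite subnK // truncn_ge_nat.
have ty : (N + r)%:R <= y by rewrite Nr truncn_le.
have ty1 : y < (N + r)%:R + 1 by rewrite Nr natr1 truncnS_gt.
have yab : y * (ab / a) = n%:R - K1.
  by rewrite /y; field; rewrite !gt_eqF.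
apply: (@le_trans _ _ (reach mu lam kap (H N) n [::])).
  apply: grow.
    rewrite -(ler_nat R); apply: (@le_trans _ _ (N + r)%:R); first by rewrite ler_nat leq_addr.
    apply: le_trans ty _; apply: (@le_trans _ _ (n%:R - K1)); last by rewrite gerBl.
    by rewrite -yab ler_peMr // ler_pdivlMr // mul1r.
  by rewrite -lerBrDr -yab ler_wpM2r // ltW.
apply: reach_le => //; rewrite /H.
have : ab * y = (n%:R - K1) * a by rewrite /y; field; rewrite gt_eqF.
have := ler_wpM2l (ltW ab0) (ltW ty1); rewrite natrD -natr1; lra.
Qed.

End linear_reach.

(** * Zero speed with exponentially decaying loops *)

Section zero_speed.
Context {R : realType}.
Context {d : measure_display} {Om : measurableType d}.
Variables (P : probability Om R) (p : nat -> R) (K : seq nat -> Om -> nat).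
Hypothesis Klaw : nat_rv_law P K p.
Hypothesis Kind : indep1 P K (fun _ => True).
Hypothesis K0 : forall u w, (0 < K u w)%N.
Variable mB : R.
Hypothesis hmB : (fun n => \sum_(k < n) (k%:R * p k)) @ \oo --> mB.
Variables (mu : nat -> R) (lam m : R).
Hypotheses (hmu : prob_nat mu) (mu0 : mu 0%N = 0) (mu1 : mu 1%N < 1).
Hypothesis hm : (fun n => \sum_(k < n) k%:R * mu k) @ \oo --> m.
Hypotheses (m1 : 1 < m) (lam0 : 0 < lam).

Let X (w : Om) : Tree := K^~ w.

Variable I : R -> R.
Hypothesis I0 : I 0 = 0.
Hypothesis Ipos : forall y, 0 < y <= 1 -> 0 < I y.
Hypothesis Iconv : forall a b t, 0 <= a <= 1 -> 0 <= b <= 1 -> 0 <= t <= 1 ->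
  I (t * a + (1 - t) * b) <= t * I a + (1 - t) * I b.
Hypothesis ldp : {ae P, forall w, forall y : R, 0 < y <= 1 ->
  (fun n => ln (tail lam (X w) n (ceiln (y * n%:R))) / n%:R) @ \oo --> - I y}.
Variable eps : R.
Hypothesis eps0 : 0 < eps.
Hypothesis dec : {ae P, forall w, loops_decay lam eps (X w)}.

(** By convexity and [I 0 = 0], the cost per level [I y / y] is nondecreasing. *)
Let slope y1 y : 0 < y1 -> y1 <= y <= 1 -> I y1 / y1 * y <= I y.
Proof.
move=> y10 /andP[y1y y_1]; have y0 : 0 < y by exact: lt_le_trans y1y.
have t01 : 0 <= y1 / y <= 1 by rewrite divr_ge0 ?(ltW y10) ?(ltW y0) //= ler_pdivrMr // mul1r.
have := Iconv (a := y) (b := 0) (t := y1 / y) _ _ t01.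
rewrite mulr0 addr0 I0 mulr0 addr0 divfK ?gt_eqF // (ltW y0) y_1 lexx ler01 => /(_ isT isT) h.
have := ler_wpM2l (_ : 0 <= y / y1) h; rewrite divr_ge0 ?(ltW y10) ?(ltW y0) // => /(_ isT).
rewrite mulrA [y / y1 * (y1 / y)](_ : _ = 1) ?mul1r; last by field; rewrite !gt_eqF.
by congr (_ <= _); ring.
Qed.

(** The bound has to be summable for an almost sure conclusion. Once probability [tau] is secured
    from time [n1] on, [L] attempts of [L + 1] generations follow; [L] also serves as cutoff for the
    return times, so both errors are geometric in [L]. *)
Lemma zero_speed_fail (a : R) : 0 < a <= 1 -> I a < ln m ->
  {ae P, forall w, exists A r C : R, exists n0 L0 : nat, [/\ 0 <= A, 0 <= r < 1 &
    forall L n1, (L0 <= L)%N -> (n0 <= n1)%N ->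
      1 - reach mu lam (X w) (a * n1%:R - C) (n1 + L * L.+1) [::] <= A * r ^+ L]}.
Proof.
move=> a01 Ia; have /andP[a0 a1] := a01.
have Ia0 := Ipos a01.
pose D := (ln m - I a) / 4; have D0 : 0 < D by rewrite divr_gt0 // subr_gt0.
pose nu := I a + 2 * D; have nu0 : 0 < nu by rewrite addr_gt0 // mulr_gt0.
pose m' := expR (I a + 3 * D).
have m'1 : 1 <= m' by rewrite /m' -[leLHS]expR0 ler_expR; move: Ia0 D0; lra.
have m'm : m' < m.
  rewrite /m' -ltr_ln ?posrE ?expR_gt0 // ?(lt_trans _ m1) // expRK.
  by rewrite (_ : ln m = I a + 4 * D); [move: D0; lra|rewrite /D; field].
have [tau tau01 lin] := pgf_compl_ge hmu hm m'm.
(* [S] collects the slopes whose cost per level is at most [c'], slightly more than that of [a]. *)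
pose c' := (I a + D) / a; have c'0 : 0 < c' by rewrite divr_gt0 ?addr_gt0.
pose S := [set y : R | a <= y <= 1 /\ I y <= c' * y].
have Sa : S a by rewrite /S /= lexx a1 /c' divfK ?gt_eqF // lerDl ltW.
have Sub : has_sup S.
  by split; [exists a|exists 1 => y [/andP[_ ?] _]].
have supa : a <= sup S by apply: ub_le_sup => //; case: Sub.
pose ep := D / nu / 2.
have ep0 : 0 < ep by rewrite divr_gt0 // divr_gt0.
have ep1 : ep < 1.
  by rewrite /ep ltr_pdivrMr // ltr_pdivrMr // /nu; move: Ia0 D0; lra.
have epnu : I a + D <= (1 - ep) * nu - D / 2.
  rewrite mulrBl mul1r /ep (_ : D / nu / 2 * nu = D / 2); last by field; rewrite gt_eqF.
  by rewrite /nu; lra.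
have e10 : 0 < 1 - ep by rewrite subr_gt0.
have supS0 : 0 < sup S by exact: lt_le_trans supa.
(* Beyond [ab / (1 - ep)] the rate function lies above the line of slope [c'],
   whereas [I ab <= c' * ab]: a walk which climbs [ab * k] levels by time [k]
   cannot do so before time [(1 - ep) * k]. *)
have [ab [/andP[aab ab1] Iab] sab] : exists2 ab, S ab & sup S * (1 - ep) < ab.
  have [ab Sab h] := sup_adherent (mulr_gt0 supS0 ep0) Sub.
  by exists ab => //; apply: le_lt_trans h; apply: eq_imp_le; ring.
have ab0 : 0 < ab by exact: lt_le_trans aab.
have ab01 : 0 < ab <= 1 by rewrite ab0.
(* [mt] makes the blocks of slope [ab] grow, while the excess [ln mt - ln m'] can be repaid by
   growth at rate [nu] over [ab / a - 1] units of time. *)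
pose lmt := Num.max (I a + 3 * D) (ab * nu / a).
pose mt := expR lmt; have lnmt : ln mt = lmt by rewrite expRK.
have m'mt : m' <= mt by rewrite ler_expR le_max lexx.
have mt1 : 1 <= mt by exact: le_trans m'mt.
pose y1 := ab / (1 - ep).
have y1S : sup S < y1 by rewrite ltr_pdivlMr.
have [be be0 [hbe1 hbe2]] : exists2 be, 0 <= be &
    (forall y, ab / (1 - ep) <= y <= 1 -> be * (y - 0) <= I y) /\ I ab < be * ab.
  have [y11|y11] := leP y1 1.
    have y10 : 0 < y1 by rewrite divr_gt0.
    have nS : c' * y1 < I y1.
      rewrite ltNge; apply/negP => Iy1.
      have : S y1.
        split => //; rewrite y11 andbT (le_trans supa) // ltW //.
      by move=> /(sup_upper_bound Sub); rewrite leNgt y1S.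
    exists (I y1 / y1); first by rewrite divr_ge0 ?(ltW y10) // (le_trans _ (ltW nS)) // mulr_ge0 // ltW.
    split; first by move=> y y1y; rewrite subr0; exact: slope.
    by apply: le_lt_trans Iab _; rewrite ltr_pM2r // ltr_pdivlMr.
  (* Here the first condition is vacuous, and any slope above [I ab / ab] serves. *)
  exists (I ab / ab + 1); first by rewrite addr_ge0 // divr_ge0 ?(ltW ab0) // ltW // Ipos.
  split; first by move=> y /andP[h1 h2]; have := le_trans h1 h2; rewrite leNgt -/y1 y11.
  by rewrite mulrDl mul1r divfK ?gt_eqF // ltrDl.
pose dl := Num.min ((be * ab - I ab) / 4) (D * ab / a / 8).
have Dab : 0 < D * ab / a by rewrite divr_gt0 // mulr_gt0.
have dl0 : 0 < dl by rewrite lt_min divr_gt0 ?subr_gt0 // divr_gt0.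
have dl1 : 4 * dl <= be * ab - I ab.
  by rewrite mulrC -ler_pdivlMr // /dl ge_min lexx.
have dl2 : 8 * dl <= D * ab / a.
  by rewrite mulrC -ler_pdivlMr // /dl ge_min lexx orbT.
pose gam := dl.
have hmt : I ab + 2 * dl + gam <= (1 - ep) * ln mt.
  rewrite lnmt; apply: (@le_trans _ _ ((1 - ep) * (ab * nu / a))); last first.
    by rewrite ler_wpM2l ?(ltW e10) // le_max lexx orbT.
  have ra : 0 <= ab / a by rewrite divr_ge0 ?(ltW ab0) ?(ltW a0).
  have := ler_wpM2r ra epnu.
  have -> : (I a + D) * (ab / a) = c' * ab by rewrite /c'; ring.
  have -> : ((1 - ep) * nu - D / 2) * (ab / a) = (1 - ep) * (ab * nu / a) - D * ab / a / 2 by ring.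
  by move: Iab dl2 dl0; rewrite /gam; lra.
have W_large : {ae P, forall w, \forall k \near \oo, expR (gam * k%:R) <=
    block_mass lam mt (ceiln (ab * k%:R)) k (X w)}.
  apply: filterS ldp => w ldpw.
  apply: (block_mass_concentrated lam0 _ (lexx 0) Ipos ldpw ab01 (v1 := 0) (be := be) (dl := dl) (eps := ep)) => //.
  - by move=> x; exact: K0.
  - by rewrite ep0.
  - by rewrite mul0r subr0; move: dl1; lra.
have hkk k : (ceiln (ab * k%:R) <= k)%N.
  by rewrite ceiln_le ?mulr_ge0 ?(ltW ab0) // ler_piMl.
have [k [k0 Wk]] := exists_moment_lt1 (hk := fun k => ceiln (ab * k%:R)) lam0 mt1 dl0 hkk Klaw K0 W_large.
pose h := ceiln (ab * k%:R).
have abk : ab * k%:R <= h%:R by rewrite ceiln_ge // mulr_ge0 // ltW.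
have h0 : (0 < h)%N.
  by rewrite -(ltr_nat R); apply: lt_le_trans abk; rewrite mulr_gt0 // ltr0n.
have r1 : (1 + expR (- gam)) / 2 < 1.
  have : expR (- gam) < 1 by rewrite expR_lt1 oppr_lt0.
  by lra.
have ki0 : 0 < k%:R^-1 :> R by rewrite invr_gt0 ltr0n.
have pos := casc_ae_pos lam0 mt1 (hkk k) Klaw Kind K0 ki0 r1 Wk.
have grow := generation_growth Klaw Kind K0 hmB.
have mB1 := mean_ge1 Klaw K0 hmB.
have mB2 : 1 <= 2 * mB by lra.
have dl' : {ae P, forall w, loops_decay lam eps (X w) /\ (forall y : R, 0 < y <= 1 ->
    (fun n => ln (tail lam (X w) n (ceiln (y * n%:R))) / n%:R) @ \oo --> - I y)}.
  by move: dec ldp; apply: filterS2 => w.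
move: pos grow dl'; apply: filterS3 => w [s s0 hs] [Cz Cz0 Zb] [decw ldpw].
have kap0 x : (0 < X w x)%N by exact: K0.
have [g g0 ret] := return_tail_exp lam0 kap0 Ipos ldpw eps0 decw Cz0 mB2 Zb.
have enm : expR nu < m' by rewrite ltr_expR /nu ltrD2l ltr_pM2r // ltr_nat.
have m'0 : 0 < m' by exact: expR_gt0.
have [r hr] : exists r, expR nu <= m' * (1 - return_tail lam (X w) r).
  pose th := 1 - expR nu / m'.
  have th0 : 0 < th by rewrite subr_gt0 ltr_pdivrMr // mul1r.
  have [L _ hL] := ret.
  pose r := maxn L (Num.truncn (- ln th / g)).+1.
  exists r; rewrite mulrC -ler_pdivrMr // lerBrDl -lerBrDr -/th.
  apply: le_trans (hL r (leq_maxl _ _)) _.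
  rewrite -[leRHS]lnK ?posrE // ler_expR lerNl mulrC -ler_pdivrMr //.
  apply: le_trans (ltW (truncnS_gt _)) _.
  by rewrite ler_nat leq_maxr.
have aab' : 0 < a <= ab by rewrite a0.
have hm2 : ln mt - ln m' <= nu * (ab / a - 1).
  rewrite lnmt expRK lerBlDr ge_max; apply/andP; split.
    rewrite lerDr mulr_ge0 ?(ltW nu0) // subr_ge0 ler_pdivlMr // mul1r //.
  by rewrite mulrBr mulr1 mulrA [nu * ab]mulrC /nu; move: D0; lra.
have [C [n0 lin_reach]] := reach_linear hmu lam0 kap0 m'1 m'mt h0 tau01 lin aab' abk nu0 hm2 s0 hs hr.
have /andP[tau0 tau1] := tau01.
have m0 : 0 < m by exact: lt_trans m1.
pose c := (1 - mu 1%N) * tau / m.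
have c0 : 0 < c by rewrite !mulr_gt0 ?subr_gt0 ?invr_gt0.
have M0 : 0 <= mu 1%N := hmu.1 1%N.
have c1 : c <= 1.
  rewrite /c ler_pdivrMr // mul1r; apply: le_trans (ltW m1).
  by apply: mulr_ile1; rewrite ?(ltW tau0) ?subr_ge0 ?(ltW mu1) // gerBl.
have [L0 _ hL0] := ret.
pose rho := Num.max (1 - c) (expR (- g)).
have rho0 : 0 <= rho by rewrite le_max expR_ge0 orbT.
exists (1 + c^-1), rho, C, n0, L0; split.
- by rewrite addr_ge0 // invr_ge0 ltW.
- by rewrite rho0 gt_max gtrBl c0 expR_lt1 oppr_lt0.
move=> L n1 LL0 n1n0.
apply: le_trans (root_fail_decay (H := a * n1%:R - C) hmu mu0 mu1 lam0 kap0 (r := L) (n1 := n1) hm m1 tau01 _ (leqnn _)) _.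
  move=> j nj; apply: le_trans (lin_reach j (leq_trans n1n0 nj)) _.
  by apply: reach_le => //; rewrite lerD2r ler_wpM2l ?(ltW a0) // ler_nat.
rewrite -/c [leRHS]mulrDl mul1r; apply: lerD.
  by rewrite lerXn2r ?nnegrE ?subr_ge0 // le_max lexx.
rewrite mulrC ler_wpM2l ?invr_ge0 ?(ltW c0) //.
apply: le_trans (hL0 _ LL0) _.
by rewrite -mulNr mulrC expRM_natl lerXn2r ?nnegrE ?expR_ge0 // le_max lexx orbT.
Qed.

End zero_speed.

(** * Positive speed, or slowly decaying loops *)

Section persistent_lineage.
Context {R : realType}.
Context {d : measure_display} {Om : measurableType d}.
Variables (P : probability Om R) (p : nat -> R) (K : seq nat -> Om -> nat).
Hypothesis Klaw : nat_rv_law P K p.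
Hypothesis Kind : indep1 P K (fun _ => True).
Hypothesis K0 : forall u w, (0 < K u w)%N.
Variables (mu : nat -> R) (lam m : R).
Hypotheses (hmu : prob_nat mu) (mu0 : mu 0%N = 0) (mu1 : mu 1%N < 1).
Hypothesis hm : (fun n => \sum_(k < n) k%:R * mu k) @ \oo --> m.
Hypotheses (m1 : 1 < m) (lam0 : 0 < lam).

Let X (w : Om) : Tree := K^~ w.

Variables (v : R) (I : R -> R).
Hypothesis v0 : 0 <= v.
Hypothesis Iv : I v = 0.
Hypothesis Ipos : forall y, v < y <= 1 -> 0 < I y.
Hypothesis Iconv : forall a b t, v <= a <= 1 -> v <= b <= 1 -> 0 <= t <= 1 ->
  I (t * a + (1 - t) * b) <= t * I a + (1 - t) * I b.
Hypothesis ldp : {ae P, forall w, forall y : R, v < y <= 1 ->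
  (fun n => ln (tail lam (X w) n (ceiln (y * n%:R))) / n%:R) @ \oo --> - I y}.

Lemma persistent_lineage_fail (a : R) : v < a <= 1 -> I a < ln m ->
  0 < v \/ (forall eps, 0 < eps -> {ae P, forall w,
    exists2 t, (0 < t)%N & expR (- (eps * t%:R)) <= loop lam (X w) t}) ->
  {ae P, forall w, forall eta : R, 0 < eta -> exists C : R, forall N,
    fail mu lam (X w) N (barrier a (- C)) [::] <= eta}.
Proof.
move=> va Ia cases; have /andP[va0 a1] := va.
have a0 : 0 < a by exact: le_lt_trans va0.
have Ia0 := Ipos va.
pose D := (ln m - I a) / 2; have D0 : 0 < D by rewrite divr_gt0 // subr_gt0.
pose m' := expR (I a + D).
have lnm' : ln m' = I a + D by rewrite expRK.
have m'1 : 1 <= m' by rewrite /m' -[leLHS]expR0 ler_expR; move: Ia0 D0; lra.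
have m'm : m' < m.
  rewrite /m' -ltr_ln ?posrE ?expR_gt0 // ?(lt_trans _ m1) // expRK.
  by rewrite (_ : ln m = I a + 2 * D); [move: D0; lra|rewrite /D; field].
have [tau tau01 lin] := pgf_compl_ge hmu hm m'm.
have [gam gam0 W_large] : exists2 gam, 0 < gam & {ae P, forall w, \forall k \near \oo,
    expR (gam * k%:R) <= block_mass lam m' (ceiln (a * k%:R)) k (X w)}.
  case: cases => [v_gt0|wait].
    pose ep := D / (2 * (I a + D)).
    have ID : 0 < I a + D by rewrite addr_gt0.
    have ep0 : 0 < ep by rewrite divr_gt0 // mulr_gt0.
    have ep1 : ep < 1 by rewrite /ep ltr_pdivrMr ?mulr_gt0 //; move: Ia0 D0; lra.
    have av0 : 0 < a - v by rewrite subr_gt0.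
    (* The slope of the chord from [(v, 0)] to [(a, I a)]. Arriving at time [(1 - ep) * k] instead
       of [k] costs [be * v * ep] more per unit of [k], a margin that is positive because
       [v > 0]. *)
    pose be := I a / (a - v).
    have be0 : 0 < be by rewrite divr_gt0.
    have bve : 0 < be * v * ep by rewrite mulr_gt0 // mulr_gt0.
    pose dl := Num.min (be * v * ep / 4) (D / 6).
    have dl0 : 0 < dl by rewrite lt_min divr_gt0 //= divr_gt0.
    have dl1 : 4 * dl <= be * v * ep by rewrite mulrC -ler_pdivlMr // /dl ge_min lexx.
    have dl2 : 6 * dl <= D by rewrite mulrC -ler_pdivlMr // /dl ge_min lexx orbT.
    exists dl => //; apply: filterS ldp => w ldpw.
    have aep : a <= a / (1 - ep).
      by rewrite ler_pdivlMr ?subr_gt0 // ler_piMr ?(ltW a0) // gerBl ltW.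
    apply: (block_mass_concentrated lam0 _ v0 Ipos ldpw va (v1 := v) (be := be) (dl := dl) (eps := ep)) => //.
    - by move=> x; exact: K0.
    - exact: ltW.
    - by rewrite ep0.
    - move=> y /andP[/(le_trans aep) ay y1].
      have vy : 0 < y - v by rewrite subr_gt0; exact: lt_le_trans ay.
      have t01 : 0 <= (a - v) / (y - v) <= 1.
        by rewrite divr_ge0 ?(ltW av0) ?(ltW vy) //= ler_pdivrMr // mul1r lerD2r.
      have := Iconv (a := y) (b := v) (t := (a - v) / (y - v)) _ _ t01.
      rewrite Iv mulr0 addr0 (_ : _ * y + _ = a); last by field; rewrite gt_eqF.
      rewrite lexx y1 (le_trans (ltW va0) ay) (le_trans (ltW va0) a1) => /(_ isT isT) h.
      rewrite /be mulrAC ler_pdivrMr // -ler_pdivlMr //.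
      apply: (le_trans h); apply: eq_imp_le; ring.
    - rewrite (_ : be * _ = I a + be * v * ep); last by rewrite /be; field; rewrite gt_eqF.
      by rewrite lerD2l.
    - rewrite lnm' (_ : (1 - ep) * _ = I a + D / 2); last by rewrite /ep; field; rewrite gt_eqF.
      by move: dl2; lra.
  exists (D / 6); first by rewrite divr_gt0.
  have D2 : 0 < D / 2 by rewrite divr_gt0.
  move: ldp (wait _ D2); apply: filterS2 => w ldpw [t t0 ht].
  apply: (block_mass_waiting lam0 _ v0 Ipos ldpw va (dl := D / 6) (eps := D / 2) (t := t)) => //.
  - by move=> x; exact: K0.
  - by rewrite divr_gt0.
  - by rewrite (ltW D2) lnm' /=; move: D0 Ia0; lra.
  - by rewrite lnm'; lra.
have hkk k : (ceiln (a * k%:R) <= k)%N.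
  by rewrite ceiln_le ?mulr_ge0 ?(ltW a0) // ler_piMl.
have [k [k0 Wk]] := exists_moment_lt1 (hk := fun k => ceiln (a * k%:R)) lam0 m'1 gam0 hkk Klaw K0 W_large.
have abk : a * k%:R <= (ceiln (a * k%:R))%:R by rewrite ceiln_ge // mulr_ge0 // ltW.
have h0 : (0 < ceiln (a * k%:R))%N.
  by rewrite -(ltr_nat R); apply: lt_le_trans abk; rewrite mulr_gt0 // ltr0n.
have r1 : (1 + expR (- gam)) / 2 < 1.
  have : expR (- gam) < 1 by rewrite expR_lt1 oppr_lt0.
  by lra.
have ki0 : 0 < k%:R^-1 :> R by rewrite invr_gt0 ltr0n.
exact: (fail_ae_small hmu mu0 mu1 lam0 m'1 h0 (hkk k) tau01 lin (ltW a0) abk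
  (lexx (a * k%:R)) Klaw Kind K0 ki0 r1 Wk).
Qed.

End persistent_lineage.

(** * The particle system *)

Section bstep_law.
Context {R : realType}.
Variables (lam : R) (kap : tree).
Hypotheses (lam0 : 0 < lam) (kap0 : forall x, (0 < kap x)%N).
Context {d : measure_display} {Om : measurableType d} (Q : probability Om R).

Lemma bstep_neighbors x (u : R) : bstep lam kap x u \in neighbors kap x.
Proof.
have kk (t : nat) : (minn t (kap x).-1 < kap x)%N.
  by rewrite gtn_min prednK ?leqnn ?orbT.
have up t : minn t (kap x).-1 :: x \in [seq i :: x | i <- iota 0 (kap x)].
  by apply: (map_f (fun i => i :: x)); rewrite mem_iota add0n kk.
rewrite /bstep /neighbors mem_cat; case: x kk up => [|i x] kk up; first by rewrite up orbT.
by case: ifP => _; rewrite ?up ?orbT // inE eqxx.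
Qed.

(** Sandwiching between the open and the closed interval avoids any discussion of end points; at
    [u = 1] the cap in [bstep] takes effect. *)
Let unit_itv (s t : R) (S : set R) : measurable S -> 0 <= s -> s < t -> t <= 1 ->
  `]s, t[%classic `<=` S -> S `&` `[0%R, 1%R]%classic `<=` `[s, t]%classic ->
  lebesgue_measure (S `&` `[0%R, 1%R]%classic) = (t - s)%:E.
Proof.
move=> mS s0 lt t1 h1 h2.
have m0 : measurable (S `&` `[0%R, 1%R]%classic) by exact: measurableI.
apply/eqP; rewrite eq_le; apply/andP; split.
  apply: (@le_trans _ _ (lebesgue_measure `[s, t]%classic)).
    by apply: le_measure; rewrite ?inE.
  by rewrite lebesgue_measure_itv /= lte_fin lt -EFinB.
apply: (@le_trans _ _ (lebesgue_measure `]s, t[%classic)).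
  by rewrite lebesgue_measure_itv /= lte_fin lt -EFinB.
apply: le_measure; rewrite ?inE // => y ys; split; first exact: h1.
move: ys; rewrite /= !in_itv /= => /andP[sy yt]; apply/andP; split.
  by rewrite ltW // (le_lt_trans s0).
by rewrite ltW // (lt_le_trans yt).
Qed.

Definition stepw (x y : seq nat) : R :=
  if (size y < size x)%N then wdn lam (nilp x) (kap x) else wup lam (nilp x) (kap x).

Lemma walk_neighbors (phi : seq nat -> R) x :
  walk lam kap phi x = \sum_(y <- neighbors kap x) stepw x y * phi y.
Proof.
rewrite /walk /op /neighbors big_cat big_map /=; congr (_ + _).
  case: x => [|i x] /=; first by rewrite big_nil mul0r.
  by rewrite big_seq1 /stepw /= ltnSn.
rewrite mulr_sumr -[X in iota 0 X]subn0 -/(index_iota 0 (kap x)) big_mkord.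
by apply: eq_bigr => i _; rewrite /stepw /= ltnNge leqnSn.
Qed.

Let child_itv (k i : nat) (z : R) : (i < k)%N -> i%:R < z < i.+1%:R -> minn (Num.truncn z) k.-1 = i.
Proof.
move=> ik /andP[iz zi]; have -> : Num.truncn z = i.
  by apply/eqP; rewrite truncn_eq ?(ltW iz) //= (le_trans _ (ltW iz)).
by apply/minn_idPl; rewrite -ltnS prednK // (leq_ltn_trans _ ik).
Qed.

Let child_itv_sub (k i : nat) (z : R) : 0 <= z <= k%:R -> (i < k)%N ->
  minn (Num.truncn z) k.-1 = i -> i%:R <= z <= i.+1%:R.
Proof.
move=> /andP[z0 zk] ik e; have k0 : (0 < k)%N by exact: leq_ltn_trans ik.
have iz : (i <= Num.truncn z)%N by rewrite -e geq_minl.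
rewrite -(truncn_ge_nat _ z0) iz /=; move: e; rewrite /minn; case: ltnP => h e.
  by rewrite -e ltW // truncnS_gt.
by rewrite -e prednK.
Qed.

Lemma bstep_prob x y : y \in neighbors kap x ->
  measurable [set u : R | bstep lam kap x u = y] /\
  lebesgue_measure ([set u : R | bstep lam kap x u = y] `&` `[0%R, 1%R]%classic) = (stepw x y)%:E.
Proof.
have k0 : 0 < (kap x)%:R :> R by rewrite ltr0n.
have lk : 0 < lam + (kap x)%:R by rewrite addr_gt0.
(* Monotonicity in the driving uniform makes each preimage an interval, hence measurable. *)
have minn_mono t1 t2 t3 k (i : nat) : (t1 <= t2)%N -> (t2 <= t3)%N ->
    minn t1 k = i -> minn t3 k = i -> minn t2 k = i.
  move=> t12 t23 e1 e3; apply/eqP; rewrite eqn_leq; apply/andP; split.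
    by rewrite -e3 leq_min geq_minr andbT (leq_trans (geq_minl _ _)).
  by rewrite -e1 leq_min geq_minr andbT (leq_trans (geq_minl _ _)).
rewrite /neighbors mem_cat => /orP[|/mapP[i]]; last first.
  rewrite mem_iota add0n /= => ik ->.
  have ik' : i.+1%:R <= (kap x)%:R :> R by rewrite ler_nat.
  have i01 : i%:R < i.+1%:R :> R by rewrite ltr_nat.
  have -> : stepw x (i :: x) = wup lam (nilp x) (kap x).
    by rewrite /stepw /= ltnNge leqnSn.
  rewrite /wup /bstep; case: x k0 lk ik ik' => [|j x] k0 lk ik ik' /=.
    set S := [set _ | _].
    have mS : measurable S.
      apply: is_interval_measurable => u1 u3 [e1] [e3] u2 /andP[u12 u23]; congr (_ :: _).
      by apply: minn_mono e1 e3; apply: le_truncn; rewrite ler_pM2r.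
    split => //; rewrite (unit_itv (s := i%:R / (kap [::])%:R) (t := i.+1%:R / (kap [::])%:R)) //.
    - by congr (_%:E); rewrite -mulrBl -natr1 addrAC subrr add0r mul1r.
    - by rewrite ltr_pM2r // invr_gt0.
    - by rewrite ler_pdivrMr // mul1r.
    - move=> u; rewrite /= in_itv /= ltr_pdivrMr // ltr_pdivlMr // => h.
      by rewrite /S /=; congr (_ :: _); exact: child_itv.
    move=> u [[e]] /=; rewrite !in_itv /= ler_pdivrMr // ler_pdivlMr // => /andP[u0 u1].
    by apply: child_itv_sub e => //; rewrite mulr_ge0 ?(ltW k0) //= ler_piMl // ltW.
  set k := kap (j :: x) in k0 lk ik ik' *.
  have SE u : (if u * (lam + k%:R) < lam then x
      else minn (Num.truncn (u * (lam + k%:R) - lam)) k.-1 :: j :: x) = i :: j :: x <->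
      lam <= u * (lam + k%:R) /\ minn (Num.truncn (u * (lam + k%:R) - lam)) k.-1 = i.
    case: ltP => h; split => //; last by move=> [_ ->].
    - by move=> /(congr1 size) /= /eqP; rewrite -[X in X == _]addn0 -addn2 eqn_add2l.
    - by case.
    - by case.
  set S := [set _ | _].
  have mS : measurable S.
    apply: is_interval_measurable => u1 u3 /SE[l1 e1] /SE[l3 e3] u2 /andP[u12 u23]; apply/SE; split.
      by rewrite (le_trans l1) // ler_pM2r.
    by apply: minn_mono e1 e3; apply: le_truncn; rewrite lerD2r ler_pM2r.
  split => //; rewrite (unit_itv (s := (lam + i%:R) / (lam + k%:R)) (t := (lam + i.+1%:R) / (lam + k%:R))) //.
  - by congr (_%:E); rewrite -mulrBl opprD addrACA subrr add0r -natr1 addrAC subrr add0r mul1r.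
  - by rewrite divr_ge0 ?addr_ge0 // ltW.
  - by rewrite ltr_pM2r ?invr_gt0 // ltrD2l.
  - by rewrite ler_pdivrMr // mul1r lerD2l.
  - move=> u; rewrite /= in_itv /= ltr_pdivrMr // ltr_pdivlMr // => /andP[h1 h2].
    apply/SE; split; first by rewrite ltW // (le_lt_trans _ h1) // lerDl.
    by apply: child_itv => //; rewrite ltrBrDl ltrBlDl h1.
  move=> u [/SE[l e]] /=; rewrite !in_itv /= ler_pdivrMr // ler_pdivlMr // => /andP[u0 u1].
  have /andP[h1 h2] : i%:R <= u * (lam + k%:R) - lam <= i.+1%:R.
    by apply: child_itv_sub e => //; rewrite subr_ge0 l /= lerBlDl ler_piMl // ltW.
  by rewrite -lerBrDl h1 -lerBlDl h2.
case: x k0 lk => [|j x] //= k0 lk; rewrite inE => /eqP ->.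
set k := kap (j :: x) in k0 lk *.
have -> : stepw (j :: x) x = lam / (lam + k%:R) by rewrite /stepw /= ltnSn.
have SE u : (if u * (lam + k%:R) < lam then x
    else minn (Num.truncn (u * (lam + k%:R) - lam)) k.-1 :: j :: x) = x <-> u * (lam + k%:R) < lam.
  case: ltP => h; split => // /(congr1 size) /= /eqP.
  by rewrite -[X in _ == X]addn0 -addn2 eqn_add2l.
set S := [set _ | _].
have mS : measurable S.
  apply: is_interval_measurable => u1 u3 /SE l1 /SE l3 u2 /andP[u12 u23]; apply/SE.
  by rewrite (le_lt_trans _ l3) // ler_pM2r.
split => //; rewrite (unit_itv (s := 0) (t := lam / (lam + k%:R))) ?subr0 //.
- by rewrite divr_gt0.
- by rewrite ler_pdivrMr // mul1r lerDl ltW.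
- by move=> u; rewrite /= in_itv /= ltr_pdivlMr // => /andP[_ h]; apply/SE.
move=> u [/SE h] /=; rewrite !in_itv /= ler_pdivlMr // => /andP[-> _] /=.
exact: ltW.
Qed.

End bstep_law.

Section particle_system.
Context {R : realType}.
Context {d : measure_display} {Om : measurableType d} (Q : probability Om R).
Variables (N : seq nat -> Om -> nat) (U : seq nat -> Om -> R) (mu : nat -> R).
Hypotheses (Nlaw : nat_rv_law Q N mu) (Ulaw : unif_rv Q U).
Hypothesis NUind : indep2 Q N (fun _ => True) U measurable.
Variables (lam : R) (kap : tree).
Hypotheses (lam0 : 0 < lam) (kap0 : forall x, (0 < kap x)%N).

Let idx := (seq nat + seq nat)%type.

Let fam (i : idx) : set (set Om) := match i with
  | inl u => [set E | exists S, E = N u @^-1` S]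
  | inr v => [set E | exists2 B, measurable B & E = U v @^-1` B] end.

Let famm i : fam i `<=` measurable.
Proof.
case: i => u E /=.
  move=> [S ->].
  rewrite (_ : _ @^-1` S = \bigcup_(k in S) (N u @^-1` [set k])); last first.
    by apply/seteqP; split => w /=; [move=> h; exists (N u w)|case=> k Sk ->].
  by apply: bigcup_measurable => k _; exact: Nlaw.1.
by move=> [B mB ->]; rewrite -[X in measurable X]setTI; exact: Ulaw.1.
Qed.

Let famI i : setI_closed (fam i).
Proof.
case: i => u E1 E2 /=.
  by move=> [S1 ->] [S2 ->]; exists (S1 `&` S2).
by move=> [B1 m1 ->] [B2 m2 ->]; exists (B1 `&` B2) => //; exact: measurableI.
Qed.

Let famT i : fam i setT.
Proof. by case: i => u /=; [exists setT|exists setT]. Qed.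

Let fam_ind (s : seq idx) (E : idx -> set Om) : uniq s ->
  (forall i, fam i (E i)) ->
  Q (\bigcap_(i in [set x | x \in s]) E i) = (\prod_(i <- s) Q (E i))%E.
Proof.
move=> us fE.
have [SN hN] : {S : seq nat -> set nat & forall u, E (inl u) = N u @^-1` S u}.
  by exists (fun u => projT1 (cid (fE (inl u)))) => u; case: cid.
have [SU hU] : {S : seq nat -> set R & forall u, measurable (S u) /\ E (inr u) = U u @^-1` S u}.
  by exists (fun u => projT1 (cid2 (fE (inr u)))) => u; case: cid2 => S ? ?.
pose F := pmap (fun i : idx => if i is inl u then Some u else None) s.
pose G := pmap (fun i : idx => if i is inr u then Some u else None) s.
have memF u : (u \in F) = (inl u \in s).
  by rewrite /F; elim: (s) => //= -[v|v] t IH; rewrite /= !inE ?IH.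
have memG u : (u \in G) = (inr u \in s).
  by rewrite /G; elim: (s) => //= -[v|v] t IH; rewrite /= !inE ?IH.
have uF : uniq F by apply: (pmap_uniq (g := inl)) => // -[].
have uG : uniq G by apply: (pmap_uniq (g := inr)) => // -[].
have -> : (\prod_(i <- s) Q (E i) = (\prod_(u <- F) Q (N u @^-1` SN u)) * \prod_(u <- G) Q (U u @^-1` SU u))%E.
  rewrite /F /G; elim: (s) => [|[v|v] t IH] /=; rewrite ?big_nil ?mule1 // !big_cons IH.
    by rewrite hN muleA.
  by rewrite (hU v).2 muleCA.
rewrite -NUind //; last by move=> v; exact: (hU v).1.
congr (Q _); apply/seteqP; split => w /=.
  move=> h; split => u /=; rewrite ?memF ?memG => /h; first by rewrite hN.
  by rewrite (hU u).2.
move=> [h1 h2] [u|u] us'; first by rewrite hN; apply: h1; rewrite /= memF.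
by rewrite (hU u).2; apply: h2; rewrite /= memG.
Qed.

(* Events determined by the offspring numbers of [u] and its descendants and
   the displacements of its strict descendants, resp. of [u] as well. *)
Let desc (u : seq nat) : set idx := [set i | match i with
  | inl v => exists s, v = s ++ u
  | inr v => exists2 s, s != [::] & v = s ++ u end].
Let desc' (u : seq nat) : set idx := [set i | match i with
  | inl v => exists s, v = s ++ u
  | inr v => exists s, v = s ++ u end].

Let sig (D : set idx) (E : set Om) := <<s cylinder fam D >> E.

Let sigT D := g_sigma_algebraType (cylinder fam D).

Let sig_measurable D E : sig D E -> measurable E.
Proof. exact: (sigma_cylinder_measurable famm). Qed.

Let step_sig x v (E : seq nat -> set Om) : (forall y, sig (desc v) (E y)) ->
  sig (desc' v) [set w | E (bstep lam kap x (U v w)) w].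
Proof.
move=> sE.
have -> : [set w | E (bstep lam kap x (U v w)) w] = \bigcup_(y in [set` neighbors kap x])
    (U v @^-1` [set r | bstep lam kap x r = y] `&` E y).
  apply/seteqP; split => w /=.
    by move=> h; exists (bstep lam kap x (U v w)) => //=; exact: bstep_neighbors.
  by move=> [y _ [/= ->]].
apply: (@fin_bigcup_measurable _ (sigT (desc' v))) => // y yn.
apply: (@measurableI _ (sigT (desc' v))).
  apply: (cylinder1 famT (i := inr v)); first by exists [::].
  by exists [set r | bstep lam kap x r = y] => //; exact: (bstep_prob lam0 kap0 yn).1.
apply: sigma_cylinderS (sE y) => -[u|u] /=; first by [].
by move=> [s _ ->]; exists s.
Qed.

(** The displacement of [v] is independent of all that happens to its descendants; splitting
    according to the neighbor chosen gives the walk operator. *)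
Let step_prob x v (E : seq nat -> set Om) : (forall y, sig (desc v) (E y)) ->
  fine (Q [set w | E (bstep lam kap x (U v w)) w]) =
  walk lam kap (fun y => fine (Q (E y))) x.
Proof.
move=> sE; have mE y := sig_measurable (sE y).
pose B y := U v @^-1` [set r | bstep lam kap x r = y].
have mB y : y \in neighbors kap x -> measurable (B y).
  move=> yn; rewrite -[X in measurable X]setTI; apply: Ulaw.1 => //.
  exact: (bstep_prob lam0 kap0 yn).1.
have -> : [set w | E (bstep lam kap x (U v w)) w] = \bigcup_(y in [set` neighbors kap x]) (B y `&` E y).
  apply/seteqP; split => w /=.
    by move=> h; exists (bstep lam kap x (U v w)) => //=; exact: bstep_neighbors.
  by move=> [y _ [/= ->]].
rewrite measure_fin_bigcup //; last 2 first.
- by move=> y1 y2 _ _ [w [[/= <- _] [/= <- _]]].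
- by move=> y yn; apply: measurableI => //; exact: mB.
rewrite -fsbig_seq ?neighbors_uniq //.
rewrite (walk_neighbors lam kap).
have -> : (\sum_(y <- neighbors kap x) Q (B y `&` E y) =
    (\sum_(y <- neighbors kap x) stepw lam kap x y * fine (Q (E y)))%:E)%E.
  rewrite -sumEFin !big_seq; apply: eq_bigr => y yn.
  have -> : Q (B y `&` E y) = (Q (B y) * Q (E y))%E.
    apply: (cylinder_indep famm famI famT fam_ind (D1 := [set inr v]) (D2 := desc v)).
    - rewrite -subset0 => i [/= ->] [s s0 /(congr1 size)] /eqP.
      by rewrite size_cat -[X in X == _]add0n eqn_add2r eq_sym size_eq0 (negPf s0).
    - apply: (cylinder1 famT (i := inr v)) => //.
      by exists [set r | bstep lam kap x r = y] => //; exact: (bstep_prob lam0 kap0 yn).1.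
    - exact: sE.
  rewrite EFinM fineK ?fin_num_measure //; congr (_ * _)%E.
  rewrite -(bstep_prob lam0 kap0 yn).2; apply: Ulaw.2.
  exact: (bstep_prob lam0 kap0 yn).1.
- by [].
- exact: finite_seq.
Qed.

Let branch_sig u (E : nat -> set Om) : (forall i, sig (desc' (i :: u)) (E i)) ->
  sig (desc u) [set w | forall i, (i < N u w)%N -> E i w].
Proof.
move=> sE.
have -> : [set w | forall i, (i < N u w)%N -> E i w] =
    \bigcup_k (N u @^-1` [set k] `&` \bigcap_(i in [set i | (i < k)%N]) E i).
  apply/seteqP; split => w /=; first by move=> h; exists (N u w) => //; split.
  by move=> [k _ [/= -> h]].
apply: (@bigcupT_measurable _ (sigT (desc u))) => k.
apply: (@measurableI _ (sigT (desc u))).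
  by apply: (cylinder1 famT (i := inl u)); [exists [::]|exists [set k]].
apply: (@fin_bigcap_measurable _ (sigT (desc u))) => [|i _]; first exact: finite_II.
apply: sigma_cylinderS (sE i) => -[v|v] /= [s ->].
  by exists (rcons s i); rewrite cat_rcons.
by exists (rcons s i); rewrite ?cat_rcons //; case: s.
Qed.

Hypothesis hmu : prob_nat mu.

(** The events of different children use disjoint sets of labels, none of them containing the
    offspring number of [u]. So they are independent with common probability [s], and summing over
    the number of children gives [pgf]. *)
Let branch_prob u (E : nat -> set Om) (s : R) : (forall i, sig (desc' (i :: u)) (E i)) ->
  (forall i, fine (Q (E i)) = s) ->
  fine (Q [set w | forall i, (i < N u w)%N -> E i w]) = pgf mu s.
Proof.
move=> sE Es; have mE i := sig_measurable (sE i).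
have s01 : 0 <= s <= 1.
  rewrite -(Es 0%N) fine_ge0 //= -lee_fin fineK ?fin_num_measure //.
  exact: probability_le1.
pose C k := \bigcap_(i in [set i | (i < k)%N]) E i.
pose Dk (k : nat) : set idx := [set i | exists2 j, (j < k)%N & desc' (j :: u) i].
have sC k : sig (Dk k) (C k).
  apply: (@fin_bigcap_measurable _ (sigT (Dk k))) => [|i ik]; first exact: finite_II.
  by apply: sigma_cylinderS (sE i) => j ji; exists i.
have mC k := sig_measurable (sC k).
have headE i j s1 s2 : s1 ++ i :: u = s2 ++ j :: u :> seq nat -> i = j.
  move=> e; have := congr1 (fun t => nth 0%N (rev t) (size u)) e.
  by rewrite !rev_cat !rev_cons !nth_cat !size_rcons size_rev ltnSn !nth_rcons size_rev ltnn eqxx.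
have QC k : Q (C k) = (s ^+ k)%:E.
  elim: k => [|k IH].
    rewrite /C expr0 (_ : \bigcap_(i in _) E i = setT) ?probability_setT //.
    by apply/seteqP; split => // w _ i.
  have -> : C k.+1 = C k `&` E k.
    apply/seteqP; split => w /=.
      by move=> h; split=> [i /= ik|]; apply: h => //=; exact: ltnW.
    move=> [h1 h2] i /=; rewrite ltnS leq_eqVlt => /orP[/eqP ->//|]; exact: h1.
  rewrite (cylinder_indep famm famI famT fam_ind (D1 := Dk k) (D2 := desc' (k :: u))) //.
    by rewrite IH exprSr EFinM -(Es k) fineK // fin_num_measure.
  - rewrite -subset0 => -[v|v] [[j jk /= [s1 ->]]] [s2 /headE e]; by rewrite e ltnn in jk.
  - exact: sC.
  - exact: sE.
have -> : [set w | forall i, (i < N u w)%N -> E i w] =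
    \bigcup_k (N u @^-1` [set k] `&` C k).
  apply/seteqP; split => w /=; first by move=> h; exists (N u w) => //; split.
  by move=> [k _ [/= -> h]].
have mN k : measurable (N u @^-1` [set k]) by exact: Nlaw.1.
rewrite measure_semi_bigcup //; last 3 first.
- by move=> k; exact: measurableI.
- by move=> i j _ _ [w [[/= <- _] [/= <- _]]].
- by apply: bigcupT_measurable => k; exact: measurableI.
rewrite (_ : (\sum_(k <oo) _)%E = (pgf mu s)%:E) //.
transitivity (\sum_(k <oo) (mu k * s ^+ k)%:E)%E.
  apply: eq_eseriesr => k _.
  have e : Q (N u @^-1` [set k] `&` C k) = (Q (N u @^-1` [set k]) * Q (C k))%E.
    apply: (cylinder_indep famm famI famT fam_ind (D1 := [set inl u]) (D2 := Dk k)).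
    - rewrite -subset0 => i [/= ->] [j jk /= [t /(congr1 size)]] /eqP.
      by rewrite size_cat /= addnS -addSn -[X in X == _]add0n eqn_add2r.
    - by apply: (cylinder1 famT (i := inl u)) => //; exists [set k].
    - exact: sC.
  by apply: (etrans e); rewrite QC EFinM Nlaw.2.
apply: cvg_lim => //.
rewrite (_ : (fun n => _) = EFin \o (fun n => \sum_(k < n) mu k * s ^+ k)); last first.
  by apply/funext => n; rewrite /= sumEFin big_mkord.
by apply: cvg_EFin; [exact: nearW|exact: pgf_cvg].
Qed.

(** [x] is a position imposed on particle [u], which makes the recursion parallel to that of [fail];
    the actual position is substituted later. *)
Fixpoint extinct (n : nat) (A : nat -> seq nat -> bool) (u x : seq nat) : set Om :=
  match n with
  | 0 => [set _ | ~~ A 0%N x]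
  | n'.+1 => if A 0%N x then
      [set w | forall i, (i < N u w)%N ->
        extinct n' (fun j => A j.+1) (i :: u) (bstep lam kap x (U (i :: u) w)) w]
      else setT
  end.

Let extinct_sig n A u x : sig (desc u) (extinct n A u x).
Proof.
elim: n A u x => [|n IH] A u x /=; first exact: (@measurable_cst_prop _ (sigT _)).
case: ifP => _; last exact: (@measurableT _ (sigT _)).
apply: (branch_sig (E := fun i => [set w | extinct n (fun j => A j.+1) (i :: u)
  (bstep lam kap x (U (i :: u) w)) w])) => i.
exact: (step_sig _ (E := extinct n (fun j => A j.+1) (i :: u))).
Qed.

Lemma measurable_extinct n A u x : measurable (extinct n A u x).
Proof. exact: (sig_measurable (@extinct_sig n A u x)). Qed.

Lemma extinct_prob n A u x : fine (Q (extinct n A u x)) = fail mu lam kap n A x.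
Proof.
elim: n A u x => [|n IH] A u x /=.
  case: (A 0%N x) => /=.
    by rewrite (_ : [set _ | _] = set0) ?measure0 //; apply/seteqP; split.
  by rewrite (_ : [set _ | _] = setT) ?probability_setT //; apply/seteqP; split.
case: ifP => _; last by rewrite probability_setT.
apply: (branch_prob (E := fun i => [set w | extinct n (fun j => A j.+1) (i :: u)
  (bstep lam kap x (U (i :: u) w)) w])) => i.
  exact: (step_sig _ (E := extinct n (fun j => A j.+1) (i :: u))).
rewrite (step_prob _ (E := extinct n (fun j => A j.+1) (i :: u))) //.
by apply: op_ext => y; exact: IH.
Qed.

(** Along the labels made of zeros only displacements enter, so this is an event about a single
    walk, whatever the offspring numbers. It identifies [walkn] with the law of the biased walk. *)
Fixpoint ray (h n : nat) (u x : seq nat) : set Om :=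
  if n is n'.+1 then
    [set w | ray h n' (0%N :: u) (bstep lam kap x (U (0%N :: u) w)) w]
  else [set _ | (h <= size x)%N].

Let ray_sig h n u x : sig (desc u) (ray h n u x).
Proof.
elim: n u x => [|n IH] u x /=; first exact: (@measurable_cst_prop _ (sigT _)).
have := step_sig x (E := ray h n (0%N :: u)) (v := 0%N :: u) (IH _).
apply: sigma_cylinderS => -[v|v] /= [s ->].
  by exists (rcons s 0%N); rewrite cat_rcons.
by exists (rcons s 0%N); rewrite ?cat_rcons //; case: s.
Qed.

Lemma ray_prob h n u x : fine (Q (ray h n u x)) = walkn lam kap n (above h) x.
Proof.
elim: n u x => [|n IH] u x /=.
  rewrite /above; case: (h <= size x)%N.
    by rewrite (_ : [set _ | _] = setT) ?probability_setT //; apply/seteqP; split.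
  by rewrite (_ : [set _ | _] = set0) ?measure0 //; apply/seteqP; split.
rewrite (step_prob _ (E := ray h n (0%N :: u))) //.
by apply: op_ext => y; exact: IH.
Qed.

End particle_system.

(** * Bounds on the maximum *)

Section geometric_borel_cantelli.
Context {R : realType} {d : measure_display} {T : measurableType d}.
Variable Q : probability T R.

Lemma geometric_borel_cantelli (E : nat -> set T) (A r : R) (J : nat) :
  0 <= A -> 0 <= r < 1 -> (forall j, measurable (E j)) ->
  (forall j, (J <= j)%N -> fine (Q (E j)) <= A * r ^+ j) ->
  {ae Q, forall w, \forall j \near \oo, ~ E j w}.
Proof.
move=> A0 /andP[r0 r1] mE hE.
pose F j := E (j + J)%N; have mF j : measurable (F j) by exact: mE.
have QF0 : Q (lim_sup_set F) = 0%E.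
  apply: lim_sup_set_cvg0 => //.
  apply: (@le_lt_trans _ _ (\sum_(j <oo) (geometric (A * r ^+ J) r j)%:E)%E).
    apply: lee_nneseries => [j _ _|j _]; first exact: measure_ge0.
    rewrite -[leLHS]fineK ?fin_num_measure // lee_fin /=.
    apply: le_trans (hE _ (leq_addl _ _)) _.
    by rewrite exprD mulrA mulrAC.
  rewrite (_ : (\sum_(j <oo) _)%E = (A * r ^+ J * (1 - r)^-1)%:E) ?ltry //.
  apply: cvg_lim => //.
  rewrite (_ : (fun n => _) = EFin \o series (geometric (A * r ^+ J) r)); last first.
    by apply/funext => n; rewrite /= sumEFin.
  apply: cvg_EFin; first exact: nearW.
  by apply: cvg_geometric_series; rewrite ger0_norm.
exists (lim_sup_set F); split => //.
  by apply: bigcapT_measurable => n; apply: bigcup_measurable.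
move=> w /= nE n _; apply: contrapT => nF; apply: nE; exists (n + J)%N => // j /= nj Ej.
have Jj : (J <= j)%N by rewrite (leq_trans _ nj) // leq_addl.
apply: nF; exists (j - J)%N; first by rewrite /= leq_subRL // addnC.
by rewrite /F subnK.
Qed.

End geometric_borel_cantelli.

Section maximum.
Context {R : realType}.
Context {d : measure_display} {Om : measurableType d} (Q : probability Om R).
Variables (N : seq nat -> Om -> nat) (U : seq nat -> Om -> R) (mu : nat -> R).
Hypotheses (Nlaw : nat_rv_law Q N mu) (Ulaw : unif_rv Q U).
Hypothesis NUind : indep2 Q N (fun _ => True) U measurable.
Hypotheses (hmu : prob_nat mu) (mu0 : mu 0%N = 0).
Variables (lam : R) (kap : tree).
Hypotheses (lam0 : 0 < lam) (kap0 : forall x, (0 < kap x)%N).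

Local Notation pos := (brw_pos lam kap U).
Local Notation M := (brw_max lam kap N U).
Local Notation ext := (extinct N U lam kap).

Lemma gen_level n w : gen N n w = level (N^~ w) n.
Proof. by elim: n => //= n ->. Qed.

Lemma vert_cat (ka : tree) s u : vert ka (s ++ u) -> vert ka u.
Proof. by elim: s => //= i s IH /andP[_]. Qed.

Lemma alive_path n A u w : vert (N^~ w) u -> ~ ext n A u (pos u w) w ->
  exists2 v, v \in gen N (n + size u) w & A n (pos v w).
Proof.
elim: n A u => [|n IH] A u vu /=.
  move=> /negP; rewrite negbK => Au; exists u => //.
  by rewrite gen_level mem_level.
case: ifP => [_|_ []//] /existsNP[i /not_implyP[iu]] al.
have [|v vg Av] := IH (fun j => A j.+1) (i :: u) _ al; first by rewrite /= iu.
by exists v => //; move: vg; rewrite /= addnS.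
Qed.

Lemma path_alive n (H : R) u s w : vert (N^~ w) (s ++ u) -> size s = n ->
  H <= (size (pos (s ++ u) w))%:R -> ~ ext n (final n H) u (pos u w) w.
Proof.
elim: n u s => [|n IH] u s vs sn Hs /=.
  by case: s sn vs Hs => // _ _ /= Hs; rewrite /final /= Hs.
case/lastP: s sn vs Hs => // s i; rewrite size_rcons cat_rcons => -[sn] vs Hs.
move=> /(_ i) ex; apply: (IH (i :: u) s vs sn Hs); move: ex; rewrite finalS; apply.
by have /= /andP[] := vert_cat vs.
Qed.

Lemma max_lt_extinct n (H : R) w : (M n w)%:R < H -> ext n (final n H) [::] [::] w.
Proof.
move=> MH; apply: contrapT => al.
have [//|v vg] := alive_path (u := [::]) (w := w) _ al.
rewrite addn0 in vg; rewrite /final eqxx /= leNgt => /negP; apply.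
apply: le_lt_trans MH; rewrite ler_nat.
exact: (leq_bigmax_seq (F := fun u => size (pos u w)) v vg).
Qed.

Lemma max_ge_alive n (H : R) w : 0 < H -> H <= (M n w)%:R -> ~ ext n (final n H) [::] [::] w.
Proof.
move=> H0 HM.
have [v vg Hv] : exists2 v, v \in gen N n w & H <= (size (pos v w))%:R.
  apply: contrapT => no; move: HM; rewrite leNgt => /negP; apply.
  rewrite /brw_max big_seq; elim/big_ind: _ => //= [x y xH yH|v vg].
    by rewrite /maxn; case: ifP.
  by rewrite ltNge; apply/negP => Hv; apply: no; exists v.
move: vg; rewrite gen_level => vg.
have := path_alive (u := [::]) (s := v); rewrite cats0; apply => //.
  exact: vert_level vg.
exact: level_size vg.
Qed.

Lemma size_pos v w : (size (pos v w) <= size v)%N.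
Proof.
elim: v => [|i v IH] //=; rewrite /bstep; case: (pos v w) IH => [|j x] //= IH.
by case: ifP => _ //=; rewrite ltnW // (leq_trans IH).
Qed.

Lemma max_le_time n w : (M n w <= n)%N.
Proof.
apply/bigmax_leqP_seq => v; rewrite gen_level => /level_size <- _; exact: size_pos.
Qed.

Lemma max_step n w : (M n.+1 w <= (M n w).+1)%N.
Proof.
apply/bigmax_leqP_seq => v; rewrite gen_level /= => /flattenP[_ /mapP[u ul ->]] /mapP[i _ ->] _ /=.
have : (size (pos u w) <= M n w)%N.
  by apply: (leq_bigmax_seq (F := fun u => size (pos u w)) u) => //; rewrite gen_level.
rewrite /bstep; case: (pos u w) => [|j x] //= h.
by case: ifP => _ //=; rewrite ltnW // (leq_trans h).
Qed.

Lemma extinctS n A u x w : ext n A u x w -> ext n.+1 A u x w.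
Proof.
have extE k B v y : ext k.+1 B v y = if B 0%N y then
    [set w | forall i, (i < N v w)%N ->
      ext k (fun j => B j.+1) (i :: v) (bstep lam kap y (U (i :: v) w)) w] else setT by [].
elim: n A u x => [|n IH] A u x; first by rewrite extE /= => /negbTE ->.
rewrite !(extE _ A); case: ifP => // _ h i iN.
exact: IH (h i iN).
Qed.


Lemma max_ge_barrier n (a C : R) w : ~ ext n (barrier a (- C)) [::] [::] w ->
  a * n%:R - C <= (M n w)%:R.
Proof.
move=> al; have [//|v vg Av] := alive_path (u := [::]) (w := w) _ al.
rewrite addn0 in vg; move: Av; rewrite /barrier addrC => /le_trans; apply.
rewrite ler_nat; exact: (leq_bigmax_seq (F := fun u => size (pos u w)) v vg).
Qed.

(** Extinction events increase with the generation, so the event of ever becoming extinct below the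
    barrier shifted by [C j] has probability at most [1 / (j + 1)]; almost surely some shift is
    survived forever. *)
Lemma persistent_max (a : R) :
  (forall eta, 0 < eta -> exists C : R, forall n, fail mu lam kap n (barrier a (- C)) [::] <= eta) ->
  {ae Q, forall w, exists C : R, forall n, a * n%:R - C <= (M n w)%:R}.
Proof.
move=> small.
have [C hC] : {C : nat -> R & forall j n, fail mu lam kap n (barrier a (- C j)) [::] <= j.+1%:R^-1}.
  have h (j : nat) : exists C : R, forall n, fail mu lam kap n (barrier a (- C)) [::] <= j.+1%:R^-1.
    by apply: small; rewrite invr_gt0.
  by exists (fun j => projT1 (cid (h j))) => j; case: cid.
pose E j n := ext n (barrier a (- C j)) [::] [::].
have mE j n : measurable (E j n) by exact: (measurable_extinct Nlaw Ulaw lam0 kap0).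
pose B := \bigcap_j \bigcup_n E j n.
have mU j : measurable (\bigcup_n E j n) by exact: bigcupT_measurable.
exists B; split; first exact: bigcapT_measurable.
  apply/eqP; rewrite eq_le measure_ge0 andbT; apply/lee_addgt0Pr => e e0; rewrite add0e.
  have [j je] : exists j : nat, (j.+1%:R^-1 <= e)%R.
    have [n _ hn] := near_infty_natSinv_lt (PosNum e0).
    by exists n; apply/ltW/(hn n) => /=.
  apply: (@le_trans _ _ (Q (\bigcup_n E j n))).
    apply: le_measure; rewrite ?inE //; first exact: bigcapT_measurable.
    by move=> w /(_ j I).
  apply: (@le_trans _ _ (j.+1%:R^-1)%:E); last by rewrite lee_fin.
  apply: probability_bigcup_le => // [n m nm w|n].
    elim: m nm => [|m IH]; first by rewrite leqn0 => /eqP ->.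
    rewrite leq_eqVlt => /orP[/eqP -> //|]; rewrite ltnS => /IH h /h.
    exact: extinctS.
  rewrite -[leLHS]fineK ?fin_num_measure // lee_fin.
  by rewrite (extinct_prob Nlaw Ulaw NUind lam0 kap0 hmu).
move=> w /= nw j _; apply: contrapT => nE; apply: nw; exists (C j) => n.
by apply: max_ge_barrier => Ew; apply: nE; exists n.
Qed.

End maximum.

Section maximum_bounds.
Context {R : realType}.
Context {d : measure_display} {Om : measurableType d} (Q : probability Om R).
Variables (N : seq nat -> Om -> nat) (U : seq nat -> Om -> R) (mu : nat -> R).
Hypotheses (Nlaw : nat_rv_law Q N mu) (Ulaw : unif_rv Q U).
Hypothesis NUind : indep2 Q N (fun _ => True) U measurable.
Hypotheses (hmu : prob_nat mu) (mu0 : mu 0%N = 0).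
Variables (lam : R) (kap : tree).
Hypotheses (lam0 : 0 < lam) (kap0 : forall x, (0 < kap x)%N).

Local Notation pos := (brw_pos lam kap U).
Local Notation M := (brw_max lam kap N U).
Local Notation ext := (extinct N U lam kap).

Lemma max_le_shift n n' w : (n <= n')%N -> (M n' w <= M n w + (n' - n))%N.
Proof.
elim: n' => [|n' IH]; first by rewrite leqn0 => /eqP ->; rewrite addn0.
rewrite leq_eqVlt => /orP[/eqP ->|]; first by rewrite subnn addn0.
rewrite ltnS => nn; apply: leq_trans (max_step _ _ _ _ _ _) _.
by rewrite subSn // addnS ltnS IH.
Qed.

Lemma max_from_decay (a b C A r : R) (n0 L0 : nat) : 0 <= b -> b < a ->
  0 <= A -> 0 <= r < 1 ->
  (forall L n1, (L0 <= L)%N -> (n0 <= n1)%N ->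
      1 - reach mu lam kap (a * n1%:R - C) (n1 + L * L.+1) [::] <= A * r ^+ L) ->
  {ae Q, forall w, \forall n \near \oo, b * n%:R <= (M n w)%:R}.
Proof.
move=> b0 ba A0 r01 hL; have a0 : 0 < a by exact: le_lt_trans ba.
pose D := (Num.truncn (2 * a / (a - b))).+1.
pose hz L := (D * (L * L.+1) + L * L.+1)%N.
pose H L : R := a * (D * (L * L.+1))%:R - C.
pose E L := ext (hz L) (final (hz L) (H L)) [::] [::].
have mE L : measurable (E L) by exact: (measurable_extinct Nlaw Ulaw lam0 kap0).
have QE L : (maxn L0 n0 <= L)%N -> fine (Q (E L)) <= A * r ^+ L.
  rewrite geq_max => /andP[LL nL].
  rewrite (extinct_prob Nlaw Ulaw NUind lam0 kap0 hmu).
  have := hL L (D * (L * L.+1))%N LL; rewrite /reach /surv subKr; apply.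
  apply: (leq_trans nL); apply: (leq_trans (leq_pmulr L (ltn0Sn L))).
  exact: leq_pmull.
have := geometric_borel_cantelli A0 r01 mE QE; apply: filterS => w [J _ hJ].
have HM L : (J <= L)%N -> H L <= (M (hz L) w)%:R.
  move=> /hJ nE; rewrite leNgt; apply/negP => /max_lt_extinct; exact: nE.
have ab0 : 0 < a - b by rewrite subr_gt0.
pose e := (a - b) / 4; have e0 : 0 < e by rewrite divr_gt0.
pose J' := maxn J (maxn (Num.truncn (2 / e)).+2 (Num.truncn (`|C| / e)).+2).
exists (hz J').+1 => // n /= nJ.
have ex : exists L, (n <= hz L)%N.
  exists n; rewrite /hz; apply: (leq_trans _ (leq_addl _ _)).
  by rewrite leq_pmulr.
case: (ex_minnP ex) => L nL minL.
have JL : (J' < L)%N.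
  rewrite ltnNge; apply/negP => LJ; move: nJ; rewrite ltnNge => /negP; apply.
  apply: (leq_trans nL); rewrite /hz -!mulSnr.
  by rewrite leq_pmul2l // leq_mul.
case: L nL minL JL => // L nL minL JL.
have nL' : (hz L < n)%N.
  by rewrite ltnNge; apply/negP => /minL; rewrite ltnn.
have := HM L.+1 (leq_trans (leq_maxl _ _) (ltnW JL)).
have := max_le_shift w nL; rewrite -(ler_nat R) natrD natrB //.
rewrite /H; move: (M n w)%:R (M (hz L.+1) w)%:R => x y xy Hy.
have D0 : 0 < D%:R + 1 :> R by rewrite natr1 ltr0n.
have hzE l : (hz l)%:R = (D%:R + 1) * (l%:R * (l%:R + 1)) :> R.
  by rewrite /hz natrD !natrM -[l.+1%:R]natr1; ring.
have aD : a / (D%:R + 1) <= (a - b) / 2.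
  have : 2 * a / (a - b) <= D%:R + 1.
    by rewrite (le_trans (ltW (truncnS_gt _))) // lerDl.
  rewrite !ler_pdivrMr // => h; apply: le_trans (_ : 2 * a / 2 <= _); first by rewrite mulrAC divff ?mul1r.
  by move: h; lra.
have l0 : 2 / e <= L%:R.
  apply: (@le_trans _ _ (Num.truncn (2 / e)).+1%:R); first exact/ltW/truncnS_gt.
  rewrite ler_nat -ltnS; apply: leq_trans JL; apply: leqW.
  by rewrite /J' !leq_max leqnn !orbT.
have lC : `|C| / e <= L%:R.
  apply: (@le_trans _ _ (Num.truncn (`|C| / e)).+1%:R); first exact/ltW/truncnS_gt.
  rewrite ler_nat -ltnS; apply: leq_trans JL; apply: leqW.
  by rewrite /J' !leq_max leqnn !orbT.
have nT : n%:R <= (hz L.+1)%:R :> R by rewrite ler_nat.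
have Tn : (hz L)%:R <= n%:R :> R by rewrite ler_nat ltnW.
have L0' : 0 <= L%:R :> R by [].
have eL : 2 <= e * L%:R by rewrite mulrC -ler_pdivrMr.
have eC : C <= e * L%:R.
  by apply: le_trans (ler_norm C) _; rewrite mulrC -ler_pdivrMr.
have T1 : (hz L.+1)%:R = (D%:R + 1) * ((L%:R + 1) * (L%:R + 2)) :> R.
  by rewrite hzE -natr1; ring.
have HE : a * (D * (L.+1 * L.+2))%:R = a * (hz L.+1)%:R - a / (D%:R + 1) * (hz L.+1)%:R :> R.
  rewrite T1 !natrM -[L.+2%:R]natr1 -[L.+1%:R]natr1; field; rewrite gt_eqF //.
have T2 := hzE L.
have Dr1 : 1 <= D%:R + 1 :> R by rewrite lerDr.
have h1 : a / (D%:R + 1) * (hz L.+1)%:R <= (a - b) / 2 * (hz L.+1)%:R by rewrite ler_wpM2r.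
have h2 : b * n%:R <= b * (hz L.+1)%:R by rewrite ler_wpM2l.
have h3 : (hz L.+1)%:R - (hz L)%:R <= e * (hz L.+1)%:R.
  rewrite T1 T2 (_ : _ - _ = (D%:R + 1) * (L%:R + 1) * 2); last by ring.
  rewrite (_ : e * _ = (D%:R + 1) * (L%:R + 1) * (e * (L%:R + 2))); last by ring.
  rewrite ler_wpM2l ?mulr_ge0 ?(ltW D0) ?addr_ge0 // mulrDr.
  by move: eL e0; lra.
have h4 : e * L%:R <= e * (hz L.+1)%:R.
  by rewrite ler_wpM2l ?(ltW e0) // T1; move: Dr1 L0'; nra.
move: HE h1 h2 h3 h4 xy Hy Tn eC; rewrite /e.
move: (hz L.+1)%:R (hz L)%:R (a * (D * (L.+1 * L.+2))%:R) => t1 t2 z; nra.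
Qed.

Lemma reach_first_moment (m : R) (h n : nat) x :
  (fun n => \sum_(k < n) k%:R * mu k) @ \oo --> m -> 0 <= m ->
  reach mu lam kap h%:R n x <= m ^+ n * walkn lam kap n (above h) x.
Proof.
move=> hm m0; elim: n x => [|n IH] x.
  by rewrite expr0 mul1r /reach /surv /= /final eqxx /= ler_nat /above; case: (h <= size x)%N; rewrite /= ?subr0 ?subrr.
have W01 : 0 <= walk lam kap (reach mu lam kap h%:R n) x <= 1.
  by rewrite walk_ge0 ?walk_le_cst // => y; case/andP: (reach01 hmu lam0 kap0 h%:R n y).
rewrite reachS //; apply: le_trans (pgf_compl_le hmu hm W01) _.
rewrite exprS -mulrA ler_wpM2l //= /walk -opZ; exact: walk_le.
Qed.

(** As [Ia = ln m + 2 * dl], the first moment [m ^+ n * tail] is at most [expR (- dl * n)] for large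
    [n], and Borel-Cantelli applies. *)
Lemma max_eventually_lt (m a Ia : R) :
  (fun n => \sum_(k < n) k%:R * mu k) @ \oo --> m -> 1 < m -> 0 < a -> ln m < Ia ->
  (fun n => ln (tail lam kap n (ceiln (a * n%:R))) / n%:R) @ \oo --> - Ia ->
  {ae Q, forall w, \forall n \near \oo, (M n w)%:R < a * n%:R}.
Proof.
move=> hm m1 a0 mI ldp; have m0 : 0 < m by exact: lt_trans m1.
pose dl := (Ia - ln m) / 2; have dl0 : 0 < dl by rewrite divr_gt0 // subr_gt0.
pose E n := ~` ext n (final n ((ceiln (a * n%:R))%:R : R)) [::] [::].
have mext n (H : R) : measurable (ext n (final n H) [::] [::]).
  exact: (measurable_extinct Nlaw Ulaw lam0 kap0).
have mE n : measurable (E n) by apply: measurableC.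
have /cvgrPdist_lt /(_ _ dl0)[J _ hJ] := ldp.
have QE n : (J.+1 <= n)%N -> fine (Q (E n)) <= 1 * expR (- dl) ^+ n.
  move=> Jn; have n0 : 0 < n%:R :> R by rewrite ltr0n (leq_ltn_trans _ Jn).
  have -> : fine (Q (E n)) = reach mu lam kap (ceiln (a * n%:R))%:R n [::].
    rewrite /reach /surv -(extinct_prob Nlaw Ulaw NUind lam0 kap0 hmu n _ [::]) /E.
    by rewrite probability_setC // fineB ?fin_num_measure.
  apply: le_trans (reach_first_moment _ _ _ hm (ltW m0)) _.
  rewrite mul1r -/(tail lam kap n (ceiln (a * n%:R))).
  have t0 : 0 <= tail lam kap n (ceiln (a * n%:R)).
    by apply: walkn_ge0 => // y; case/andP: (above01 (R := R) (ceiln (a * n%:R)) y).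
  have := hJ n (ltnW Jn); rewrite /= ltr_norml => /andP[h _].
  move: t0 h; set t := tail _ _ _ _ => t0 h.
  (* [ln 0] is 0 by convention, so the convergence of the logarithms says nothing about a vanishing
     tail. *)
  have [t00|t00] := eqVneq t 0.
    by rewrite t00 mulr0 exprn_ge0 // expR_ge0.
  have {}t0 : 0 < t by rewrite lt_neqAle eq_sym t00.
  rewrite -(lnK (_ : m \in Num.pos)) ?posrE // -[t]lnK ?posrE // -!expRM_natl -expRD ler_expR.
  have : ln t <= n%:R * (- Ia + dl).
    by rewrite mulrC -ler_pdivrMr //; move: h; lra.
  rewrite (_ : Ia = ln m + 2 * dl); last by rewrite /dl; field.
  by move: (n%:R) (ln m) (ln t) => x y z; lra.
have e01 : 0 <= expR (- dl) < 1 by rewrite expR_ge0 expR_lt1 oppr_lt0.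
have := geometric_borel_cantelli ler01 e01 mE QE; apply: filterS => w [J' _ hJ'].
exists J'.+1 => // n /= Jn; rewrite ltNge; apply/negP => Mn.
have n0 : 0 < n%:R :> R by rewrite ltr0n (leq_ltn_trans _ Jn).
have an : 0 < a * n%:R by rewrite mulr_gt0.
apply: (hJ' n (ltnW Jn)); apply: max_ge_alive.
  exact: (lt_le_trans an (ceiln_ge (ltW an))).
by rewrite ler_nat ceiln_le // ltW.
Qed.

Lemma max_ge_ray n w : (forall u, 0 < N u w)%N ->
  (size (pos (nseq n 0%N) w) <= M n w)%N.
Proof.
move=> N0; apply: (leq_bigmax_seq (F := fun u => size (pos u w)) (nseq n 0%N)) => //.
rewrite gen_level -{2}(size_nseq n 0%N); apply: mem_level.
by elim: n => //= n ->; rewrite N0.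
Qed.

(** The lineage of first children performs a biased walk, which connects the branching system with
    what is assumed about single walks. *)
Lemma bwalk_ray n w :
  bwalk lam kap (fun n => U (nseq n.+1 0%N)) n w = pos (nseq n 0%N) w.
Proof. by elim: n => //= n ->. Qed.

Lemma indep_ray : indep1 Q (fun n => U (nseq n.+1 0%N)) measurable.
Proof.
move=> F SA uF mS.
have := @NUind [::] (map (fun n => nseq n.+1 0%N) F) (fun=> setT) (fun u => SA (size u).-1).
have inj : injective (fun n => nseq n.+1 0%N).
  by move=> i j /(congr1 size); rewrite !size_nseq => -[].
rewrite map_inj_uniq // => /(_ isT uF (fun=> I) (fun=> mS _)).
rewrite big_nil mul1e big_map; under [in RHS]eq_bigr do rewrite size_nseq.
move=> <-; congr (Q _); apply/seteqP; split => w /=.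
  move=> h; split => // _ /mapP[n nF ->].
  by rewrite [size _]/= size_nseq; exact: h.
move=> [_ h] n nF; have := h (nseq n.+1 0%N); rewrite /= size_nseq; apply.
exact: (map_f (fun n => nseq n.+1 0%N)).
Qed.

Lemma ray_event h n u w : ray U lam kap h n u (pos u w) w = (h <= size (pos (nseq n 0%N ++ u) w))%N.
Proof.
elim: n u => [//|n IH] u.
rewrite -[LHS]/(ray U lam kap h n (0%N :: u) (pos (0%N :: u) w) w) IH -cat_rcons.
suff -> : rcons (nseq n 0%N) 0%N = nseq n.+1 0%N by [].
by elim: n {IH} => //= n ->.
Qed.

(** The bound 2 never binds, since the walk rises by at most one level per step. *)
Lemma ldp_of_walk (y Iy : R) : 0 < y ->
  (fun n => ln (fine (Q [set w | y <= (size (bwalk lam kap (fun n => U (nseq n.+1 0%N)) n w))%:R / n%:R < (2 : R)]))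
    / n%:R) @ \oo --> - Iy ->
  (fun n => ln (tail lam kap n (ceiln (y * n%:R))) / n%:R) @ \oo --> - Iy.
Proof.
move=> y0; apply: cvg_trans; apply: near_eq_cvg; near=> n.
have n0 : 0 < n%:R :> R by rewrite ltr0n; near: n; exact: nbhs_infty_gt.
congr (ln _ / _); rewrite /tail -(ray_prob Nlaw Ulaw NUind lam0 kap0 _ n [::]); congr (fine (Q _)).
apply/seteqP; split => w /=; rewrite (ray_event _ _ [::]) cats0 bwalk_ray ceiln_le ?mulr_ge0 ?(ltW y0) // ler_pdivlMr //.
  by move=> /andP[].
move=> ->; rewrite ltr_pdivrMr // (@le_lt_trans _ _ n%:R) ?ltr_pMl ?ltr1n //.
by rewrite ler_nat (leq_trans (size_pos _ _ _ _ _)) // size_nseq.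
Unshelve. all: by end_near. Qed.

End maximum_bounds.

(** * From the one-sided bounds to the limit *)

Lemma ae_positive {R : realType} {d : measure_display} {Om : measurableType d}
    (P : probability Om R) (p : nat -> R) (K : seq nat -> Om -> nat) :
  nat_rv_law P K p -> p 0%N = 0 -> {ae P, forall w, forall u, (0 < K u w)%N}.
Proof.
move=> Klaw p0.
pose B n := if (unpickle n : option (seq nat)) is Some u then K u @^-1` [set 0%N] else set0.
have : {ae P, forall w, forall n, ~ B n w}.
  apply: ae_foralln => n; rewrite /B; case: unpickle => [u|]; last by apply: nearW => w [].

  exists (K u @^-1` [set 0%N]); split; first exact: Klaw.1.
    by apply: (etrans (Klaw.2 u 0%N)); rewrite p0.
  by move=> w /= /contrapT.
apply: filterS => w nB u; rewrite lt0n; apply/negP => /eqP Ku.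
by apply: (nB (pickle u)); rewrite /B pickleK.
Qed.

Section positive_offspring.
Context {R : realType} {d : measure_display} {Om : measurableType d}.
Variables (P : probability Om R) (p : nat -> R) (K : seq nat -> Om -> nat).
Hypothesis Klaw : nat_rv_law P K p.
Hypothesis p0 : p 0%N = 0.

(** A version of the offspring numbers that is positive everywhere, so that the statements about a
    fixed tree apply at every sample point; it agrees with [K] almost surely when [p 0 = 0]. *)
Definition pos_offspring (u : seq nat) (w : Om) : nat := maxn 1 (K u w).

Lemma pos_offspring_law : nat_rv_law P pos_offspring p.
Proof.
have e2 u k : pos_offspring u @^-1` [set k.+2] = K u @^-1` [set k.+2].
  by apply/seteqP; split => w /=; rewrite /pos_offspring; case: (K u w) => [|[|n]].
have e1 u : pos_offspring u @^-1` [set 1%N] = K u @^-1` [set 1%N] `|` K u @^-1` [set 0%N].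
  apply/seteqP; split => w /=; rewrite /pos_offspring; case: (K u w) => [|[|n]] //=;
    by [right|left|case].
have e0 u : pos_offspring u @^-1` [set 0%N] = set0.
  by apply/seteqP; split => w //=; rewrite /pos_offspring; case: (K u w) => [|[|n]].
split=> u [|[|k]].
- by rewrite e0.
- by rewrite e1; apply: measurableU; exact: Klaw.1.
- by rewrite e2; exact: Klaw.1.
- by rewrite e0 measure0 p0.
- have K0 : P (K u @^-1` [set 0%N]) = 0%E by apply: (etrans (Klaw.2 u 0%N)); rewrite p0.
  rewrite e1 measureU0; [exact: Klaw.2|exact: Klaw.1|exact: Klaw.1|exact: K0].
- by rewrite e2; exact: Klaw.2.
Qed.

Lemma pos_offspring_indep : indep1 P K (fun _ => True) ->
  indep1 P pos_offspring (fun _ => True).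
Proof.
move=> Kind F SA uF _; exact: (Kind F (fun u => [set k | SA u (maxn 1 k)]) uF (fun=> I)).
Qed.

End positive_offspring.

Lemma cvg_of_bounds {R : realType} (x : nat -> R) (l : R) :
  (forall e, 0 < e -> \forall n \near \oo, l - e < x n) ->
  (forall e, 0 < e -> \forall n \near \oo, x n < l + e) -> x @ \oo --> l.
Proof.
move=> lo up; apply/cvgrPdist_lt => e e0.
move: (lo e e0) (up e e0); apply: filterS2 => n h1 h2.
by rewrite distrC ltr_distl h1 h2.
Qed.

Section lower_speed.
Context {R : realType} {d : measure_display} {Om : measurableType d}.
Variables (P : probability Om R) (p : nat -> R) (K : seq nat -> Om -> nat).
Hypothesis Klaw : nat_rv_law P K p.
Hypothesis Kind : indep1 P K (fun _ => True).
Hypothesis K0 : forall u w, (0 < K u w)%N.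
Variable mB : R.
Hypothesis hmB : (fun n => \sum_(k < n) (k%:R * p k)) @ \oo --> mB.
Variables (mu : nat -> R) (lam m : R).
Hypotheses (hmu : prob_nat mu) (mu0 : mu 0%N = 0) (mu1 : mu 1%N < 1).
Hypothesis hm : (fun n => \sum_(k < n) k%:R * mu k) @ \oo --> m.
Hypotheses (m1 : 1 < m) (lam0 : 0 < lam).
Variables (v : R) (J : R -> R).
Hypothesis v0 : 0 <= v.
Hypothesis Jv : J v = 0.
Hypothesis Jpos : forall y, v < y <= 1 -> 0 < J y.
Hypothesis Jconv : forall a b t, v <= a <= 1 -> v <= b <= 1 -> 0 <= t <= 1 ->
  J (t * a + (1 - t) * b) <= t * J a + (1 - t) * J b.
Hypothesis ldp : {ae P, forall w, forall y : R, v < y <= 1 ->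
  (fun n => ln (tail lam (K^~ w) n (ceiln (y * n%:R))) / n%:R) @ \oo --> - J y}.

(** The gap between [b] and [a] absorbs the additive constants and, in the last case, the stretches
    between the times [hz L]. *)
Lemma max_eventually_ge (a b : R) : v < a <= 1 -> J a < ln m -> 0 <= b < a ->
  {ae P, forall w, forall (d' : measure_display) (Om' : measurableType d')
    (Q : probability Om' R) (N : seq nat -> Om' -> nat) (U : seq nat -> Om' -> R),
    nat_rv_law Q N mu -> unif_rv Q U -> indep2 Q N (fun _ => True) U measurable ->
    {ae Q, forall w', \forall n \near \oo, b * n%:R <= (brw_max lam (K^~ w) N U n w')%:R}}.
Proof.
move=> va Ja /andP[b0 ba].
have [cases|[v00 [eps eps0 dec]]] :
    (0 < v \/ forall eps, 0 < eps -> {ae P, forall w,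
      exists2 t, (0 < t)%N & expR (- (eps * t%:R)) <= loop lam (K^~ w) t}) \/
    (v = 0 /\ exists2 eps, 0 < eps & {ae P, forall w, loops_decay lam eps (K^~ w)}).
- have [v_gt0|] := ltP 0 v; first by left; left.
  move=> v_le0; have v00 : v = 0 by apply/eqP; rewrite eq_le v_le0.
  have [dec|wait] := loops_dichotomy Klaw Kind K0 lam0; first by right.
  by left; right.
- have := persistent_lineage_fail Klaw Kind K0 hmu mu0 mu1 hm m1 lam0 v0 Jv Jpos Jconv ldp va Ja cases.
  apply: filterS => w small d' Om' Q N U Nlaw Ulaw NU.
  have := persistent_max Nlaw Ulaw NU hmu lam0 (fun x => K0 x w) small.
  apply: filterS => w' [C hC].
  near=> n; apply: le_trans (hC n); rewrite lerBrDl -lerBrDr -mulrBl mulrC -ler_pdivrMr ?subr_gt0 //.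
  by near: n; exact: nbhs_infty_ger.
move: va v0 Jv Jpos Jconv ldp; rewrite v00 => va _ J0 Jpos0 Jconv0 ldp0.
have := zero_speed_fail Klaw Kind K0 hmB hmu mu0 mu1 hm m1 lam0 J0 Jpos0 Jconv0 ldp0 eps0 dec va Ja.
apply: filterS => w [A [r [C [n0 [L0 [A0 r01 hL]]]]]] d' Om' Q N U Nlaw Ulaw NU.
exact: (max_from_decay Nlaw Ulaw NU hmu lam0 (fun x => K0 x w) b0 ba A0 r01 hL).
Unshelve. all: by end_near. Qed.

End lower_speed.

Unset Implicit Arguments.

Theorem theorem1p1
  (R : realType)
  (* the BGW tree: Ω carries i.i.d. child counts K u ~ p; tree of w is K^~ w *)
  (d : measure_display) (Omega : measurableType d) (P : probability Omega R)
  (p : nat -> R) (K : seq nat -> Omega -> nat)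
  (hp : prob_nat p) (hp0 : p 0%N = 0) (hp1 : p 1%N < 1)
  (hmB : exists mB : R, (fun n => \sum_(k < n) (k%:R * p k)) @ \oo --> mB)
  (hKlaw : nat_rv_law P K p)
  (hKind : indep1 P K (fun _ => True))
  (* bias and reproduction law *)
  (lam : R) (hlam : 0 < lam)
  (mu : nat -> R) (m : R)
  (hmu : prob_nat mu) (hmu0 : mu 0%N = 0) (hmu1 : mu 1%N < 1)
  (hm : (fun n => \sum_(k < n) (k%:R * mu k)) @ \oo --> m) (hm1 : 1 < m)
  (* v_lambda: the speed of the lambda-biased walk *)
  (v : R) (hv01 : 0 <= v <= 1)
  (hv : {ae P, forall w, forall (d' : measure_display) (Omega' : measurableType d')
          (Q : probability Omega' R) (V : nat -> Omega' -> R),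
          unif_rv Q V -> indep1 Q V measurable ->
          {ae Q, forall w', (fun n => (size (bwalk lam (K^~ w) V n w'))%:R / n%:R)
                              @ \oo --> v}})
  (* I_lambda: the large deviation rate function of the walk *)
  (I : R -> R)
  (hIv : I v = 0)
  (hIcont : {within `[v, 1], continuous I})
  (hIconv : forall a b t, v <= a <= 1 -> v <= b <= 1 -> 0 <= t <= 1 ->
              I (t * a + (1 - t) * b) <= t * I a + (1 - t) * I b)
  (hIincr : forall a b, v <= a -> a < b -> b <= 1 -> I a < I b)
  (hIq : {ae P, forall w, forall (d' : measure_display) (Omega' : measurableType d')
          (Q : probability Omega' R) (V : nat -> Omega' -> R),
          unif_rv Q V -> indep1 Q V measurable ->
          forall a b : R, v < a <= 1 -> a < b ->
          (fun n => ln (fine (Q [set w' | a <= (size (bwalk lam (K^~ w) V n w'))%:R / n%:R < b]))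
                    / n%:R) @ \oo --> - I a})
  (hIa : forall (d' : measure_display) (Omega' : measurableType d')
          (Q : probability Omega' R) (K' : seq nat -> Omega' -> nat)
          (V : nat -> Omega' -> R),
          nat_rv_law Q K' p -> unif_rv Q V -> indep2 Q K' (fun _ => True) V measurable ->
          indep1 Q K' (fun _ => True) -> indep1 Q V measurable ->
          forall a b : R, v < a <= 1 -> a < b ->
          (fun n => ln (fine (Q [set w' | a <= (size (bwalk lam (K'^~ w') V n w'))%:R / n%:R < b]))
                    / n%:R) @ \oo --> - I a) :
  {ae P, forall w, forall (d' : measure_display) (Omega' : measurableType d')
     (Q : probability Omega' R) (N : seq nat -> Omega' -> nat) (U : seq nat -> Omega' -> R),
     nat_rv_law Q N mu -> unif_rv Q U -> indep2 Q N (fun _ => True) U measurable ->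
     {ae Q, forall w', (fun n => (brw_max lam (K^~ w) N U n w')%:R / n%:R) @ \oo -->
        sup [set a : R | v <= a <= 1 /\ I a <= ln m]}}.
Proof.
pose laws (d' : measure_display) (Om' : measurableType d') (Q : probability Om' R)
  (N : seq nat -> Om' -> nat) (U : seq nat -> Om' -> R) :=
  [/\ nat_rv_law Q N mu, unif_rv Q U & indep2 Q N (fun _ => True) U measurable].
(* The rate function is known only through walks realized on some probability space. The
   displacements of a realized branching system supply such a walk; if there is none, the conclusion
   is vacuous. *)
have [[d0 [Om0 [Q0 [N0 [U0 laws0]]]]]|none] := pselect (exists (d0 : measure_display)
    (Om0 : measurableType d0) (Q0 : probability Om0 R) (N0 : seq nat -> Om0 -> nat)
    (U0 : seq nat -> Om0 -> R), laws d0 Om0 Q0 N0 U0); last first.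
  apply: nearW => w d' Om' Q N U h1 h2 h3; exfalso; apply: none.
  by exists d', Om', Q, N, U.
have ray_laws d' (Om' : measurableType d') (Q : probability Om' R) N U : laws d' Om' Q N U ->
    unif_rv Q (fun n => U (nseq n.+1 0%N)) /\ indep1 Q (fun n => U (nseq n.+1 0%N)) measurable.
  move=> [_ Ul NU]; split; last exact: indep_ray NU.
  by split=> [n|n B]; [exact: Ul.1|exact: Ul.2].
have [v0 v1] := andP hv01; have [mB hB] := hmB.
have m0 : 0 < m by exact: lt_trans hm1.
have lm : 0 < ln m by exact: ln_gt0.
have Ipos y : v < y <= 1 -> 0 < I y.
  by move=> /andP[vy y1]; rewrite -hIv; exact: hIincr.
have Klaw' := pos_offspring_law hKlaw hp0.
have Kind' := pos_offspring_indep hKind.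
set K' := pos_offspring K in Klaw' Kind'.
have K0 u w : (0 < K' u w)%N by rewrite /K' /pos_offspring leq_max.
have KK : {ae P, forall w, K^~ w = K'^~ w}.
  have := ae_positive hKlaw hp0; apply: filterS => w Kw; apply/funext => u.
  by rewrite /K' /pos_offspring; apply/esym/maxn_idPr.
have ldp : {ae P, forall w, forall y : R, v < y <= 1 ->
    (fun n => ln (tail lam (K'^~ w) n (ceiln (y * n%:R))) / n%:R) @ \oo --> - I y}.
  move: KK hIq; apply: filterS2 => w -> hI y vy.
  have [uV iV] := ray_laws _ _ _ _ _ laws0; have [NL UL NU] := laws0.
  have y0 : 0 < y by case/andP: vy => vy _; exact: le_lt_trans vy.
  apply: (ldp_of_walk NL UL NU hlam (fun x => K0 x w) y0).
  apply: (hI _ _ _ _ uV iV y 2 vy).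
  by case/andP: vy => _ y1; rewrite (le_lt_trans y1) // ltr1n.
pose S := [set a : R | v <= a <= 1 /\ I a <= ln m].
have Sv : S v by rewrite /S /= lexx v1 hIv ltW.
have supS : has_sup S by split; [exists v|exists 1 => y [/andP[_ ?] _]].
pose s := sup S.
have vs : v <= s by exact: (sup_upper_bound supS).
have s1 : s <= 1 by apply: ge_sup => [|y [/andP[]]]; first by exists v.
(* Countably many slopes suffice. For [v < s], [be i < al i < s] with [be i] tending to [s], and
   [I (al i) < ln m] because the set defining [s] has a point beyond [al i] and [I] is strictly
   increasing. *)
pose al i := s - (s - v) / i.+2%:R; pose be i := s - (s - v) / i.+1%:R.
have lower : {ae P, forall w, forall i, v < s -> forall (d' : measure_display) (Om' : measurableType d')
    (Q : probability Om' R) (N : seq nat -> Om' -> nat) (U : seq nat -> Om' -> R),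
    nat_rv_law Q N mu -> unif_rv Q U -> indep2 Q N (fun _ => True) U measurable ->
    {ae Q, forall w', \forall n \near \oo, be i * n%:R <= (brw_max lam (K'^~ w) N U n w')%:R}}.
  apply: ae_foralln => i; have [vs0|sv] := ltP v s; last first.
    by apply: nearW => w.
  have sv0 : 0 < s - v by rewrite subr_gt0.
  have als : al i < s by rewrite gtrBl divr_gt0.
  have val : v < al i.
    rewrite /al ltrBrDl -ltrBrDr ltr_pdivrMr // ltr_pMr // ltr1n //.
  have beal : be i < al i.
    by rewrite /be /al ltrD2l ltrN2 ltr_pM2l // ltf_pV2 ?posrE // ltr_nat.
  have be0 : 0 <= be i.
    rewrite /be subr_ge0 ler_pdivrMr // (le_trans (_ : _ <= s)) //.
      by rewrite lerBlDr lerDl.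
    by rewrite ler_peMr ?ler1n // (le_trans v0).
  have Ial : I (al i) < ln m.
    have sal : 0 < s - al i by rewrite subr_gt0.
    have [a [/andP[va a1] Ia]] := sup_adherent sal supS; rewrite subKr => ala.
    by apply: lt_le_trans Ia; apply: hIincr => //; exact: ltW.
  have := max_eventually_ge Klaw' Kind' K0 hB hmu hmu0 hmu1 hm hm1 hlam v0 hIv Ipos hIconv ldp
    (a := al i) (b := be i).
  rewrite val (le_trans (ltW als)) // be0 beal => /(_ isT Ial isT).
  by apply: filterS => w h _; exact: h.
have {}lower : {ae P, forall w, (forall y : R, v < y <= 1 ->
    (fun n => ln (tail lam (K'^~ w) n (ceiln (y * n%:R))) / n%:R) @ \oo --> - I y) /\
    forall i, v < s -> forall (d' : measure_display) (Om' : measurableType d')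
    (Q : probability Om' R) (N : seq nat -> Om' -> nat) (U : seq nat -> Om' -> R),
    nat_rv_law Q N mu -> unif_rv Q U -> indep2 Q N (fun _ => True) U measurable ->
    {ae Q, forall w', \forall n \near \oo, be i * n%:R <= (brw_max lam (K'^~ w) N U n w')%:R}}.
  by move: ldp lower; apply: filterS2.
move: KK hv lower; apply: filterS3 => w -> hvw [ldpw low] d' Om' Q N U Nl Ul NU.
have kap0 x := K0 x w; set kap := K'^~ w in kap0 hvw ldpw low *.
have [uV iV] := ray_laws d' Om' Q N U (And3 Nl Ul NU).
have walkV := hvw d' Om' Q _ uV iV.
have Npos := ae_positive Nl hmu0.
have Qlow : {ae Q, forall w', forall i, v < s ->
    \forall n \near \oo, be i * n%:R <= (brw_max lam kap N U n w')%:R}.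
  apply: ae_foralln => i; have [vs0|sv] := ltP v s; last first.
    by apply: nearW => w'.
  by have := low i vs0 _ _ _ _ _ Nl Ul NU; apply: filterS => w' h _; exact: h.
(* For [s < 1] these slopes decrease to [s] within [[s, 1]]; they exceed the supremum, so
   [I (ga i) > ln m]. *)
pose ga i := s + (1 - s) / i.+1%:R.
have Qup : {ae Q, forall w', forall i, s < 1 ->
    \forall n \near \oo, (brw_max lam kap N U n w')%:R < ga i * n%:R}.
  apply: ae_foralln => i; have [s1'|s1'] := ltP s 1; last first.
    by apply: nearW => w'.
  have os0 : 0 < 1 - s by rewrite subr_gt0.
  have sga : s < ga i by rewrite ltrDl divr_gt0.
  have ga1 : ga i <= 1.
    by rewrite /ga -lerBrDl ler_pdivrMr // ler_peMr ?ler1n // ltW.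
  have vga : v < ga i <= 1 by rewrite ga1 andbT (le_lt_trans vs).
  have Iga : ln m < I (ga i).
    rewrite ltNge; apply/negP => Iga.
    have : S (ga i) by split=> //; rewrite ga1 andbT; case/andP: vga => /ltW.
    by move=> /(sup_upper_bound supS); rewrite leNgt sga.
  have ga0 : 0 < ga i by case/andP: vga => vga _; exact: le_lt_trans vga.
  have := max_eventually_lt Nl Ul NU hmu hlam kap0 hm hm1 ga0 Iga (ldpw _ vga).
  by apply: filterS => w' h _; exact: h.
have Qlow' : {ae Q, forall w', (forall u, (0 < N u w')%N) /\ forall i, v < s ->
    \forall n \near \oo, be i * n%:R <= (brw_max lam kap N U n w')%:R}.
  by move: Npos Qlow; apply: filterS2.
move: walkV Qlow' Qup; apply: filterS3 => w' walkw [Nw loww] upw.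
have small (c e : R) : 0 <= c -> 0 < e -> exists i : nat, c / i.+1%:R < e.
  move=> c0 e0; exists (Num.truncn (c / e)); rewrite ltr_pdivrMr // mulrC -ltr_pdivrMr //.
  exact: truncnS_gt.
have size_le n : (brw_max lam kap N U n w' <= n)%N by exact: max_le_time.
have ray_le n : (size (bwalk lam kap (fun n => U (nseq n.+1 0%N)) n w') <= brw_max lam kap N U n w')%N.
  by rewrite bwalk_ray; exact: max_ge_ray.
apply: cvg_of_bounds => e e0; rewrite -/s.
- have [vs0|sv] := ltP v s.
    have sv0 : 0 <= s - v by rewrite subr_ge0.
    have [i hi] := small _ _ sv0 e0; have := loww i vs0; apply: filterS2 (nbhs_infty_gt 0) => n n0 h.
    have n0' : 0 < n%:R :> R by rewrite ltr0n.
    rewrite (@lt_le_trans _ _ (be i)) //; last by rewrite ler_pdivlMr.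
    by rewrite /be ltrD2l ltrN2.
  (* If [s = v], the lower bound comes from the speed of the walk along the lineage of first
     children. *)
  have -> : s = v by apply/eqP; rewrite eq_le sv.
  have /cvgrPdist_lt /(_ _ e0) := walkw; apply: filterS2 (nbhs_infty_gt 0) => n n0.
  have n0' : 0 < n%:R :> R by rewrite ltr0n.
  rewrite ltr_norml => /andP[_ h].
  apply: (lt_le_trans (y := (size (bwalk lam kap (fun n => U (nseq n.+1 0%N)) n w'))%:R / n%:R)).
    by move: h; lra.
  by rewrite ler_pM2r ?invr_gt0 // ler_nat.
have [s1'|s1'] := ltP s 1.
  have s10 : 0 <= 1 - s by rewrite subr_ge0.
  have [i hi] := small _ _ s10 e0; have := upw i s1'; apply: filterS2 (nbhs_infty_gt 0) => n n0 h.
  have n0' : 0 < n%:R :> R by rewrite ltr0n.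
  rewrite (@lt_le_trans _ _ (ga i)) //; first by rewrite ltr_pdivrMr.
  by rewrite /ga lerD2l ltW.
(* If [s = 1], the upper bound is the trivial one: the maximum is at most [n]. *)
near=> n.
have n0' : 0 < n%:R :> R by rewrite ltr0n; near: n; exact: nbhs_infty_gt.
rewrite (@le_lt_trans _ _ 1) //; first by rewrite ler_pdivrMr // mul1r ler_nat.
by rewrite (le_lt_trans s1') // ltrDl.
Unshelve. all: by end_near. Qed.
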